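(* For every $d\ge 2$ and every $N\ge 4$ there is a simplicial $d$-polytope with $N+\Theta(d^2)$ vertices whose boundary complex is vertex-decomposable, and two facets $F_1$ and $F_2$ of this boundary complex, such that every monotone conservative path between $F_1$ and $F_2$ has length at least $2^{d-3}N$.
   Context: Here $N+\Theta(d^2)$ means that the number of vertices minus $N$ lies between $c_1d^2$ and $c_2d^2$ for absolute constants $c_1,c_2>0$. All simplicial complexes are finite. A complex is pure of dimension $d-1$ (a $(d-1)$-complex) if all its facets (inclusion-maximal faces) have $d$ elements. Two facets are adjacent if they differ in a single vertex; this defines the dual graph. A dual path is a path $[F_0,\dots,F_m]$ in the dual graph, and its length is $m$. A pure complex is normal if between every two facets $F,F'$ there is a dual path consisting only of facets containing $F\cap F'$ (boundary complexes of simplicial polytopes are normal). The link of a vertex $v$ is $\mathrm{lk}_C(v)=\{f\in C: v\notin f,\ f\cup\{v\}\in C\}$, and the deletion is $\mathrm{del}_C(v)=\{f\in C: v\notin f\}$. A pure $(d-1)$-complex $C$ is vertex-decomposable if it is a simplex or if there is a vertex $x$ of $C$ such that $\mathrm{lk}_C(x)$ and $\mathrm{del}_C(x)$ are both vertex-decomposable and $\mathrm{del}_C(x)$ is pure of dimension $d-1$. Vertex-distance. $\mathrm{vdist}_C(u,v)$ is the graph distance in the 1-skeleton of $C$, and $\mathrm{vdist}_C(S,S')=\min_{u\in S,v\in S'}\mathrm{vdist}_C(u,v)$, equal to $\infty$ if $S$ or $S'$ is empty. If $\dim C=0$, then for nonempty $S,S'$ one sets $\mathrm{vdist}_C(S,S')=0$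 if $S\cap S'\neq\emptyset$ and $1$ otherwise. Vector of distances. Let $F=(v_1,\dots,v_d)$ be an ordered facet (a facet with an ordering of its vertices) of a pure $(d-1)$-complex $C$ and $S$ a set of vertices of $C$ (target set). The vector of distances $(\lambda_1,\dots,\lambda_d)$ from $F$ to $S$ is defined recursively: $\lambda_1=\mathrm{vdist}_C(v_1,S)$, and $(\lambda_2,\dots,\lambda_d)$ is the vector of distances from $F\setminus v_1$ (with induced order) to $S'$ in $\mathrm{lk}_C(v_1)$, where, with $V_1$ the vertex set of $\mathrm{lk}_C(v_1)$, $S'=\{v\in V_1:\mathrm{vdist}_C(v,S)=\mathrm{vdist}_C(v_1,S)-1\}$ if $v_1\notin S$, and $S'=S\cap V_1$ if $v_1\in S$. (If the target set is empty at some stage, all entries from there on are $\infty$.) The ordering is admissible with respect to $S$ if $\lambda_1=\mathrm{vdist}_C(F,S)$ and $F\setminus v_1$ is admissible with respect to $S'$ in $\mathrm{lk}_C(v_1)$ (the empty ordered facet is admissible). Monotone conservative paths. Let $C$ be pure and normal, $S$ a nonempty target set, and $[F_0,\dots,F_m]$ a dual path of ordered facets. It is monotone towards $S$ if the vectors of distances of $F_0,\dots,F_m$ to $S$ are strictly lexicographically decreasing. The index of a step from $F_{i-1}=(v_1,\dots,v_d)$ to $F_i=(v_1',\dots,v_d')$ is the minimum $k$ with $v_k\neq v_k'$. The step is conservative towards $S$ if (i) the vertex in $F_{i-1}\setminus F_i$ is the last vertex in the ordering of $F_{i-1}$, and (ii) the ordering of $F_i$ is admissible with respect to $S$ and has the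 maximum index among all admissible reorderings of $F_i$. The path is conservative towards $S$ if $F_0$ is admissible with respect to $S$ and every step is conservative. A monotone conservative path from a facet $F$ to a facet $F'$ is a dual path of ordered facets that starts at $F$, ends at $F'$, and is monotone and conservative towards the target set $S=F'$; a monotone conservative path between $F_1$ and $F_2$ is one from $F_1$ to $F_2$ or from $F_2$ to $F_1$. *)

(* Defs.v *)
From HB Require Import structures.
From mathcomp Require Import all_boot all_order all_algebra.
From mathcomp Require Import boolp.

Set Implicit Arguments.
Unset Strict Implicit.
Unset Printing Implicit Defensive.

Import Order.TTheory GRing.Theory Num.Theory.

(** * Simplicial complexes *)

(* A finite complex on vertices taken from [V] is its set of faces, the empty
   face included.  An element of [V] is a vertex of [C] only if it is in
   [vertices C]. *)
Section Complexes.
Variable V : finType.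
Implicit Types (C : {set {set V}}) (F G : {set V}) (x v : V).

Definition simplicial_complex C :=
  set0 \in C /\ forall F G, G \subset F -> F \in C -> G \in C.

Definition vertices C : {set V} := [set v | [set v] \in C].

Definition facets C : {set {set V}} := [set F | maxset (fun G => G \in C) F].

(* Pure of dimension [k - 1]. *)
Definition pure_complex (k : nat) C :=
  simplicial_complex C /\ forall F, F \in facets C -> #|F| = k.

Definition link C v : {set {set V}} := [set F in C | (v \notin F) && (v |: F \in C)].

Definition deletion C v : {set {set V}} := [set F in C | v \notin F].

(* The simplex on the empty vertex set, the complex [set set0] of dimension -1,
   is included: it is the link of a vertex of a 0-dimensional complex. *)
Inductive vertex_decomposable : {set {set V}} -> Prop :=
| vd_simplex F : vertex_decomposable (powerset F)
| vd_shed k C x :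
    pure_complex k C -> x \in vertices C ->
    vertex_decomposable (link C x) ->
    vertex_decomposable (deletion C x) ->
    pure_complex k (deletion C x) ->
    vertex_decomposable C.

Definition adjacent F G := (#|F :\: G| == 1) && (#|G :\: F| == 1).

End Complexes.

(** * Distances: natural numbers with infinity, encoded as [None] *)

Definition dist_le (a b : option nat) : bool :=
  match a, b with
  | _, None => true
  | None, Some _ => false
  | Some m, Some n => m <= n
  end.

Definition dist_min (a b : option nat) := if dist_le a b then a else b.

Definition dist_lt (a b : option nat) := ~~ dist_le b a.

Fixpoint lex_lt (s t : seq (option nat)) : bool :=
  match s, t with
  | a :: s', b :: t' => dist_lt a b || ((a == b) && lex_lt s' t')
  | [::], _ :: _ => true
  | _, [::] => false
  end.

Section Distances.
Variable V : finType.
Implicit Types (C : {set {set V}}) (u v : V) (S T : {set V}).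

Definition edge C : rel V := fun u v => (u != v) && ([set u; v] \in C).

Definition walk_of_length C u v (k : nat) : bool :=
  [exists t : k.-tuple V, path (edge C) u t && (last u t == v)].

Definition graph_dist C u v : option nat :=
  if pselect (exists k, walk_of_length C u v k) is left walk_uv
  then Some (ex_minn walk_uv) else None.

Definition zero_dim C : bool := \max_(F in C) #|F| == 1.

Definition vdist C S T : option nat :=
  if zero_dim C then
    if (S == set0) || (T == set0) then None
    else Some (if S :&: T != set0 then 0 else 1)
  else \big[dist_min/None]_(u in S) \big[dist_min/None]_(v in T) graph_dist C u v.

(* The target set in [link C v].  It is empty when [v] is at infinite distance
   from [S], in particular when [S] is empty, so that from there on all entries
   of the vector of distances are infinite. *)
Definition next_target C v S : {set V} :=
  if v \in S then S :&: vertices (link C v)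
  else if vdist C [set v] S is Some k.+1
  then [set w in vertices (link C v) | vdist C [set w] S == Some k]
  else set0.

Fixpoint dist_vector C (F : seq V) S : seq (option nat) :=
  if F is v :: F' then
    vdist C [set v] S :: dist_vector (link C v) F' (next_target C v S)
  else [::].

Fixpoint admissible C (F : seq V) S : bool :=
  if F is v :: F' then
    (vdist C [set v] S == vdist C [set:: F] S)
      && admissible (link C v) F' (next_target C v S)
  else true.

End Distances.

(** * Monotone conservative paths *)

Section Paths.
Variable V : finType.
Implicit Types (C : {set {set V}}) (S : {set V}) (F G : seq V) (Fs : seq (seq V)).

Definition ordered_facet C F := uniq F && ([set:: F] \in facets C).

(* A path of ordered facets is given by its first element [F] and the sequence
   [Fs] of the other ones; its length is [size Fs]. *)
Definition dual_path C F Fs :=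
  all (ordered_facet C) (F :: Fs) &&
  path (fun G H => adjacent [set:: G] [set:: H]) F Fs.

Definition monotone C S F Fs :=
  path (fun G H => lex_lt (dist_vector C H S) (dist_vector C G S)) F Fs.

(* Positions are counted from 1. *)
Definition step_index F G : nat :=
  (find (fun vw => vw.1 != vw.2) (zip F G)).+1.

Definition conservative_step C S F G : bool :=
  [&& [exists v, ([set:: F] :\: [set:: G] == [set v]) && (v == last v F)],
      admissible C G S &
      all (fun G' => admissible C G' S ==> (step_index F G' <= step_index F G))
          (permutations G)].

Definition conservative C S F Fs :=
  admissible C F S && path (conservative_step C S) F Fs.

Definition mono_cons_path C (A B : {set V}) F Fs :=
  [/\ dual_path C F Fs, [set:: F] = A, [set:: last F Fs] = B,
      monotone C B F Fs & conservative C B F Fs].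

Definition mono_cons_path_between C (A B : {set V}) F Fs :=
  mono_cons_path C A B F Fs \/ mono_cons_path C B A F Fs.

End Paths.

(** * Simplicial polytopes *)

From mathcomp Require Import classical_sets reals.

Local Open Scope ring_scope.
Local Open Scope classical_set_scope.

Section Polytopes.
Variables (R : realType) (d : nat).
Implicit Types (P G : set 'rV[R]_d) (a x : 'rV[R]_d).

Definition dot a x : R := \sum_j a 0 j * x 0 j.

Definition face P G :=
  exists a (b : R), (forall x, P x -> dot a x <= b)
                    /\ G = P `&` [set x | dot a x = b].

Definition proper_face P G := face P G /\ G <> P.

Variable n : nat.
Implicit Type p : 'I_n -> 'rV[R]_d.

Definition conv_hull p : set 'rV[R]_d :=
  [set x | exists w : 'I_n -> R,
     [/\ forall i, 0 <= w i, \sum_i w i = 1 & x = \sum_i w i *: p i]].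

Definition aff_hull p : set 'rV[R]_d :=
  [set x | exists w : 'I_n -> R, \sum_i w i = 1 /\ x = \sum_i w i *: p i].

Definition aff_independent p (A : set 'I_n) :=
  forall w : 'I_n -> R, (forall i, ~ A i -> w i = 0) ->
    \sum_i w i = 0 -> \sum_i w i *: p i = 0 -> forall i, w i = 0.

(* [p] lists, without repetition, the vertices of a [d]-dimensional simplicial
   polytope in R^d. *)
Definition simplicial_polytope p :=
  [/\ injective p,
      [set x | face (conv_hull p) [set x]] = range p,
      aff_hull p = setT &
      forall G, proper_face (conv_hull p) G -> aff_independent p (p @^-1` G)].

(* Faces are recorded by the indices of their vertices. *)
Definition boundary_complex p : {set {set 'I_n}} :=
  [set A : {set 'I_n} | `[< exists2 G, proper_face (conv_hull p) G &
                                       [set` A] = p @^-1` G >]]%SET.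

End Polytopes.

(* Main.v *)
(** Suspending a [d]-polytope at a vertex [w] (one-point suspension) replaces [w] by
    an edge [ab] such that the links of [a] and [b] are both copies of the old
    boundary complex.  Suppose that conservative paths from a facet [A] to [w], and
    from [w] to [A], have length at least [l].  Stack new vertices over the facets
    [a |: A] and [b |: A] until the last ones are isolated from all of the old
    vertices, [b] being the only old vertex that is closer than [a] to those over
    [b |: A].  A conservative path from one end to the other must then first cross the
    link of [a] from [A] to [b], with [a] as its lead (first vertex), and afterwards
    the link of [b] from [a] to [A], with [b] as its lead, which takes [2 * l] steps.
    One dimension thus costs [4 * d + 2] vertices and doubles the length; the
    induction starts with a polygon.

    For the induction the bound has to hold for every complex that agrees with the
    constructed one except beyond the two end facets ([far], [agree]), since links
    contain the vertices that are stacked later. *)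

Require Import Defs.
From mathcomp Require Import all_boot all_order all_fingroup all_algebra.
From mathcomp Require Import boolp reals.
From mathcomp Require classical_sets.
From mathcomp Require Import zify lra.

Set Implicit Arguments.
Unset Strict Implicit.
Unset Printing Implicit Defensive.

Import Order.TTheory GRing.Theory Num.Theory.

(** * Distances to a target set *)

(** The index rule carries the bound. A lead that attains the distance of the next facet to the
    target must stay first, so it gives way only to a strictly closer vertex; until then the path
    can be read in the link of the lead, as a conservative path towards the next target.

    The two layers at each end control who may take the lead. Vertices of [A] can be as close to the
    target as [a]; the inner layer on the side of [a] keeps them out of every facet that meets the
    outer layer. The vertices of the inner layer are never closer than those of the outer one, and
    in a tie the lead stays, so only [a] can take over. On the side of [b], the two layers make
    every old vertex other than [b] strictly farther from the target than [b].

    The suspended vertex [w] is itself stacked over the end facet [B]. Deleting it gives back the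
    old complex without [B], and a suspension is decomposed through this deletion. This is why the
    induction also maintains that the complexes without an end facet are vertex-decomposable. *)

Lemma dist_le_refl x : dist_le x x.
Proof. by case: x => /=. Qed.

Lemma dist_le_trans : transitive dist_le.
Proof. by move=> [y|] [x|] [z|] //=; apply: leq_trans. Qed.

Lemma dist_le_total : total dist_le.
Proof. by move=> [x|] [y|] //=; apply: leq_total. Qed.

Lemma dist_minl x y : dist_le (dist_min x y) x.
Proof.
by rewrite /dist_min; case: ifP => [_|/negP nxy]; rewrite ?dist_le_refl //; case/orP: (dist_le_total x y).
Qed.

Lemma dist_minr x y : dist_le (dist_min x y) y.
Proof. by rewrite /dist_min; case: ifP => //; rewrite dist_le_refl. Qed.

Lemma dist_min_or x y : dist_min x y = x \/ dist_min x y = y.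
Proof. by rewrite /dist_min; case: ifP; [left|right]. Qed.

Lemma big_dist_min_le (I : eqType) (r : seq I) (P : pred I) (F : I -> option nat) i :
  i \in r -> P i -> dist_le (\big[dist_min/None]_(j <- r | P j) F j) (F i).
Proof.
elim: r => [//|j r IHr]; rewrite inE big_cons => /predU1P[<- Pi|ri Pi].
  by rewrite Pi dist_minl.
by case: ifP => _; [apply: dist_le_trans (dist_minr _ _) _|]; apply: IHr.
Qed.

Lemma big_dist_min_ex (I : finType) (P : pred I) (F : I -> option nat) k :
  \big[dist_min/None]_(j | P j) F j = Some k -> exists2 i, P i & F i = Some k.
Proof.
apply: (big_ind (fun x => x = Some k -> exists2 i, P i & F i = Some k)) => //.
  by move=> x y IHx IHy; case: (dist_min_or x y) => ->.
by move=> i; exists i.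
Qed.

Section Distance.
Variable V : finType.
Implicit Types (C : {set {set V}}) (S T : {set V}) (u v w : V).

Lemma walk0 C u v : walk_of_length C u v 0 = (u == v).
Proof.
by apply/existsP/eqP => [[t]|->]; [rewrite tuple0 => /eqP|exists [tuple]; rewrite /= eqxx].
Qed.

Lemma walkS C u v k :
  reflect (exists2 w, edge C u w & walk_of_length C w v k) (walk_of_length C u v k.+1).
Proof.
apply: (iffP existsP) => [[t]|[w uw /existsP[t wv]]].
  case/tupleP: t => w t /= /andP[/andP[uw pt] lt].
  by exists w => //; apply/existsP; exists t; rewrite pt.
by exists [tuple of w :: t] => /=; rewrite uw.
Qed.

Lemma graph_distP C u v k : graph_dist C u v = Some k ->
  walk_of_length C u v k.
Proof. by rewrite /graph_dist; case: pselect => // w [<-]; case: ex_minnP. Qed.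

Lemma graph_dist_le C u v k : walk_of_length C u v k -> dist_le (graph_dist C u v) (Some k).
Proof.
rewrite /graph_dist; case: pselect => [w uv|nw uv] /=; last by case: nw; exists k.
by case: ex_minnP => m _; apply.
Qed.

Section FixedTarget.
Variables (C : {set {set V}}) (S : {set V}).
Hypothesis C_dim : zero_dim C = false.
Let D v := vdist C [set v] S.

Lemma vdist1E v : D v = \big[dist_min/None]_(s in S) graph_dist C v s.
Proof.
rewrite /D /vdist C_dim big_set1E.
by case: (\big[_/_]_(s in S) _).
Qed.

Lemma vdist_walk v k :
  (exists2 s, s \in S & walk_of_length C v s k) -> dist_le (D v) (Some k).
Proof.
case=> s Ss vs; rewrite vdist1E.
by apply: dist_le_trans (graph_dist_le vs); apply: big_dist_min_le; rewrite ?mem_index_enum.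
Qed.

Lemma vdist_ex_walk v k : D v = Some k -> exists2 s, s \in S & walk_of_length C v s k.
Proof. by rewrite vdist1E => /big_dist_min_ex[s Ss /graph_distP]; exists s. Qed.

Lemma vdist_eq0 v : (D v == Some 0) = (v \in S).
Proof.
apply/eqP/idP => [/vdist_ex_walk[s Ss]|Sv]; first by rewrite walk0 => /eqP->.
have: dist_le (D v) (Some 0) by apply: vdist_walk; exists v; rewrite ?walk0.
by case: (D v) => [[]|].
Qed.

Lemma vdist_edge u v k : edge C u v -> D v = Some k -> dist_le (D u) (Some k.+1).
Proof.
move=> uv /vdist_ex_walk[s Ss vs]; apply: vdist_walk; exists s => //.
by apply/walkS; exists v.
Qed.

Lemma vdist_descent v k : D v = Some k.+1 -> exists2 u, edge C v u & D u = Some k.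
Proof.
move=> Dv; have [s Ss /walkS[u vu us]] := vdist_ex_walk Dv; exists u => //.
have: dist_le (D u) (Some k) by apply: vdist_walk; exists s.
case Du: (D u) => [j|] //= jk; have := vdist_edge vu Du.
by rewrite Dv /= => kj; congr Some; apply/eqP; rewrite eqn_leq jk.
Qed.

Lemma vdist_set T : vdist C T S = \big[dist_min/None]_(u in T) D u.
Proof.
by rewrite {1}/vdist C_dim; apply: eq_bigr => u _; rewrite -/(D u) vdist1E.
Qed.

End FixedTarget.

Lemma vdist_le C S T u : u \in T -> dist_le (vdist C T S) (vdist C [set u] S).
Proof.
move=> Tu; have T0: T != set0 by apply/set0Pn; exists u.
case zC: (zero_dim C); last first.
  by rewrite (vdist_set S zC); apply: big_dist_min_le; rewrite ?mem_index_enum.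
have u0: ([set u] == set0) = false by apply/negbTE/set0Pn; exists u; rewrite set11.
rewrite /vdist zC (negPf T0) u0 /=; case: (S == set0) => //=.
case: ifP => // /negbFE/eqP/setP TS; case: ifP => // /set0Pn[x].
by rewrite !inE => /andP[/eqP-> Su]; have := TS u; rewrite !inE Tu Su.
Qed.

Lemma vdist_attained C S T : T != set0 ->
  exists2 u, u \in T & vdist C [set u] S = vdist C T S.
Proof.
move=> T0; case/set0Pn: (T0) => x Tx.
case zC: (zero_dim C); last first.
  case E: (vdist C T S) => [k|].
    by move: E; rewrite (vdist_set S zC) => /big_dist_min_ex[u]; exists u.
  exists x => //; have := vdist_le C S Tx; rewrite E; by case: (vdist C [set x] S).
have s0 u: ([set u] == set0) = false by apply/negbTE/set0Pn; exists u; rewrite set11.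
case S0: (S == set0).
  by exists x => //; rewrite /vdist zC S0 !orbT.
case: (boolP (T :&: S == set0)) => [TS|TS].
  exists x => //; rewrite /vdist zC S0 s0 (negPf T0) TS /=.
  suff ->: [set x] :&: S == set0 by [].
  apply/eqP/setP => y; rewrite !inE; apply/negbTE/negP => /andP[/eqP-> Sx].
  by move/eqP/setP/(_ x): TS; rewrite !inE Tx Sx.
case/set0Pn: (TS) => y; rewrite inE => /andP[Ty Sy]; exists y => //.
rewrite /vdist zC S0 s0 (negPf T0) TS /=.
suff ->: [set y] :&: S != set0 by [].
by apply/set0Pn; exists y; rewrite !inE eqxx.
Qed.

End Distance.

(** * Conservative paths and links *)

Section ConservativePaths.
Variable V : finType.
Implicit Types (C : {set {set V}}) (S T A B : {set V}) (u v w c : V).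
Implicit Types (F G H : seq V) (Fs Gs : seq (seq V)).

Lemma set_seq_cons c G : [set:: c :: G] = c |: [set:: G].
Proof. by apply/setP => x; rewrite !inE. Qed.

Lemma set_seq_consD1 c G : uniq (c :: G) -> [set:: c :: G] :\ c = [set:: G].
Proof.
move=> /= /andP[cG _]; apply/setP => x; rewrite !inE.
by case: eqVneq => [->|]; rewrite ?(negPf cG).
Qed.

Lemma card_set_seq G : uniq G -> #|[set:: G]| = size G.
Proof. by move=> uG; rewrite cardsE; apply/card_uniqP. Qed.

Lemma uniq_set_seq_perm F G : uniq F -> uniq G -> [set:: F] = [set:: G] -> perm_eq F G.
Proof. by move=> uF uG /setP FG; apply: uniq_perm => // x; have := FG x; rewrite !inE. Qed.

Lemma uniq_set_seq_perm_of F G : perm_eq F G -> uniq G -> uniq F /\ [set:: F] = [set:: G].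
Proof.
move=> FG uG; rewrite (perm_uniq FG); split=> //.
by apply/setP => x; rewrite !inE (perm_mem FG).
Qed.

(** Greedy choice: put a vertex that attains the distance of [A] first, and order the rest in its
    link. *)
Lemma admissible_ex C S A : exists G, [/\ uniq G, [set:: G] = A & admissible C G S].
Proof.
move: {2}#|A| (leqnn #|A|) => n; elim: n => [|n IHn] in C S A *.
  rewrite leqn0 cards_eq0 => /eqP->.
  by exists [::]; split.
move=> leA; have [->|A0] := eqVneq A set0.
  by exists [::]; split.
have [u Au uA] := vdist_attained C S A0.
have [|G [uG GA adm]] := IHn (link C u) (next_target C u S) (A :\ u).
  by move: leA; rewrite (cardsD1 u) Au.
exists (u :: G); rewrite /= set_seq_cons GA setD1K // uA eqxx; split=> //.
by rewrite uG andbT -[u \in G](in_set (mem G)) GA !inE eqxx.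
Qed.

Lemma step_index_cons a b F G :
  step_index (a :: F) (b :: G) = if a == b then (step_index F G).+1 else 1.
Proof. by rewrite /step_index /=; case: eqP. Qed.

(** Faces with [d] elements stand in for facets: the complexes met below are known only in part, and
    this form passes to links without any purity. *)
Definition face_path d C F Fs :=
  all (fun G => [&& uniq G, size G == d & [set:: G] \in C]) (F :: Fs)
  && path (fun G H => adjacent [set:: G] [set:: H]) F Fs.

Definition cons_path d C S F Fs := face_path d C F Fs && conservative C S F Fs.

Lemma cons_path_cons d C S F G Fs :
  cons_path d C S F (G :: Fs) =
  [&& cons_path d C S F [::], adjacent [set:: F] [set:: G], conservative_step C S F G &
      cons_path d C S G Fs].
Proof.
rewrite /cons_path /face_path /conservative /= !andbT.
apply/idP/idP.
  move=> /andP[/andP[/andP[-> /andP[-> ->]] /andP[-> ->]] /andP[-> /andP[cFG ->]]].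
  by rewrite cFG; case/and3P: cFG => _ ->.
by move=> /and4P[/andP[-> ->] -> -> /andP[/andP[/andP[-> ->] ->] /andP[_ ->]]].
Qed.

(** Since [c] attains the distance, some admissible ordering of the new facet begins with [c] and
    has index at least 2. The chosen ordering has maximal index, so its first vertex is [c] too. *)
Lemma conservative_lead C S c F G :
  conservative_step C S (c :: F) G -> uniq G -> c \in G ->
  vdist C [set c] S = vdist C [set:: G] S -> exists G', G = c :: G'.
Proof.
case/and3P=> _ admG /allP maxG uG cG dc.
have [H [uH HG admH]] := admissible_ex (link C c) (next_target C c S) ([set:: G] :\ c).
have GE : [set:: c :: H] = [set:: G] by rewrite set_seq_cons HG setD1K ?inE.
have ucH : uniq (c :: H).
  by rewrite /= uH andbT -[c \in H](in_set (mem H)) HG !inE eqxx.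
have := maxG (c :: H); rewrite mem_permutations uniq_set_seq_perm //= => /(_ isT).
rewrite admH andbT GE dc eqxx /= step_index_cons eqxx.
by case: G {admG maxG uG cG dc GE HG} => // g G; rewrite step_index_cons; case: eqP => // <- _; exists G.
Qed.

Lemma dropped_last C S c F G : uniq (c :: F) -> F != [::] ->
  conservative_step C S (c :: F) G ->
  exists v, [/\ [set:: c :: F] :\: [set:: G] = [set v], v = last c F & v != c].
Proof.
move=> /= /andP[cF uF] F0 /and3P[/existsP[v /andP[/eqP FG /eqP vl]] _ _].
exists v; split=> //; rewrite vl; case: F F0 cF {uF FG vl} => //= x F _.
by apply: contraNneq => <-; apply: mem_last.
Qed.

Lemma lead_kept C S c F G : uniq (c :: F) -> F != [::] ->
  conservative_step C S (c :: F) G -> c \in G.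
Proof.
move=> uF F0 /(dropped_last uF F0)[v [/setP FG _ vc]].
by have := FG c; rewrite !inE eqxx /= eq_sym (negPf vc) andbT => /negbFE.
Qed.

(* The step into the facet where the lead changes is still a conservative step
   of the link of the old lead, for a suitable ordering of that facet. *)
Lemma conservative_step_link C S c F G : uniq (c :: F) -> F != [::] -> uniq G ->
  conservative_step C S (c :: F) G ->
  exists H, [/\ uniq H, [set:: H] = [set:: G] :\ c &
                conservative_step (link C c) (next_target C c S) F H].
Proof.
move=> uF F0 uG cFG; have [v [FG vl vc]] := dropped_last uF F0 cFG.
have cG := lead_kept uF F0 cFG.
set C' := link C c; set S' := next_target C c S.
have [H0 [uH0 H0G admH0]] := admissible_ex C' S' ([set:: G] :\ c).
(* [P] holds of the indices attained by admissible orderings of [G] without [c]; an ordering that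
   attains the largest one makes the step conservative in the link. *)
pose P := [pred k | has (fun H => admissible C' H S' && (step_index F H == k)) (permutations H0)].
have P0 : exists k, P k.
  exists (step_index F H0); apply/hasP; exists H0; rewrite ?mem_permutations //.
  by rewrite admH0 /=.
have Pmax k : P k -> k <= \max_(H <- permutations H0) step_index F H.
  by move=> /hasP[H HH /andP[_ /eqP<-]]; apply: leq_bigmax_seq.
case: (ex_maxnP P0 Pmax) => k /hasP[H HH /andP[admH /eqP Hk]] kmax.
move: HH; rewrite mem_permutations => HH.
have [uH HS] := uniq_set_seq_perm_of HH uH0.
exists H; split; rewrite ?HS //; apply/and3P; split=> //.
- apply/existsP; exists v; apply/andP; split; last first.
    by rewrite vl; case: (F) F0.
  rewrite HS H0G -FG; apply/eqP/setP => x; rewrite !inE.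
  by case: (eqVneq x c) uF => [->|_] /=; rewrite ?cG //; case: (c \in F).
- apply/allP => H'; rewrite mem_permutations => H'H; apply/implyP => admH'.
  rewrite Hk; apply: kmax; apply/hasP; exists H'; last by rewrite admH' /=.
  by rewrite mem_permutations (perm_trans H'H).
Qed.

(** Putting [c] in front raises every index by 1 and keeps admissibility, so maximality of the index
    passes to the link. *)
Lemma conservative_step_behead C S c F G : uniq (c :: F) -> F != [::] -> uniq (c :: G) ->
  conservative_step C S (c :: F) (c :: G) ->
  conservative_step (link C c) (next_target C c S) F G.
Proof.
move=> uF F0 uG cFG; have [v [FG vl vc]] := dropped_last uF F0 cFG.
case/and3P: cFG => _ /andP[/eqP dc admG] /allP maxG; apply/and3P; split=> //.
- apply/existsP; exists v; apply/andP; split; last by rewrite vl; case: (F) F0.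
  apply/eqP/setP => x; move/setP/(_ x): FG; rewrite !inE.
  case: (eqVneq x c) uF => [->|//] /= /andP[/negPf-> _].
  by rewrite andbF.
- apply/allP => H; rewrite mem_permutations => HG; apply/implyP => admH.
  have := maxG (c :: H); rewrite mem_permutations perm_cons HG => /(_ isT).
  have [_ HS] : uniq (c :: H) /\ [set:: c :: H] = [set:: c :: G].
    by apply: uniq_set_seq_perm_of; rewrite ?perm_cons.
  by rewrite /= HS dc eqxx admH /= !step_index_cons eqxx ltnS.
Qed.

Lemma link_face C c F : simplicial_complex C -> uniq (c :: F) ->
  [set:: c :: F] \in C -> [set:: F] \in link C c.
Proof.
move=> [_ sC] /= /andP[cF _] CF; rewrite inE inE cF -set_seq_cons CF /= andbT.
by apply: sC CF; apply/subsetP => x; rewrite !inE => ->; rewrite orbT.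
Qed.

Lemma adjacent_setD1 c A B : c \in A -> c \in B -> adjacent A B = adjacent (A :\ c) (B :\ c).
Proof.
move=> cA cB; have E (X Y : {set V}) : c \in X -> c \in Y -> X :\: Y = (X :\ c) :\: (Y :\ c).
  move=> cX cY; apply/setP => x; rewrite !inE.
  by case: (eqVneq x c) => [->|]; rewrite ?cY //= andbT.
by rewrite /adjacent !(E A B, E B A).
Qed.

Lemma cons_path_nil d C S F :
  cons_path d C S F [::] = [&& uniq F, size F == d, [set:: F] \in C & admissible C F S].
Proof. by rewrite /cons_path /face_path /conservative /= !andbT -!andbA. Qed.

Lemma cons_path_link d C S c F : simplicial_complex C ->
  cons_path d.+1 C S (c :: F) [::] ->
  cons_path d (link C c) (next_target C c S) F [::].
Proof.
move=> sC; rewrite !cons_path_nil => /and4P[ucF sF CF /andP[_ admF]].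
apply/and4P; split=> //; first by case/andP: ucF.
exact: link_face ucF CF.
Qed.

(** The path is cut at the first facet [X] where [c] is not first, or at its end. A step drops the
    last vertex, never the lead, so [X] still contains [c] and the step into [X] belongs to the
    projected path. If the lead was lost, [c] cannot attain the distance of [X], by
    [conservative_lead]. *)
Lemma lead_phase d C S c F Fs : 0 < d -> simplicial_complex C ->
    cons_path d.+1 C S (c :: F) Fs ->
  exists Fs1 Fs2 Gs, let X := last (c :: F) Fs1 in
  [/\ Fs = Fs1 ++ Fs2, cons_path d (link C c) (next_target C c S) F Gs,
      size Gs = size Fs1, cons_path d.+1 C S X Fs2 &
      [/\ c \in X, [set:: last F Gs] = [set:: X] :\ c &
          (exists2 H, X = c :: H & Fs2 = [::]) \/
          vdist C [set c] S != vdist C [set:: X] S]].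
Proof.
move=> d0 sC; elim: Fs => [|G Fs IHFs] in F *.
  move=> pF; exists [::], [::], [::] => /=; split=> //; first exact: cons_path_link pF.
  move: pF; rewrite cons_path_nil inE eqxx => /andP[/set_seq_consD1-> _].
  by split=> //; left; exists F.
rewrite cons_path_cons => /and4P[pF aFG cFG pG].
have [ucF sF CF admF] : [/\ uniq (c :: F), size F = d, [set:: c :: F] \in C &
    admissible C (c :: F) S].
  by move: pF; rewrite cons_path_nil => /and4P[-> /eqP[->] ->].
have [uG sG CG] : [/\ uniq G, size G = d.+1 & [set:: G] \in C].
  by case/andP: pG => /andP[/andP[/and3P[-> /eqP-> ->]]].
have F0 : F != [::] by rewrite -size_eq0 sF -lt0n.
have cG := lead_kept ucF F0 cFG.
have [dcG|dcG] := eqVneq (vdist C [set c] S) (vdist C [set:: G] S).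
  have [G' GE] := conservative_lead cFG uG cG dcG; rewrite {}GE in uG sG CG pG aFG cFG *.
  have [Fs1 [Fs2 [Gs [FsE pGs sGs pX rest]]]] := IHFs _ pG.
  exists ((c :: G') :: Fs1), Fs2, (G' :: Gs); split; rewrite //= ?FsE ?sGs //.
  rewrite cons_path_cons pGs andbT (cons_path_link sC pF) /=.
  rewrite (conservative_step_behead ucF F0 uG cFG) andbT.
  by rewrite -(set_seq_consD1 ucF) -(set_seq_consD1 uG) -adjacent_setD1 // !inE eqxx.
have [H [uH HG stepH]] := conservative_step_link ucF F0 uG cFG.
exists [:: G], Fs, [:: H]; split; rewrite //=; last by split=> //; right.
rewrite cons_path_cons (cons_path_link sC pF) stepH /= HG -(set_seq_consD1 ucF).
rewrite -adjacent_setD1 ?inE ?eqxx // aFG /= cons_path_nil uH HG.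
have -> : admissible (link C c) H (next_target C c S) by case/and3P: stepH.
have -> : size H == d.
  rewrite -(card_set_seq uH) HG; move: (card_set_seq uG).
  by rewrite (cardsD1 c) inE cG sG add1n => -[->].
rewrite inE in_setD1 eqxx setD1K ?inE // CG /= !andbT.
by case: sC => _; apply; [apply: subD1set|].
Qed.

End ConservativePaths.

(** * Crossing the links of [a] and [b] one after the other *)

Section TwoPhases.
Variables (V : finType) (C : {set {set V}}).
Implicit Types (S : {set V}) (u v w : V) (F G H : seq V) (Fs Gs : seq (seq V)).
Hypothesis C_sc : simplicial_complex C.

Lemma face_zero_dim A : A \in C -> 1 < #|A| -> zero_dim C = false.
Proof.
move=> CA A1; apply/eqP => mE; move: A1; rewrite ltnNge -mE => /negP; apply.
exact: leq_bigmax_cond.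
Qed.

Lemma face_edge A u v : A \in C -> u \in A -> v \in A -> u != v -> edge C u v.
Proof.
case: C_sc => _ sC CA Au Av uv; rewrite /edge uv; apply: sC CA.
by rewrite subUset !sub1set Au.
Qed.

Lemma mem_link_vertices c w : (w \in vertices (link C c)) = edge C c w.
Proof.
rewrite !inE /edge; case: (boolP ([set c; w] \in C)) => cwC; last by rewrite !andbF.
suff -> : [set w] \in C by [].
by case: C_sc => _ sC; apply: sC cwC; rewrite sub1set !inE eqxx orbT.
Qed.

Section Target.
Variable S : {set V}.
Let D v := vdist C [set v] S.

(** Consecutive facets share a vertex because [d > 1], so finiteness of the distance spreads
    backwards from the last facet. *)
Lemma cons_path_reach d F Fs v : 1 < d -> cons_path d C S F Fs ->
  (exists2 y, y \in S & y \in last F Fs) -> v \in F -> exists k, D v = Some k.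
Proof.
move=> d1; elim: Fs => [|G Fs IHFs] /= in F v *.
  rewrite cons_path_nil => /and4P[uF /eqP sF CF _] [y Sy Fy] Fv.
  have dC : zero_dim C = false by apply: face_zero_dim CF _; rewrite card_set_seq ?sF.
  have Dy : D y = Some 0 by apply/eqP; rewrite vdist_eq0.
  have [->|vy] := eqVneq v y; first by exists 0.
  have: edge C v y by apply: (face_edge CF); rewrite ?inE.
  by move/(vdist_edge dC)/(_ Dy); rewrite -/(D v); case: (D v) => // k _; exists k.
rewrite cons_path_cons cons_path_nil => /and4P[/and4P[uF /eqP sF CF _] aFG _ pG] SG Fv.
have dC : zero_dim C = false by apply: face_zero_dim CF _; rewrite card_set_seq ?sF.
have /set0Pn[w] : [set:: F] :&: [set:: G] != set0.
  case/andP: aFG => /eqP FG _; apply: contraTneq d1 => FG0.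
  by rewrite -sF -(card_set_seq uF) -(cardsID [set:: G]) FG0 cards0 FG.
rewrite !inE => /andP[Fw Gw]; have [k Dw] := IHFs _ _ pG SG Gw.
have [->|vw] := eqVneq v w; first by exists k.
have: edge C v w by apply: (face_edge CF); rewrite ?inE.
by move/(vdist_edge dC)/(_ Dw); rewrite -/(D v); case: (D v) => // j _; exists j.
Qed.

End Target.

(* Each vertex [v] gets a stratum [kappa v]: 0 is the part beyond the facet [A],
   1 and 2 the two layers isolating it, 3 and 5 the vertices [a] and [b] of the
   one-point suspension, 4 the vertices of the suspended complex, 6, 7 and 8 the
   layers and the part beyond [B]. *)
Definition strata : seq (seq nat) :=
  [:: [:: 0; 1; 3]; [:: 1; 2; 3]; [:: 2; 3; 4]; [:: 3; 4; 5];
      [:: 4; 5; 6]; [:: 5; 6; 7]; [:: 5; 7; 8]].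

Definition near_strata i j := has (fun s => (i \in s) && (j \in s)) strata.

(** Turns a claim about the strata of two adjacent vertices into a computation on the seven lists,
    discharged by [isT]. *)
Lemma near_strataP (P : nat -> nat -> bool) i j :
  all (fun s => all (fun x => all (P x) s) s) strata -> near_strata i j -> P i j.
Proof. by move=> /allP Ps /hasP[s /Ps /allP Pi /andP[/Pi/allP Pj /Pj]]. Qed.

Variables (kappa : V -> nat) (a b : V) (S : {set V}).
Hypothesis kappa_edge : forall u v, edge C u v -> near_strata (kappa u) (kappa v).
Hypothesis kappa3 : forall v, (kappa v == 3) = (v == a).
Hypothesis kappa5 : forall v, (kappa v == 5) = (v == b).
Hypothesis edge_ab : edge C a b.
Hypothesis edge_1a : forall v, kappa v = 1 -> edge C v a.
Hypothesis edge_b7 : forall v, kappa v = 7 -> edge C b v.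
Hypothesis S_far : forall s, s \in S -> s = b \/ 7 <= kappa s.
Hypothesis dC : zero_dim C = false.
Let D v := vdist C [set v] S.

Let kappa_a : kappa a = 3. Proof. by apply/eqP; rewrite kappa3. Qed.
Let kappa_b : kappa b = 5. Proof. by apply/eqP; rewrite kappa5. Qed.

Let DE0 v : (D v == Some 0) = (v \in S). Proof. exact: vdist_eq0. Qed.

Let kappaS s : s \in S -> kappa s = 5 \/ 7 <= kappa s.
Proof. by move=> /S_far[->|]; [left|right]. Qed.

Let near u v : edge C u v -> near_strata (kappa u) (kappa v) := @kappa_edge u v.

(** A shortest walk from [v] to the target either passes through [b] or goes from stratum 6 into
    stratum 7. In the second case [b] is adjacent to the vertex entered, so it is no farther than
    the vertex just left. *)
Lemma dist_b_le v k : kappa v <= 4 \/ kappa v = 6 -> D v = Some k ->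
  exists2 e, D b = Some e & e <= k.
Proof.
elim: k v => [|k IHk] v kv Dv.
  by move/eqP: Dv; rewrite DE0 => /kappaS; case: kv; lia.
have [u vu Du] := vdist_descent dC Dv.
have /= := near_strataP (P := fun i j => (i <= 4) || (i == 6) ==> [|| j <= 4, j == 6, j == 5 | j == 7]) isT (near vu).
have -> /= : (kappa v <= 4) || (kappa v == 6) by case: kv => ->; rewrite ?orbT.
case/or4P => [ku|/eqP ku||/eqP ku].
- by have [e De ek] := IHk u (or_introl ku) Du; exists e => //; apply: leqW.
- by have [e De ek] := IHk u (or_intror ku) Du; exists e => //; apply: leqW.
- by rewrite kappa5 => /eqP ub; exists k; rewrite // -ub.
- have := vdist_edge dC (edge_b7 ku) Du; rewrite -/(D b).
  by case: (D b) => // e ek; exists e.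
Qed.

Section Delta.
Variable e : nat.
Hypothesis De : D b = Some e.

Lemma dist_ge v k : kappa v <= 4 \/ kappa v = 6 -> D v = Some k -> e <= k.
Proof. by move=> kv Dv; have [e'] := dist_b_le kv Dv; rewrite De => -[<-]. Qed.

(** A shortest walk leaves the strata up to 4 through [b] or through stratum 6, and both are at
    distance at least [e]. *)
Lemma dist_gt v k : kappa v <= 4 -> D v = Some k -> e < k.
Proof.
elim: k v => [|k IHk] v kv Dv.
  by move/eqP: Dv; rewrite DE0 => /kappaS; lia.
have [u vu Du] := vdist_descent dC Dv.
have /= := near_strataP (P := fun i j => (i <= 4) ==> [|| j <= 4, j == 5 | j == 6]) isT (near vu).
rewrite kv => /or3P[ku||/eqP ku].
- by apply: leqW; apply: IHk Du.
- by rewrite kappa5 => /eqP ub; move: Du; rewrite ub -/(D b) De => -[->].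
- by rewrite ltnS; apply: (@dist_ge u); [right|].
Qed.

Lemma dist_gt1 v k : kappa v <= 2 -> D v = Some k -> e.+1 < k.
Proof.
case: k => [|k] kv Dv.
  by move/eqP: Dv; rewrite DE0 => /kappaS; lia.
have [u vu Du] := vdist_descent dC Dv.
have /= := near_strataP (P := fun i j => (i <= 2) ==> (j <= 4)) isT (near vu).
by rewrite kv ltnS => ku; apply: dist_gt Du.
Qed.

Lemma dist_a : D a = Some e.+1.
Proof.
have := vdist_edge dC edge_ab De; rewrite -/(D a).
case Da: (D a) => [k|//] /= ke; congr Some; apply/eqP; rewrite eqn_leq ke.
by apply: dist_gt Da; rewrite kappa_a.
Qed.

Lemma dist1 v : kappa v = 1 -> D v = Some e.+2.
Proof.
move=> kv; have := vdist_edge dC (edge_1a kv) dist_a; rewrite -/(D v).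
case Dv: (D v) => [k|//] /= ke; congr Some; apply/eqP; rewrite eqn_leq ke.
by apply: dist_gt1 Dv; rewrite kv.
Qed.

(** All other neighbours of [a] lie in the strata up to 4, hence are at distance more than [e]. *)
Lemma next_target_a : next_target C a S = [set b].
Proof.
have aS : a \notin S by rewrite -DE0 dist_a.
rewrite /next_target (negPf aS) -/(D a) dist_a; apply/setP => w; rewrite inE in_set1.
rewrite mem_link_vertices -/(D w); apply/andP/eqP => [[aw /eqP Dw]|->]; last first.
  by rewrite edge_ab -/(D b) De.
have /= := near_strataP (P := fun i j => (i == 3) ==> (j <= 4) || (j == 5)) isT (near aw).
rewrite kappa_a /= => /orP[kw|].
  by have := dist_gt kw Dw; rewrite ltnn.
by rewrite kappa5 => /eqP.
Qed.

Lemma next_target_b s : s \in next_target C b S -> 7 <= kappa s.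
Proof.
rewrite /next_target; case: ifP => bS.
  rewrite inE mem_link_vertices => /andP[Ss /andP[bs _]].
  by case: (S_far Ss) => // sb; rewrite sb eqxx in bs.
rewrite -/(D b) De; case Ee: e => [|k]; first by rewrite inE.
rewrite inE mem_link_vertices -/(D s) => /andP[bs /eqP Ds].
rewrite ltnNge; apply/negP => ks.
have ks' : kappa s <= 4 \/ kappa s = 6.
  have : kappa s != 5 by rewrite kappa5; apply: contraTneq bs => ->; rewrite /edge eqxx.
  lia.
by have := dist_ge ks' Ds; rewrite Ee ltnn.
Qed.

End Delta.

Variables d l : nat.
Hypothesis d_gt0 : 0 < d.
(** The bounds that the induction provides in the two links. In the link of [a] the target is
    exactly [b]; in the link of [b] only its strata are known, so [far_b] has to hold for every such
    [S']. *)
Hypothesis far_a : forall F Fs, cons_path d (link C a) [set b] F Fs ->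
  (exists2 x, x \in F & kappa x <= 1) -> b \in last F Fs -> l <= size Fs.
Hypothesis far_b : forall (S' : {set V}) F Fs, (forall s, s \in S' -> 7 <= kappa s) ->
  cons_path d (link C b) S' F Fs -> a \in F ->
  (exists2 s, s \in S' & s \in last F Fs) -> l <= size Fs.

(** The vertex [b] may itself be in [S], but reaching it ends only the first phase; hence the
    condition on the stratum. *)
Let ends G := exists y, [/\ y \in S, y \in G & 7 <= kappa y].

Lemma cons_path_lead_min c F Fs u : cons_path d.+1 C S (c :: F) Fs -> u \in c :: F ->
  dist_le (D c) (D u).
Proof.
case/andP=> _ /andP[/andP[/eqP dcF _] _] uF.
by rewrite /D dcF; apply: vdist_le; rewrite inE.
Qed.

Lemma cons_path_face F Fs : cons_path d.+1 C S F Fs ->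
  [/\ uniq F, size F = d.+1 & [set:: F] \in C].
Proof. by case/andP => /andP[/andP[/and3P[-> /eqP-> ->]]]. Qed.

Lemma ends_reach F : ends F -> exists2 y, y \in S & y \in F.
Proof. by case=> y []; exists y. Qed.

(** The lead is [b], because [a] and all other neighbours of [a] are strictly farther. It is lost
    only to a strictly closer neighbour, which lies in the target of the link of [b]. If it is kept
    to the end, then [b] is in [S] and the final target vertex is also a target in the link. Either
    way the projected path crosses the link. *)
Lemma phase_b F Fs : cons_path d.+1 C S F Fs -> a \in F -> b \in F ->
  ends (last F Fs) -> l <= size Fs.
Proof.
move=> pF Fa Fb eF; have [uF sF CF] := cons_path_face pF.
have [e De] := cons_path_reach (d := d.+1) d_gt0 pF (ends_reach eF) Fb.
rewrite -/(D b) in De.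
case: F => // c F in pF Fa Fb eF uF sF CF *.
have cb : c = b.
  apply/eqP; rewrite -kappa5 eqn_leq; have := cons_path_lead_min pF Fb; rewrite De.
  case Dc: (D c) => [k|] //= ke.
  have [ca|ca] := eqVneq c a.
    by move: Dc ke; rewrite ca (dist_a De) => -[<-]; rewrite ltnn.
  have : edge C a c by apply: (face_edge CF); rewrite ?inE ?eqxx // eq_sym.
  move/near/(near_strataP (P := fun i j => (i == 3) ==> (j <= 4) || (j == 5)) isT) => /=.
  rewrite kappa_a /= => /orP[kc|/eqP->//].
  by have := dist_gt De kc Dc; rewrite ltnNge ke.
rewrite {c Fb}cb in pF Fa eF uF sF CF *.
have aF : a \in F by move: Fa edge_ab; rewrite inE /edge => /predU1P[->|]; rewrite ?eqxx.
have [Fs1 [Fs2 [Gs [FsE pGs sGs pX [bX GX touch]]]]] := lead_phase d_gt0 C_sc pF.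
rewrite FsE size_cat -sGs; apply: leq_trans (leq_addr _ _).
apply: far_b pGs aF _; first exact: next_target_b De.
set X := last _ _ in pX bX GX touch; have [uX sX CX] := cons_path_face pX.
have lastG u : u \in X -> u != b -> u \in last F Gs.
  by move=> Xu ub; move/setP/(_ u): GX; rewrite !inE Xu ub.
have edgeX u : u \in X -> u != b -> edge C b u.
  by move=> Xu ub; apply: (face_edge CX); rewrite ?inE // eq_sym.
case: touch => [[H XE Fs20]|].
  move: eF; rewrite FsE Fs20 cats0 -/X => -[y [Sy Xy ky]].
  have yb : y != b by rewrite -kappa5; apply: contraTneq ky => ->.
  have bS : b \in S.
    rewrite -DE0; rewrite XE in pX Xy; have := cons_path_lead_min pX Xy.
    by move: Sy; rewrite -DE0 => /eqP->; case: (D b) => [[]|].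
  exists y; last exact: lastG.
  by rewrite /next_target bS inE Sy mem_link_vertices edgeX.
rewrite -/(D b) De => DX.
have X0 : [set:: X] != set0 by apply/set0Pn; exists b; rewrite inE.
have [u] := vdist_attained C S X0; rewrite inE -/(D u) => Xu DuX.
have := vdist_le C S (u := b) (T := [set:: X]); rewrite inE bX -DuX -/(D b) De => /(_ isT).
rewrite -DuX in DX; case Du: (D u) DX => [k|] //= DX ke.
have {DX ke} ke : k < e by rewrite ltn_neqAle ke andbT; apply: contraNneq DX => ->.
have ub : u != b by apply: contraTneq ke => ub; move: Du; rewrite ub De => -[->]; rewrite ltnn.
have bS : b \notin S by rewrite -DE0 De; case: (e) ke.
have /(vdist_edge dC) : edge C b u by apply: edgeX.
move/(_ S _ Du); rewrite -/(D b) De /= => ek.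
have eE : e = k.+1 by apply/eqP; rewrite eqn_leq ek.
exists u; last exact: lastG.
rewrite /next_target (negPf bS) -/(D b) De eE inE mem_link_vertices edgeX //=.
by rewrite -/(D u) Du.
Qed.

(** The lead [a] can be lost only to [b], and it cannot last until a target vertex is reached. So
    the first phase ends in a facet that contains both [a] and [b], where [phase_b] takes over. *)
Lemma phase_a F Fs : cons_path d.+1 C S (a :: F) Fs ->
  (exists2 x, x \in F & kappa x <= 1) -> ends (last (a :: F) Fs) -> 2 * l <= size Fs.
Proof.
move=> pF Z eF; have [uF sF CF] := cons_path_face pF.
have [k Da] := cons_path_reach (d := d.+1) d_gt0 pF (ends_reach eF) (mem_head _ _).
have [|e De _] := dist_b_le (v := a) _ Da; first by rewrite kappa_a; left.
have [Fs1 [Fs2 [Gs [FsE pGs sGs pX [aX GX touch]]]]] := lead_phase d_gt0 C_sc pF.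
rewrite (next_target_a De) in pGs.
set X := last _ _ in pX aX GX touch; have [uX sX CX] := cons_path_face pX.
have eX : ends (last X Fs2) by move: eF; rewrite FsE last_cat.
suff Xb : b \in X.
  have l1 : l <= size Fs1.
    rewrite -sGs; apply: far_a pGs Z _.
    move/setP/(_ b): GX; rewrite !inE Xb andbT => ->.
    by move: edge_ab; rewrite /edge eq_sym => /andP[].
  have l2 := phase_b pX aX Xb eX.
  by rewrite FsE size_cat mul2n -addnn leq_add.
case: touch => [[H XE Fs20]|].
  case: eX; rewrite Fs20 /= => y [Sy Xy _]; rewrite XE in pX Xy.
  have := cons_path_lead_min pX Xy; rewrite (dist_a De).
  by move: Sy; rewrite -DE0 => /eqP->.
rewrite -/(D a) (dist_a De) => DX.
have X0 : [set:: X] != set0 by apply/set0Pn; exists a; rewrite inE.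
have [u] := vdist_attained C S X0; rewrite inE -/(D u) => Xu DuX.
have := vdist_le C S (u := a) (T := [set:: X]); rewrite inE aX -DuX -/(D a) (dist_a De) => /(_ isT).
rewrite -DuX in DX; case Du: (D u) DX => [j|] //= DX je.
have {DX je} je : j <= e by rewrite -ltnS ltn_neqAle je andbT; apply: contraNneq DX => ->.
have [ua|ua] := eqVneq u a.
  by move: Du; rewrite ua (dist_a De) => -[ej]; move: je; rewrite -ej ltnn.
have : edge C a u by apply: (face_edge CX); rewrite ?inE // eq_sym.
move/near/(near_strataP (P := fun i j => (i == 3) ==> (j <= 4) || (j == 5)) isT) => /=.
rewrite kappa_a /= => /orP[ku|].
  by have := dist_gt De ku Du; rewrite ltnNge je.
by rewrite kappa5 => /eqP <-.
Qed.

(** The old lead is still in the next facet, so the new lead is adjacent to it. Hence the lead stays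
    in the strata 0 and 1 until [a] takes over, at which time a vertex from these strata is still
    present, as [phase_a] requires. *)
Lemma phase_0 v F Fs : kappa v <= 1 -> cons_path d.+1 C S (v :: F) Fs ->
  ends (last (v :: F) Fs) -> 2 * l <= size Fs.
Proof.
elim: Fs => [|G Fs IHFs] in v F *.
  move=> kv pF [y [Sy Fy ky]]; have := cons_path_lead_min pF Fy.
  move: Sy; rewrite -DE0 => /eqP->; case Dv: (D v) => [k|] //=; rewrite leqn0 => /eqP k0.
  by move: Dv; rewrite k0 => /eqP; rewrite DE0 => /kappaS; lia.
move=> kv; rewrite cons_path_cons => /and4P[pF _ cFG pG] eG.
have [uF sF CF] := cons_path_face pF; have [uG sG CG] := cons_path_face pG.
have F0 : F != [::] by case: (F) sF d_gt0 => //= -[<-].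
have Gv := lead_kept uF F0 cFG.
apply: leqW; case: G => // c G in cFG pG eG uG sG CG Gv *.
have [cv|cv] := eqVneq c v; first by apply: (IHFs v G kv); rewrite -cv.
have [ca|ca] := eqVneq c a.
  rewrite ca in pG Gv eG; apply: phase_a pG _ eG; exists v => //.
  by move: Gv; rewrite inE => /predU1P[va|//]; move: cv; rewrite ca va eqxx.
suff kc : kappa c <= 1 by apply: (IHFs c G kc pG).
have ncv : near_strata (kappa v) (kappa c).
  by apply: near; apply: (face_edge CG); rewrite ?in_set ?mem_head // eq_sym.
have nc3 : kappa c != 3 by rewrite kappa3.
have := near_strataP (P := fun i j => (i <= 1) ==> [|| j == 3, j <= 1 | (j == 2) && (i == 1)])
  isT ncv.
rewrite /= kv (negPf nc3) /= => /orP[//|/andP[/eqP kc /eqP kv1]].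
have [k Dc] := cons_path_reach (d := d.+1) d_gt0 pG (ends_reach eG) (mem_head _ _).
rewrite -/(D c) in Dc; have [|e De _] := dist_b_le (v := c) _ Dc; first by rewrite kc; left.
have kc2 : kappa c <= 2 by rewrite kc.
(* [v] and [c] are equally far from the target, so the lead had no reason to change *)
have [|G' [cE _]] := conservative_lead cFG uG Gv; last by rewrite cE eqxx in cv.
have := cons_path_lead_min pG Gv; rewrite (dist1 De kv1) -/(D c) Dc /= => ke2.
have kE : k = e.+2 by apply/eqP; rewrite eqn_leq ke2; apply: dist_gt1 De _ _ kc2 Dc.
rewrite -/(D v) (dist1 De kv1) -kE -Dc /D.
by case/andP: pG => _ /andP[/andP[/eqP <-]].
Qed.

Lemma two_phases F Fs : cons_path d.+1 C S F Fs ->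
  (exists2 x, x \in F & kappa x = 0) -> ends (last F Fs) -> 2 * l <= size Fs.
Proof.
move=> pF [x Fx kx] eF; have [uF sF CF] := cons_path_face pF.
case: F => // c F in pF eF uF sF CF Fx *.
have [ca|ca] := eqVneq c a.
  rewrite ca in pF eF Fx; apply: phase_a pF _ eF; exists x; last by rewrite kx.
  by move: Fx; rewrite inE => /predU1P[xa|//]; move: kx; rewrite xa kappa_a.
apply: phase_0 pF eF; have [->|cx] := eqVneq c x; first by rewrite kx.
have : edge C x c by apply: (face_edge CF); rewrite ?in_set ?mem_head // eq_sym.
move/near/(near_strataP (P := fun i j => (i == 0) ==> (j == 3) || (j <= 1)) isT) => /=.
by rewrite kx kappa3 (negPf ca).
Qed.

End TwoPhases.

(** * Complexes agreeing beyond two facets *)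

(* [Y] agrees with [M] except beyond the facets [A] and [B], each of which may have
   been replaced by anything on new vertices [ZA], [ZB]. *)
Definition agree (U V : finType) (phi : U -> V) (M : {set {set U}}) (A B : {set U})
    (Y : {set {set V}}) (ZA ZB : {set V}) : Prop :=
  [/\ injective phi, forall v, v \in ZA -> v \notin ZB,
      forall u, phi u \notin ZA /\ phi u \notin ZB,
      forall g, g \in Y -> [\/ g \subset ZA :|: phi @: A, g \subset ZB :|: phi @: B |
                            exists2 f, f \in M & g = phi @: f] &
      forall f, f \in M -> f != A -> f != B -> phi @: f \in Y].

(** [S] is any set at the end [B]: targets arise recursively in links, and only their position is
    under control. *)
Definition far d l (U : finType) (M : {set {set U}}) (A B : {set U}) : Prop :=
  forall (V : finType) (phi : U -> V) (Y : {set {set V}}) (ZA ZB S : {set V})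
         (F : seq V) (Fs : seq (seq V)),
    agree phi M A B Y ZA ZB -> simplicial_complex Y -> S \subset ZB :|: phi @: B ->
    cons_path d Y S F Fs -> (exists2 x, x \in F & x \in ZA) ->
    (exists y, [/\ y \in S, y \in last F Fs & y \in ZB]) -> l <= size Fs.

Lemma agree_sym (U V : finType) (phi : U -> V) M A B Y ZA ZB :
  agree phi M A B Y ZA ZB -> agree phi M B A Y ZB ZA.
Proof.
case=> inj dis fresh up low; split=> //.
- by move=> v Zv; apply: contraL Zv; apply: dis.
- by move=> u; case: (fresh u).
- by move=> g /up[]; [constructor 2|constructor 1|constructor 3].
- by move=> f Mf fB fA; apply: low.
Qed.

Lemma link_sc (V : finType) (C : {set {set V}}) c :
  [set c] \in C -> simplicial_complex C -> simplicial_complex (link C c).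
Proof.
move=> cC [C0 sC]; split; first by rewrite inE C0 inE setU0.
move=> F G GF; rewrite !inE => /and3P[CF cF cFC]; apply/and3P; split.
- exact: sC CF.
- by apply: contra cF; apply: (subsetP GF).
- by apply: sC cFC; apply: setUS.
Qed.

(** [kappa] gives the strata 1 to 7; the strata 0 and 8 appear only in a complex that continues
    beyond the ends. The cases of [dbl_up] are the two layers at [a], the two layers at [b], the
    faces around the edge [ab] over [B], and copies of faces of [M]. The bounds [dbl_A_gt] and
    [dbl_B_gt] make the end facets larger than edges, so that the edges from [a] and [b] into the
    outer layers survive in every agreeing complex. *)
Record doubling (U U' : finType) (M : {set {set U}}) (A B : {set U})
    (M' : {set {set U'}}) (A' B' : {set U'}) (iota : U -> U') (kappa : U' -> nat)
    (a b : U') : Prop := Doubling {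
  dbl_inj : injective iota;
  dbl_range : forall x, 1 <= kappa x <= 7;
  dbl_4 : forall u, kappa (iota u) = 4;
  dbl_3 : forall x, (kappa x == 3) = (x == a);
  dbl_5 : forall x, (kappa x == 5) = (x == b);
  dbl_A : A' = a |: [set x | kappa x == 1];
  dbl_B : B' = b |: [set x | kappa x == 7];
  dbl_A_gt : 1 < #|[set x | kappa x == 1]|;
  dbl_B_gt : 1 < #|[set x | kappa x == 7]|;
  dbl_sc : simplicial_complex M';
  dbl_AM : A' \in M';
  dbl_BM : B' \in M';
  dbl_ab : [set a; b] \in M';
  dbl_up : forall f, f \in M' ->
    let K s := [set x | kappa x \in s] in
    f \subset K [:: 1; 2; 3] \/ f \subset K [:: 2; 3] :|: iota @: A \/
    f \subset K [:: 5; 6; 7] \/ f \subset K [:: 5; 6] :|: iota @: A \/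
    f \subset [set a; b] :|: iota @: B \/
    exists2 g, g \in M & [\/ f = iota @: g, f = a |: iota @: g | f = b |: iota @: g];
  dbl_low : forall g, g \in M -> g != A -> g != B ->
    a |: iota @: g \in M' /\ b |: iota @: g \in M'
}.

(** Reflecting the strata exchanges [a] and [b], so the link of [b] and paths in the opposite
    direction need no separate treatment. *)
Lemma doubling_sym U U' M A B M' A' B' iota kappa a b :
  @doubling U U' M A B M' A' B' iota kappa a b ->
  doubling M A B M' B' A' iota (fun x => 8 - kappa x) b a.
Proof.
case=> inj range k4 k3 k5 AE BE A1 B1 sc AM BM abM up low.
have k x : [/\ (8 - kappa x == 1) = (kappa x == 7), (8 - kappa x == 7) = (kappa x == 1),
     (8 - kappa x == 3) = (kappa x == 5) & (8 - kappa x == 5) = (kappa x == 3)].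
  by have r := range x; split; apply/eqP/eqP; lia.
have k2 x : (8 - kappa x == 2) = (kappa x == 6) by have r := range x; apply/eqP/eqP; lia.
have k6 x : (8 - kappa x == 6) = (kappa x == 2) by have r := range x; apply/eqP/eqP; lia.
have KS : [/\ [set x | 8 - kappa x \in [:: 1; 2; 3]] = [set x | kappa x \in [:: 5; 6; 7]],
    [set x | 8 - kappa x \in [:: 5; 6; 7]] = [set x | kappa x \in [:: 1; 2; 3]],
    [set x | 8 - kappa x \in [:: 2; 3]] = [set x | kappa x \in [:: 5; 6]] &
    [set x | 8 - kappa x \in [:: 5; 6]] = [set x | kappa x \in [:: 2; 3]]].
  by split; apply/setP => x; have [k1 k7 k3' k5'] := k x;
    rewrite !inE ?k1 ?k2 ?k3' ?k5' ?k6 ?k7; do !case: (_ == _).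
have [KS1 KS5 KS2 KS6] := KS.
split=> //.
- by move=> x; have := range x; lia.
- by move=> u; rewrite k4.
- by move=> x; have [_ _ -> _] := k x.
- by move=> x; have [_ _ _ ->] := k x.
- by rewrite BE; congr (_ |: _); apply/setP => x; rewrite !inE; have [-> _ _ _] := k x.
- by rewrite AE; congr (_ |: _); apply/setP => x; rewrite !inE; have [_ -> _ _] := k x.
- suff -> : [set x | 8 - kappa x == 1] = [set x | kappa x == 7] by [].
  by apply/setP => x; rewrite !inE; have [-> _ _ _] := k x.
- suff -> : [set x | 8 - kappa x == 7] = [set x | kappa x == 1] by [].
  by apply/setP => x; rewrite !inE; have [_ -> _ _] := k x.
- by rewrite setUC.
- move=> f /up /= Mf; rewrite KS1 KS2 KS5 KS6 [[set b; a]]setUC.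
  case: Mf => [|[|[|[|[|[g Mg fE]]]]]]; try by tauto.
  do 5!right; exists g => //.
  by case: fE; [constructor 1|constructor 3|constructor 2].
- by move=> g Mg gA gB; have [] := low g Mg gA gB.
Qed.

Section DoublingLinks.
Variables (U U' : finType) (M : {set {set U}}) (A B : {set U}).
Variables (M' : {set {set U'}}) (A' B' : {set U'}) (iota : U -> U') (kappa : U' -> nat).
Variables (a b : U').
Hypothesis dbl : doubling M A B M' A' B' iota kappa a b.

Let kappa_a : kappa a = 3. Proof. by apply/eqP; rewrite (dbl_3 dbl). Qed.
Let kappa_b : kappa b = 5. Proof. by apply/eqP; rewrite (dbl_5 dbl). Qed.

Lemma dbl_aB : a \notin B'.
Proof.
by rewrite (dbl_B dbl) !inE -(dbl_5 dbl) kappa_a.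
Qed.

Lemma dbl_bA : b \notin A'.
Proof. by rewrite (dbl_A dbl) !inE -(dbl_3 dbl) kappa_b. Qed.

(** In the link of [a], the layers on its side lie beyond [A], while [b] is the only vertex beyond
    [B]: the vertex replaced by [ab] was the one stacked over [B]. *)
Lemma agree_link (V : finType) (phi : U' -> V) Y ZA ZB : simplicial_complex Y ->
  agree phi M' A' B' Y ZA ZB ->
  agree (phi \o iota) M A B (link Y (phi a))
        (ZA :|: phi @: [set x | kappa x \in [:: 1; 2]]) [set phi b].
Proof.
move=> [_ sY] [inj dis fresh up low].
have memphi x (D : {set U'}) : (phi x \in phi @: D) = (x \in D) by apply: mem_imset.
split.
- by move=> x y /= /inj /(dbl_inj dbl).
- move=> v; rewrite in_set1 inE => Zv; apply: contraL Zv => /eqP->.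
  by rewrite negb_or (fresh b).1 memphi inE kappa_b.
- move=> u /=; rewrite in_set1 inE negb_or (fresh _).1 memphi inE (dbl_4 dbl); split=> //.
  by rewrite (inj_eq inj) -(dbl_5 dbl) (dbl_4 dbl).
- move=> g; rewrite inE => /and3P[_ ag /up[]].
  + move=> /subsetP sg; constructor 1; apply/subsetP => v gv.
    have := sg v; rewrite !inE gv orbT => /(_ isT) /orP[->//|/imsetP[x]].
    rewrite (dbl_A dbl) !inE => /predU1P[xa vE|/eqP kx ->]; first by rewrite vE xa in gv; rewrite gv in ag.
    by rewrite memphi inE kx orbT.
  + move=> /subsetP/(_ (phi a)); rewrite !inE eqxx (negPf (fresh a).2) memphi => /(_ isT).
    by rewrite (negPf dbl_aB).
  + case=> f Mf gE.
    have fa : a \in f by rewrite -memphi -gE !inE eqxx.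
    have gf v : v \in g -> exists x, [/\ v = phi x, x \in f & x != a].
      move=> gv; have : v \in phi @: f by rewrite -gE !inE gv orbT.
      case/imsetP => x fx vE; exists x; split=> //.
      by apply: contraNneq ag => <-; rewrite -vE.
    case: (dbl_up dbl Mf) => [|[|[|[|[]]]]].
    * move=> /subsetP sf; constructor 1; apply/subsetP => v /gf[x [-> fx xa]].
      move: (sf x fx); rewrite !inE memphi !inE (dbl_3 dbl) (negPf xa).
      by rewrite orbF => ->; rewrite orbT.
    * move=> /subsetP sf; constructor 1; apply/subsetP => v /gf[x [-> fx xa]].
      move: (sf x fx); rewrite !inE memphi !inE (dbl_3 dbl) (negPf xa) orbF.
      case/orP => [->|/imsetP[u Au ->]]; first by rewrite !orbT.
      by apply/orP; right; apply/imsetP; exists u.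
    * by move=> /subsetP/(_ a fa); rewrite inE kappa_a.
    * move=> /subsetP/(_ a fa); rewrite !inE kappa_a /= => /imsetP[u _ au].
      by have := dbl_4 dbl u; rewrite -au kappa_a.
    * move=> /subsetP sf; constructor 2; apply/subsetP => v /gf[x [-> fx xa]].
      move: (sf x fx); rewrite !inE (negPf xa) /= => /orP[/eqP->|/imsetP[u Bu ->]].
        by rewrite eqxx.
      by apply/orP; right; apply/imsetP; exists u.
    * case=> g0 Mg0 fE; constructor 3; exists g0 => //.
      have aI : a \notin iota @: g0.
        by apply/imsetP => -[u _ au]; have := dbl_4 dbl u; rewrite -au kappa_a.
      have {}fE : f = a |: iota @: g0.
        case: fE => // fE; move: fa; rewrite fE ?inE (negPf aI) ?orbF //.
        by rewrite -(dbl_5 dbl) kappa_a.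
      rewrite imset_comp; apply/setP => v; move/setP/(_ v): gE.
      rewrite fE imsetU1 !inE; case: eqVneq => [->|//] _.
      by rewrite (negPf ag) memphi (negPf aI).
- move=> f Mf fA fB; have [aM _] := dbl_low dbl Mf fA fB.
  have aI : a \notin iota @: f.
    by apply/imsetP => -[u _ au]; have := dbl_4 dbl u; rewrite -au kappa_a.
  have aY : phi a |: phi @: (iota @: f) \in Y.
    rewrite -imsetU1; apply: low => //; last first.
      by apply: contraNneq dbl_aB => <-; rewrite !inE eqxx.
    apply/eqP => fE; have := dbl_A_gt dbl; rewrite ltnNge => /negP; apply.
    suff -> : [set x | kappa x == 1] = set0 by rewrite cards0.
    apply/setP => x; rewrite !inE; apply/negbTE/negP => kx.
    have : x \in A' by rewrite (dbl_A dbl) !inE kx orbT.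
    rewrite -fE !inE -(dbl_3 dbl) (eqP kx) /= => /imsetP[u _ xu].
    by have := dbl_4 dbl u; rewrite -xu (eqP kx).
  rewrite inE imset_comp memphi aI aY !andbT.
  by apply: sY aY; apply: subsetUr.
Qed.

End DoublingLinks.

(** * The length bound for the doubled complex *)

Section FarDoubling.
Variables (U U' : finType) (M : {set {set U}}) (A B : {set U}).
Variables (M' : {set {set U'}}) (A' B' : {set U'}) (iota : U -> U') (kappa : U' -> nat).
Variables (a b : U').
Hypothesis dbl : doubling M A B M' A' B' iota kappa a b.

Let kappa_a : kappa a = 3. Proof. by apply/eqP; rewrite (dbl_3 dbl). Qed.
Let kappa_b : kappa b = 5. Proof. by apply/eqP; rewrite (dbl_5 dbl). Qed.

Lemma far_doubling d l : 0 < d -> far d l M A B -> far d l M B A ->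
  far d.+1 (2 * l) M' A' B'.
Proof.
move=> d0 farAB farBA V phi Y ZA ZB S F Fs agr sY SB pF FZ FE.
have [inj dis fresh up low] := agr.
have memphi x (D : {set U'}) : (phi x \in phi @: D) = (x \in D) by apply: mem_imset.
(* The default 4 goes to elements of [V] that are neither new nor images. No hypothesis of
   [two_phases] singles out stratum 4, whereas 3 and 5 must occur once and 1 and 7 force edges. *)
pose k v := if v \in ZA then 0 else if v \in ZB then 8
            else if [pick x | phi x == v] is Some x then kappa x else 4.
have kphi x : k (phi x) = kappa x.
  rewrite /k (negPf (fresh x).1) (negPf (fresh x).2).
  by case: pickP => [y /eqP/inj->//|/(_ x)]; rewrite eqxx.
have kZA v : v \in ZA -> k v = 0 by rewrite /k => ->.
have kZB v : v \in ZB -> k v = 8 by move=> Bv; rewrite /k Bv ifN //; apply: contraL Bv; apply: dis.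
have kP v : v \notin ZA -> v \notin ZB -> k v != 4 -> exists x, v = phi x.
  rewrite /k => /negPf-> /negPf->; case: pickP => // x /eqP <- _; by exists x.
have edge_low x y : x != y -> [set x; y] \in M' -> [set x; y] != A' -> [set x; y] != B' ->
    edge Y (phi x) (phi y).
  move=> xy Mxy nA nB; rewrite /edge (inj_eq inj) xy.
  by have := low _ Mxy nA nB; rewrite imsetU1 imset_set1.
have ab : a != b by apply: contraTneq isT => E; move: kappa_a; rewrite E kappa_b.
have abE : edge Y (phi a) (phi b).
  apply: edge_low => //; first exact: dbl_ab dbl.
    by apply: contraNneq (dbl_bA dbl) => <-; rewrite !inE eqxx orbT.
  by apply: contraNneq (dbl_aB dbl) => <-; rewrite !inE eqxx.
have [aY bY] : [set phi a] \in Y /\ [set phi b] \in Y.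
  case: sY => _ sY'; case/andP: abE => _ abY.
  by split; apply: sY' abY; rewrite sub1set !inE eqxx ?orbT.
apply: (@two_phases V Y sY k (phi a) (phi b) S _ _ _ _ _ _ _ _ d l d0 _ _ F Fs pF).
- move=> u v /andP[_ /up uvY].
  have near s : s \in strata -> k u \in s -> k v \in s -> near_strata (k u) (k v).
    by move=> ss us vs; apply/hasP; exists s; rewrite ?us.
  have sub2 (D : {set V}) : [set u; v] \subset D -> u \in D /\ v \in D.
    by rewrite subUset !sub1set => /andP.
  have kA w : w \in ZA :|: phi @: A' -> k w \in [:: 0; 1; 3].
    rewrite inE => /orP[/kZA->//|/imsetP[x]].
    by rewrite (dbl_A dbl) !inE => /predU1P[->|/eqP kx] ->; rewrite kphi ?kappa_a ?kx.
  have kB w : w \in ZB :|: phi @: B' -> k w \in [:: 5; 7; 8].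
    rewrite inE => /orP[/kZB->//|/imsetP[x]].
    by rewrite (dbl_B dbl) !inE => /predU1P[->|/eqP kx] ->; rewrite kphi ?kappa_b ?kx.
  case: uvY => [/sub2[/kA uA /kA vA]|/sub2[/kB uB /kB vB]|[f Mf uvE]].
  + exact: near uA vA.
  + exact: near uB vB.
  have {sub2} ff w : w \in [set u; v] -> exists2 x, x \in f & k w = kappa x.
    by rewrite uvE => /imsetP[x fx ->]; exists x; rewrite ?kphi.
  have [x fx ux] := ff u (setU11 _ _); have [y fy vy] := ff v (set22 _ _).
  move: near; rewrite {}ux {}vy => near {uvE ff}.
  have kI (D : {set U}) z : z \in iota @: D -> kappa z = 4.
    by case/imsetP => t _ ->; apply: dbl_4 dbl _.
  have sub (D : {set U'}) : f \subset D -> x \in D /\ y \in D by move/subsetP => fD; split; apply: fD.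
  have split_kappa s (D : {set U}) z : z \in [set t | kappa t \in s] :|: iota @: D ->
      kappa z \in 4 :: s.
    by rewrite !inE => /orP[->|/kI->]; rewrite ?orbT.
  have Mab z (D : {set U}) : z \in [set a; b] :|: iota @: D -> kappa z \in [:: 3; 4; 5].
    by rewrite !inE -(dbl_3 dbl) -(dbl_5 dbl) => /orP[/orP[]/eqP->|/kI->].
  have perm s t : s =i t -> kappa x \in s -> kappa x \in t by move=> st; rewrite st.
  case: (dbl_up dbl Mf) => [/sub[]|[/sub[/split_kappa kx /split_kappa ky]|[/sub[]|
    [/sub[/split_kappa kx /split_kappa ky]|[/sub[/Mab kx /Mab ky]|[g Mg fE]]]]]].
  + by rewrite !in_set; apply: near.
  + by apply: (near [:: 2; 3; 4]) => //; rewrite (@perm_mem _ _ [:: 4; 2; 3]).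
  + by rewrite !in_set; apply: near.
  + by apply: (near [:: 4; 5; 6]).
  + exact: near kx ky.
  + have Dab z : z \in f -> kappa z \in [:: 3; 4; 5].
      move=> fz; apply: (Mab z g); move: fz; rewrite !inE.
      case: fE => ->; rewrite ?inE; first by move=> ->; rewrite orbT.
        by case/orP => ->; rewrite ?orbT.
      by case/orP => ->; rewrite ?orbT.
    by apply: (near [:: 3; 4; 5]) => //; apply: Dab.
- move=> v; apply/eqP/eqP => [kv|->]; last by rewrite kphi.
  have [| | |x vE] := kP v; last 1 first.
  + by move: kv; rewrite vE kphi => /eqP; rewrite (dbl_3 dbl) => /eqP->.
  + by apply: contra_eqN kv => /kZA->.
  + by apply: contra_eqN kv => /kZB->.
  + by rewrite kv.
- move=> v; apply/eqP/eqP => [kv|->]; last by rewrite kphi.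
  have [| | |x vE] := kP v; last 1 first.
  + by move: kv; rewrite vE kphi => /eqP; rewrite (dbl_5 dbl) => /eqP->.
  + by apply: contra_eqN kv => /kZA->.
  + by apply: contra_eqN kv => /kZB->.
  + by rewrite kv.
- exact: abE.
- move=> v kv; have [| | |x vE] := kP v.
  + by apply: contra_eqN kv => /kZA->.
  + by apply: contra_eqN kv => /kZB->.
  + by rewrite kv.
  move: kv; rewrite vE kphi => kx.
  have xa : x != a by rewrite -(dbl_3 dbl) kx.
  have xaA : [set x; a] \subset A' by rewrite subUset !sub1set (dbl_A dbl) !inE kx !eqxx orbT.
  apply: edge_low => //.
  + by case: (dbl_sc dbl) => _ sM; apply: sM (dbl_AM dbl).
  + apply: contraTneq (dbl_A_gt dbl) => E.
    rewrite -leqNgt; apply: leq_trans (_ : #|[set x]| <= 1); last by rewrite cards1.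
    apply: subset_leq_card; apply/subsetP => y; rewrite !inE => ky.
    have : y \in [set x; a] by rewrite E (dbl_A dbl) !inE ky orbT.
    by rewrite !inE -(dbl_3 dbl) (eqP ky) orbF.
  + by apply: contraNneq (dbl_aB dbl) => <-; rewrite !inE eqxx orbT.
- move=> v kv; have [| | |x vE] := kP v.
  + by apply: contra_eqN kv => /kZA->.
  + by apply: contra_eqN kv => /kZB->.
  + by rewrite kv.
  move: kv; rewrite vE kphi => kx.
  have xb : b != x by rewrite eq_sym -(dbl_5 dbl) kx.
  have xbB : [set b; x] \subset B' by rewrite subUset !sub1set (dbl_B dbl) !inE kx !eqxx orbT.
  apply: edge_low => //.
  + by case: (dbl_sc dbl) => _ sM; apply: sM (dbl_BM dbl).
  + by apply: contraNneq (dbl_bA dbl) => <-; rewrite !inE eqxx.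
  + apply: contraTneq (dbl_B_gt dbl) => E.
    rewrite -leqNgt; apply: leq_trans (_ : #|[set x]| <= 1); last by rewrite cards1.
    apply: subset_leq_card; apply/subsetP => y; rewrite !inE => ky.
    have : y \in [set b; x] by rewrite E (dbl_B dbl) !inE ky orbT.
    by rewrite !inE -(dbl_5 dbl) (eqP ky).
- move=> s /(subsetP SB); rewrite inE => /orP[/kZB->|/imsetP[x]]; first by right.
  by rewrite (dbl_B dbl) !inE => /predU1P[->|/eqP kx] ->; [left|right; rewrite kphi kx].
- by case/andP: abE => abN abY; apply: face_zero_dim abY _; rewrite cards2 abN.
- move=> F1 Fs1 pF1 [x Fx kx] bl.
  apply: (farAB V _ _ _ _ [set phi b] F1 Fs1 (agree_link dbl sY agr) _ _ pF1).
  + exact: link_sc.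
  + exact: subsetUl.
  + have := kP x; case: (boolP (x \in ZA)) => xZ; first by exists x; rewrite // inE xZ.
    case: (boolP (x \in ZB)) => xZB; first by move: kx; rewrite kZB.
    case=> //; first by apply: contraTneq kx => ->.
    move=> y xE; exists x => //; rewrite xE inE memphi inE; move: kx; rewrite xE kphi !inE.
    by case: (kappa y) (dbl_range dbl y) => [|[|]] //; rewrite orbT.
  + by exists (phi b); rewrite in_set1 eqxx.
- move=> S' F1 Fs1 S'7 pF1 aF [y S'y yl].
  have yZ s : s \in S' -> s \in ZB :|: phi @: [set x | 8 - kappa x \in [:: 1; 2]].
    move=> /S'7 ks; rewrite inE; case: (boolP (s \in ZB)) => //= sZB.
    have [| | |x sE] := kP s => //.
    + by apply: contraTN ks => /kZA->.
    + by apply: contraTneq ks => ->.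
    rewrite sE memphi inE; move: ks; rewrite sE kphi.
    by case: (kappa x) (dbl_range dbl x) => [|[|[|[|[|[|[|[|]]]]]]]].
  (* In the link of [b], only [a] lies beyond [B] and the target lies beyond [A]; the crossing
     therefore goes from [B] to [A]. *)
  have agr' := agree_link (doubling_sym dbl) sY (agree_sym agr).
  apply: (farBA V _ _ _ _ S' F1 Fs1 (agree_sym agr') _ _ pF1).
  + exact: link_sc.
  + by apply: subset_trans (subsetUl _ _); apply/subsetP.
  + by exists (phi a); rewrite // in_set1.
  + by exists y; split=> //; apply: yZ.
- by case: FZ => x Fx /kZA; exists x.
- by case: FE => y [Sy yl /kZB ky]; exists y; rewrite Sy yl ky.
Qed.

End FarDoubling.

(** * Vertex decomposability *)

Section PureComplexes.
Variable V : finType.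
Implicit Types (C T : {set {set V}}) (F G f g : {set V}) (v x y z w b : V).

Lemma pureP k C : pure_complex k C <->
  simplicial_complex C /\ forall g, g \in C -> exists F, [/\ F \in C, g \subset F & #|F| = k].
Proof.
split=> [[sC pC]|[sC pC]]; split=> //.
  move=> g Cg; have [F maxF gF] := @maxset_exists _ (mem C) g Cg.
  by exists F; split; [case/maxsetP: maxF|done|apply: pC; rewrite inE].
move=> F; rewrite inE => /maxsetP[CF maxF]; have [G [CG FG <-]] := pC F CF.
by rewrite (maxF G CG FG).
Qed.

Lemma pure_le k C g : pure_complex k C -> g \in C -> #|g| <= k.
Proof. by case/pureP => _ pC /pC[F [_ gF <-]]; apply: subset_leq_card. Qed.

Lemma pure_eq k C F f : pure_complex k C -> f \in C -> F \subset f -> #|F| = k -> f = F.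
Proof.
move=> pC Cf Ff Fk; apply/esym/eqP.
by rewrite eqEcard Ff Fk (pure_le pC Cf).
Qed.

Lemma pure_uniq k k' C : pure_complex k C -> pure_complex k' C -> k = k'.
Proof.
have le j j' : pure_complex j C -> pure_complex j' C -> j <= j'.
  case/pureP => -[C0 _] /(_ _ C0)[F [CF _ <-]] /pure_le; exact.
by move=> p p'; apply/eqP; rewrite eqn_leq !le.
Qed.

Lemma powerset_pure F : pure_complex #|F| (powerset F).
Proof.
apply/pureP; split; last by move=> g; rewrite inE => gF; exists F; rewrite inE.
split; first by rewrite inE sub0set.
by move=> G H HG; rewrite !inE; apply: subset_trans.
Qed.

Lemma vd_pure C : vertex_decomposable C -> exists k, pure_complex k C.
Proof.
case=> [F|k {}C x pC _ _ _ _]; last by exists k.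
exists #|F|; exact: powerset_pure.
Qed.

Lemma link_pure k C x : pure_complex k.+1 C -> x \in vertices C -> pure_complex k (link C x).
Proof.
case/pureP=> sC pC; rewrite inE => Cx; apply/pureP; split; first exact: link_sc.
move=> g; rewrite !inE => /and3P[Cg xg /pC[F [CF xgF Fk]]]; exists (F :\ x).
have xF : x \in F by apply: (subsetP xgF); rewrite !inE eqxx.
rewrite !inE eqxx setD1K // CF /= subsetD1 xg.
rewrite (subset_trans (subsetUr [set x] g) xgF); split=> //.
  by rewrite andbT; case: sC => _; apply; [apply: subD1set|].
by move: Fk; rewrite (cardsD1 x) xF add1n => -[].
Qed.

Lemma deletion_sc C x : simplicial_complex C -> simplicial_complex (deletion C x).
Proof.
case=> C0 sC; split=> [|f g gf]; rewrite !inE ?C0 // => /andP[Cf xf].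
by rewrite (sC f) //=; apply: contra xf; apply: (subsetP gf).
Qed.

(** Points are shed one by one; as long as a second point exists, the deletion stays pure of the
    same dimension. *)
Lemma vd_points C : pure_complex 1 C -> vertex_decomposable C.
Proof.
move: {2}#|vertices C| (leqnn #|vertices C|) => n; elim: n C => [|n IHn] C.
  rewrite leqn0 cards_eq0 => /eqP C0 /pureP[[Cs0 sC] /(_ _ Cs0)[F [CF _ /eqP/cards1P[x Fx]]]].
  by move/setP/(_ x): C0; rewrite !inE -Fx CF.
move=> Cn pC; have [sC pC'] := (pureP 1 C).1 pC.
have [C0 dC] := sC.
have [F [CF _ /eqP/cards1P[x Fx]]] := pC' _ C0; rewrite {}Fx in CF.
have xC : x \in vertices C by rewrite inE.
have linkE : link C x = powerset set0.
  apply/setP => g; rewrite !inE subset0; apply/and3P/eqP => [[Cg xg xgC]|->]; last first.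
    by rewrite inE setU0 CF C0.
  apply/eqP; rewrite -cards_eq0 -leqn0 -ltnS; have := pure_le pC xgC.
  by rewrite cardsU1 xg.
have [E|[y [Cy yx]]] : C = powerset [set x] \/ exists y, y \in vertices C /\ y != x.
  case: (boolP [exists y, (y \in vertices C) && (y != x)]) => [/existsP[y /andP[Cy yx]]|].
    by right; exists y.
  rewrite negb_exists => /forallP noy; left; apply/setP => g; rewrite inE.
  apply/idP/idP => [Cg|]; last by move/dC; apply.
  apply/subsetP => y gy; have := noy y; rewrite !inE (dC g) ?sub1set //=.
  by rewrite negbK.
  by rewrite E; apply: vd_simplex.
have pdel : pure_complex 1 (deletion C x).
  apply/pureP; split; first exact: deletion_sc.
  move=> g; rewrite inE => /andP[Cg xg]; have [->|g0] := eqVneq g set0.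
    by exists [set y]; rewrite !inE eq_sym yx sub0set cards1; move: Cy; rewrite inE => ->.
  exists g; rewrite !inE Cg xg subxx; split=> //; apply/eqP.
  by rewrite eqn_leq (pure_le pC Cg) card_gt0.
apply: (vd_shed pC xC) => //; first by rewrite linkE; apply: vd_simplex.
apply: IHn => //; rewrite -ltnS; apply: leq_trans Cn; apply: proper_card.
apply/properP; split; last by exists x; rewrite // !inE eqxx andbF.
by apply/subsetP => v; rewrite !inE => /andP[].
Qed.

Definition cone z C : {set {set V}} := [set f : {set V} | f :\ z \in C].

Definition fresh z C := forall f, f \in C -> z \notin f.

Lemma cone_pure k z C : fresh z C -> pure_complex k C -> pure_complex k.+1 (cone z C).
Proof.
move=> zC /pureP[[C0 sC] pC]; apply/pureP; split.
  split; first by rewrite inE set0D.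
  by move=> f g gf; rewrite !inE; apply: sC; apply: setSD.
move=> g; rewrite inE => /pC[F [CF gF Fk]]; exists (z |: F).
rewrite inE setU1K ?zC // CF cardsU1 zC // Fk; split=> //.
by rewrite -subDset.
Qed.

Lemma vd_cone z C : fresh z C -> vertex_decomposable C -> vertex_decomposable (cone z C).
Proof.
move=> zC vC; elim: vC zC => {C} [F|k C x pC xC _ IHl _ IHd pd] zC.
  have -> : cone z (powerset F) = powerset (z |: F).
    by apply/setP => g; rewrite !inE subDset.
  exact: vd_simplex.
have xz : x != z.
  by apply/eqP => xz; move: xC; rewrite inE xz => /zC; rewrite !inE eqxx.
have xzE : [set x] :\ z = [set x] by apply/setDidPl; rewrite disjoints1 inE.
have linkE : link (cone z C) x = cone z (link C x).
  by apply/setP => g; rewrite !inE xz setDUl xzE.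
have delE : deletion (cone z C) x = cone z (deletion C x).
  by apply/setP => g; rewrite !inE xz.
have pcd : pure_complex k.+1 (cone z (deletion C x)).
  by apply: cone_pure => // g; rewrite inE => /andP[/zC].
apply: (@vd_shed _ k.+1 _ x).
- exact: cone_pure.
- by rewrite inE inE xzE; move: xC; rewrite inE.
- by rewrite linkE; apply: IHl => g; rewrite inE => /andP[/zC].
- by rewrite delE; apply: IHd => g; rewrite inE => /andP[/zC].
- by rewrite delE.
Qed.

Definition boundary F : {set {set V}} := [set g : {set V} | g \proper F].

Lemma boundary_pure F : F != set0 -> pure_complex #|F|.-1 (boundary F).
Proof.
move=> F0; apply/pureP; split.
  split; first by rewrite inE proper0.
  by move=> f g gf; rewrite !inE; apply: sub_proper_trans.
move=> g; rewrite inE => /properP[gF [x Fx xg]]; exists (F :\ x).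
rewrite inE properD1 // subsetD1 gF xg (cardsD1 x F) Fx; split=> //.
Qed.

Lemma proper_setD1 F g x : x \in F -> x \notin g -> (g \proper F :\ x) = (x |: g \proper F).
Proof.
move=> Fx xg; rewrite !properE subsetD1 xg andbT subUset sub1set Fx /=.
by rewrite subDset.
Qed.

(** Deleting a vertex leaves the simplex on the opposite facet, and the link of that vertex is the
    boundary of the same facet. *)
Lemma vd_boundary F : F != set0 -> vertex_decomposable (boundary F).
Proof.
move: {2}#|F| (leqnn #|F|) => n; elim: n F => [|n IHn] F.
  by rewrite leqn0 cards_eq0 => /eqP->; rewrite eqxx.
move=> Fn F0; have [x Fx] := set0Pn _ F0.
have delE : deletion (boundary F) x = powerset (F :\ x).
  apply/setP => g; rewrite !inE subsetD1 properE.
  case: (boolP (x \in g)) => xg; rewrite ?andbF //= !andbT.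
  by case: (g \subset F) => //=; apply/subsetP => /(_ x Fx); rewrite (negPf xg).
have [Fx0|Fx0] := eqVneq (F :\ x) set0.
  suff -> : boundary F = powerset set0 by apply: vd_simplex.
  have -> : F = [set x] by rewrite -(setD1K Fx) Fx0 setU0.
  by apply/setP => g; rewrite !inE properE subset0; apply/idP/idP;
    [rewrite subset1; case/andP=> /orP[/eqP->|//]; rewrite subxx
    |move/eqP->; rewrite sub0set sub1set inE].
apply: (@vd_shed _ #|F|.-1 _ x).
- exact: boundary_pure.
- rewrite !inE properEcard sub1set Fx cards1 (cardsD1 x) Fx add1n ltnS.
  by rewrite card_gt0.
- suff -> : link (boundary F) x = boundary (F :\ x).
    by apply: IHn => //; move: Fn; rewrite (cardsD1 x) Fx.
  apply/setP => g; rewrite !inE; case: (boolP (x \in g)) => xg /=.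
    rewrite andbF; apply/esym/negbTE; rewrite properE negb_and.
    by apply/orP; left; apply/subsetP => /(_ x xg); rewrite !inE eqxx.
  rewrite proper_setD1 //; case: (boolP (x |: g \proper F)); rewrite ?andbF // andbT.
  by apply: sub_proper_trans; apply: subsetUr.
- by rewrite delE; apply: vd_simplex.
- by rewrite delE (cardsD1 x F) Fx /=; apply: powerset_pure.
Qed.

End PureComplexes.

(** * Stacking over a facet *)

Section Stacking.
Variable V : finType.
Implicit Types (C T : {set {set V}}) (F G f g A B : {set V}) (v x y z w b : V).

(** Stellar subdivision of the facet [F]: it gives way to the cone with apex [z] over its
    boundary. *)
Definition stack (C : {set {set V}}) (F : {set V}) z : {set {set V}} :=
  [set f : {set V} | if z \in f then f :\ z \proper F else (f \in C) && (f != F)].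

(** This is what a stacking over [F] becomes when a vertex of [F] is deleted: one new facet remains,
    attached along the rest [R] of [F]. *)
Definition add_facet (C : {set {set V}}) (R : {set V}) z : {set {set V}} :=
  [set f : {set V} | if z \in f then f :\ z \subset R else f \in C].

Lemma stack_sc k C F z : pure_complex k C -> F \in C -> #|F| = k -> 0 < k ->
  simplicial_complex (stack C F z).
Proof.
move=> pC CF Fk k0; have [[C0 sC] _] := pC; split.
  by rewrite inE inE C0 /= eq_sym -card_gt0 Fk.
move=> f g gf; rewrite !inE; case: (boolP (z \in g)) => zg.
  by rewrite (subsetP gf) //; apply: sub_proper_trans; apply: setSD.
case: ifP => zf => [fF|/andP[Cf fF]].
  have gF : g \proper F.
    apply: sub_proper_trans fF; rewrite subsetD1 gf zg //.
  by rewrite (sC F) ?proper_sub // (proper_neq gF).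
rewrite (sC f) //=; apply: contraNneq fF => gF; apply/eqP.
by apply: (pure_eq pC Cf) => //; rewrite -gF.
Qed.

Lemma stack_extend k C F z f : 0 < k -> fresh z C -> F \in C -> #|F| = k -> f \proper F ->
  exists G, [/\ G \in stack C F z, f \subset G, z |: f \subset G & #|G| = k].
Proof.
move=> k0 zC CF Fk /properP[fF [x Fx xf]]; exists (z |: F :\ x).
have zF : z \notin F :\ x by rewrite !inE (negPf (zC F CF)) andbF.
rewrite inE setU11 setU1K // properD1 // cardsU1 zF -Fk (cardsD1 x F) Fx.
have sub : f \subset F :\ x by rewrite subsetD1 fF.
by split=> //; [apply: subset_trans sub (subsetUr _ _)|apply: setUS].
Qed.

Lemma stack_pure k C F z : pure_complex k C -> fresh z C -> F \in C -> #|F| = k -> 0 < k ->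
  pure_complex k (stack C F z).
Proof.
move=> pC zC CF Fk k0; apply/pureP; split; first exact: stack_sc pC CF Fk k0.
move=> f; rewrite inE; case: ifP => zf => [fF|/andP[Cf fF]].
  have [G [CG _ fG Gk]] := stack_extend k0 zC CF Fk fF.
  by exists G; rewrite setD1K in fG.
have [G [CG fG Gk]] := (((pureP k C).1 pC).2 f Cf).
have [GF|GF] := eqVneq G F; last by exists G; rewrite inE (negPf (zC G CG)) CG.
have [|H [CH fH _ Hk]] := @stack_extend k C F z f k0 zC CF Fk; last by exists H.
by rewrite properEneq fF -GF.
Qed.

Lemma vd_add_facet k C R z : fresh z C -> pure_complex k.+1 C -> vertex_decomposable C ->
  R \in C -> #|R| = k -> vertex_decomposable (add_facet C R z).
Proof.
move=> zC pC vC CR Rk; have [[C0 sC] pC'] := (pureP _ _).1 pC.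
have zR := zC R CR.
have delE : deletion (add_facet C R z) z = C.
  apply/setP => f; rewrite !inE; case: (boolP (z \in f)) => zf; rewrite ?andbF ?andbT //.
  by apply/esym/negbTE; apply: contraL zf; apply: zC.
have p : pure_complex k.+1 (add_facet C R z).
  apply/pureP; split.
    split; first by rewrite inE inE.
    move=> f g gf; rewrite !inE; case: (boolP (z \in g)) => zg.
      by rewrite (subsetP gf) //; apply: subset_trans; apply: setSD.
    case: ifP => zf; last exact: sC.
    by move=> fR; apply: sC CR; apply: subset_trans fR; rewrite subsetD1 gf.
  move=> f; rewrite inE; case: ifP => zf => [fR|/pC'[G [CG fG Gk]]].
    exists (z |: R); rewrite inE setU11 setU1K // cardsU1 zR Rk; split=> //.
    by rewrite -subDset.
  by exists G; rewrite inE (negPf (zC G CG)).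
apply: (vd_shed p (x := z)); rewrite ?delE //.
  by rewrite !inE eqxx setDv sub0set.
suff -> : link (add_facet C R z) z = powerset R by apply: vd_simplex.
apply/setP => f; rewrite !inE eqxx /=; case: (boolP (z \in f)) => zf /=.
  by rewrite andbF; apply/esym/negbTE/subsetP => /(_ z zf); apply/negP.
rewrite setU1K //; case: (boolP (f \subset R)) => fR; rewrite ?andbF // andbT.
exact: sC CR.
Qed.

Lemma link_stack k C F z x : pure_complex k C -> fresh z C -> F \in C -> #|F| = k -> x != z ->
  link (stack C F z) x = if x \in F then stack (link C x) (F :\ x) z else link C x.
Proof.
move=> pC zC CF Fk xz; have [[C0 sC] pC'] := (pureP _ _).1 pC.
have xzE : [set x] :\ z = [set x] by apply/setDidPl; rewrite disjoints1 inE.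
case: ifP => Fx; apply/setP => f; rewrite !inE (eq_sym z) (negPf xz) /=.
  rewrite setDUl xzE; case: (boolP (x \in f)) => xf /=.
    rewrite andbF; case: ifP => zf; rewrite ?andbF //.
    apply/esym/negbTE; rewrite properE negb_and; apply/orP; left.
    by apply/subsetP => /(_ x); rewrite !inE xf xz eqxx => /(_ isT).
  case: ifP => zf.
    rewrite proper_setD1 ?inE ?(negPf xf) ?andbF //.
    case: (boolP (x |: f :\ z \proper F)) => p; rewrite ?andbF // andbT.
    by apply: sub_proper_trans p; apply: subsetUr.
  have -> : (f != F) by apply: contraNneq xf => ->.
  rewrite andbT; case: (f \in C) => //=; case: (x |: f \in C) => //=.
  have [E|E] := eqVneq f (F :\ x); first by rewrite E setD1K // eqxx.
  by apply: contraNneq E => <-; rewrite setU1K.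
rewrite setDUl xzE; case: ifP => zf.
  have /negPf-> : f \notin C by apply: contraTN zf => /zC.
  suff -> : (x |: f :\ z \proper F) = false by rewrite !andbF.
  rewrite properE; apply/negbTE; rewrite negb_and; apply/orP; left.
  by apply/subsetP => /(_ x); rewrite !inE eqxx Fx => /(_ isT).
case: (boolP (x \in f)) => xf /=; first by rewrite !andbF.
have xfF : x |: f != F by apply: contraFneq Fx => <-; rewrite !inE eqxx.
rewrite xfF andbT; case: (boolP (x |: f \in C)) => xfC; rewrite ?andbF // !andbT.
case: (f \in C) => //=; apply: contraTneq xfC => ->.
by apply/negP => /(pure_le pC); rewrite cardsU1 Fx Fk ltnn.
Qed.

Lemma deletion_stack C F z x : x != z ->
  deletion (stack C F z) x =
    if x \in F then add_facet (deletion C x) (F :\ x) z else stack (deletion C x) F z.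
Proof.
move=> xz; case: ifP => Fx; apply/setP => f; rewrite !inE.
  case: ifP => zf; last first.
    case: (boolP (x \in f)) => xf; rewrite ?andbF //= !andbT.
    by case: (f \in C) => //=; apply: contraNneq xf => ->.
  rewrite subsetD1 !inE xz /= properE.
  case: (boolP (x \in f)) => xf; rewrite ?andbF //= !andbT.
  by case: (f :\ z \subset F) => //=; apply/subsetP => /(_ x Fx); rewrite !inE (negPf xf) andbF.
case: ifP => zf; last by rewrite andbAC.
case: (boolP (x \in f)) => xf; rewrite ?andbF ?andbT //.
apply/esym/negbTE; rewrite properE negb_and; apply/orP; left.
by apply/subsetP => /(_ x); rewrite !inE xf xz Fx => /(_ isT).
Qed.

Lemma deletion_stack_new C F z :
  fresh z C -> deletion (stack C F z) z = C :\ F.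
Proof.
move=> zC; apply/setP => f; rewrite !inE; case: (boolP (z \in f)) => zf.
  by rewrite andbF (contraTF (@zC f) zf) andbF.
by rewrite andbT andbC.
Qed.

(** The shedding vertex [x] of [C] still works. If it is outside [F], its link is unchanged and its
    deletion is a stacked complex. If it is in [F], its link is stacked over [F :\ x] and its
    deletion only gains a facet. Stacking a simplex gives a cone over a boundary. *)
Lemma vd_stack k C F z : vertex_decomposable C -> pure_complex k C -> fresh z C ->
  F \in C -> #|F| = k -> 0 < k -> vertex_decomposable (stack C F z).
Proof.
move=> vC; elim: vC k F => {C} [A|k' C x pC' xC vl IHl vd IHd pd] k F pC zC CF Fk k0.
  have FA : F = A.
    apply/esym; apply: (pure_eq pC); rewrite ?inE //.
    by move: CF; rewrite inE.
  have F0 : F != set0 by rewrite -card_gt0 Fk.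
  have -> : stack (powerset A) F z = cone z (boundary F).
    apply/setP => f; rewrite !inE; case: ifP => // zf; rewrite (setDidPl _).
      by rewrite properEneq andbC -FA.
    by rewrite disjoint_sym disjoints1 zf.
  apply: vd_cone (vd_boundary F0) => f; rewrite inE => /proper_sub fF.
  by apply: contra (zC F CF); apply: (subsetP fF).
have kk := pure_uniq pC' pC; rewrite {k'}kk in pd pC' *.
case: k => [//|[|k]] in pC Fk k0 pd {pC'} *.
  (* For points the induction hypothesis on links would be about [k = 0], where the facet is empty
     and cannot be stacked over. *)
  by apply: vd_points; apply: stack_pure.
have xz : x != z by apply/eqP => xz; move: xC; rewrite inE xz => /zC; rewrite !inE eqxx.
have fl : fresh z (link C x) by move=> f; rewrite inE => /andP[/zC].
have fd : fresh z (deletion C x) by move=> f; rewrite inE => /andP[/zC].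
have dC : deletion (stack C F z) x =
    if x \in F then add_facet (deletion C x) (F :\ x) z else stack (deletion C x) F z.
  exact: deletion_stack.
have lC := link_stack pC zC CF Fk xz.
have vdel : vertex_decomposable (deletion (stack C F z) x).
  rewrite dC; case: ifP => Fx; last first.
    by apply: (IHd k.+2) => //; rewrite inE CF Fx.
  apply: (@vd_add_facet k.+1) => //; last by move: Fk; rewrite (cardsD1 x) Fx add1n => -[].
  by rewrite !inE eqxx andbT; case: pC => -[_ sC] _; apply: sC CF; apply: subD1set.
have pdel : pure_complex k.+2 (deletion (stack C F z) x).
  (* Vertex decomposability already gives purity in some dimension; one face with [k.+2] elements
     and the bound from the whole complex determine it. *)
  have [j pj] := vd_pure vdel; rewrite -(_ : j = k.+2) //.
  case: (boolP (x \in F)) => Fx; rewrite ?(negPf Fx) ?Fx in dC.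
    have [[C0 _] pd'] := (pureP _ _).1 pd; have [G [dG _ Gk]] := pd' _ C0.
    apply/eqP; rewrite eqn_leq; apply/andP; split.
      have [[D0 _] /(_ _ D0)[H [DH _ Hj]]] := (pureP _ _).1 pj.
      rewrite -Hj; apply: (pure_le (stack_pure pC zC CF Fk isT)).
      by move: DH; rewrite inE => /andP[].
    by rewrite -Gk; apply: (pure_le pj); rewrite dC inE (negPf (fd G dG)).
  apply: pure_uniq pj _; rewrite dC; apply: stack_pure => //.
  by rewrite inE CF Fx.
apply: (vd_shed (stack_pure pC zC CF Fk isT) (x := x)) => //.
  rewrite !inE eq_sym (negPf xz); move: xC; rewrite inE => -> /=.
  by apply: contra_eqN Fk => /eqP <-; rewrite cards1.
rewrite lC; case: ifP => Fx //.
have lF : F :\ x \in link C x.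
  rewrite !inE eqxx setD1K // CF /= andbT.
  by case: pC => -[_ sC] _; apply: sC CF; apply: subD1set.
apply: (IHl k.+1) => //; first exact: link_pure.
by move: Fk; rewrite (cardsD1 x) Fx add1n => -[].
Qed.

Lemma stack_setD1 C F B z : z \notin B -> B != F -> stack C F z :\ B = stack (C :\ B) F z.
Proof.
move=> zB BF; apply/setP => f; rewrite !inE; case: ifP => zf.
  by rewrite (contraNneq _ zB) // => <-.
by rewrite andbA.
Qed.

Lemma setD1_sc k C F : 0 < k -> pure_complex k C -> #|F| = k -> simplicial_complex (C :\ F).
Proof.
move=> k0 pC Fk; have [[C0 sC] _] := pC; split; first by rewrite !inE C0 andbT eq_sym -card_gt0 Fk.
move=> f g gf; rewrite !inE => /andP[fF Cf]; rewrite (sC f) // andbT.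
by apply: contraNneq fF => gF; apply/eqP; apply: (pure_eq pC Cf _ Fk); rewrite -gF.
Qed.

(** Shed [z]. The deletion is [C :\ F]; the link is the boundary of [F] without its facet [F :\ x],
    which is a cone with apex [x] over the boundary of [F :\ x]. *)
Lemma vd_stack_setD1 k C F z x : 1 < k -> pure_complex k C -> pure_complex k (C :\ F) ->
  vertex_decomposable (C :\ F) -> fresh z C -> F \in C -> #|F| = k -> x \in F ->
  vertex_decomposable (stack C F z :\ (z |: F :\ x)).
Proof.
move=> k1 pC pCF vCF zC CF Fk Fx; have k0 := ltnW k1; have zF := zC F CF.
set A := z |: F :\ x; have zFx : z \notin F :\ x by rewrite !inE (negPf zF) andbF.
have Ak : #|A| = k by rewrite cardsU1 zFx -Fk (cardsD1 x F) Fx.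
have Fx0 : F :\ x != set0.
  by rewrite -card_gt0; move: k1; rewrite -Fk (cardsD1 x) Fx.
have pS := stack_pure pC zC CF Fk k0.
have zx : z != x by apply: contraNneq zF => ->.
have linkE : link (stack C F z :\ A) z = cone x (boundary (F :\ x)).
  apply/setP => f; rewrite !inE eqxx /=; case: (boolP (z \in f)) => zf /=.
    rewrite andbF; apply/esym/negbTE; rewrite properE negb_and; apply/orP; left.
    by apply/subsetP => /(_ z); rewrite !inE zf zx (negPf zF) andbF => /(_ isT).
  have fA : f != A by apply: contraNneq zf => ->; rewrite !inE eqxx.
  have zfA : (z |: f == A) = (f == F :\ x).
    by apply/eqP/eqP => [E|->//]; rewrite -(setU1K zf) E setU1K.
  rewrite fA zfA setU1K //=.
  have -> : (f \in C) && (f != F) && ((f != F :\ x) && (f \proper F))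
      = (f != F :\ x) && (f \proper F).
    case: (boolP (f \proper F)) => fF; rewrite ?andbF // !andbT (proper_neq fF) andbT.
    have -> // : f \in C by case: pC => -[_ sC] _; apply: sC CF; apply: proper_sub.
  apply/andP/idP => [[fFx /properP[fF [y Fy yf]]]|].
    rewrite properE setSD //=; apply/subsetP => sub.
    have [xy|xy] := eqVneq y x.
      rewrite xy in yf; case/negP: fFx; rewrite eqEsubset subsetD1 fF yf /=.
      by apply/subsetP => v /sub; rewrite !inE => /andP[].
    by have := sub y; rewrite !inE xy Fy (negPf yf) => /(_ isT).
  case/properP => fF [y]; rewrite !inE => /andP[yx Fy]; rewrite negb_and negbK (negPf yx) /= => yf.
  have fF' : f \subset F by rewrite -(setD1K Fx) -subDset.
  split; first by apply: contraNneq yf => ->; rewrite !inE yx.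
  by apply/properP; split=> //; exists y.
have delE : deletion (stack C F z :\ A) z = C :\ F.
  rewrite -(deletion_stack_new F zC); apply/setP => f; rewrite !inE.
  case: (boolP (z \in f)) => zf; rewrite ?andbF //.
  by have -> : f != A by apply: contraNneq zf => ->; rewrite !inE eqxx.
apply: (@vd_shed _ k _ z); rewrite ?delE //.
- apply/pureP; split; first exact: setD1_sc k0 pS Ak.
  move=> f; rewrite !inE => /andP[fA]; case: ifP => zf => [/properP[fF [y Fy yf]]|]; last first.
    case/andP=> Cf fF; have [|G [CG fG Gk]] := ((pureP _ _).1 pCF).2 f; first by rewrite !inE fF.
    exists G; move: CG; rewrite !inE => /andP[GF CG].
    have GA : G != A by apply: contraNneq (zC G CG) => ->; rewrite !inE eqxx.
    by rewrite (negPf (zC G CG)) CG GF GA.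
  (* Leaving out [y'] in place of [x] gives a new facet through [f] that is not the removed one. *)
  have [y' [Fy' y'f y'x]] : exists y', [/\ y' \in F, y' \notin f & y' != x].
    have [yx|yx] := eqVneq y x; last first.
      exists y; split=> //; move: yf; rewrite !inE negb_and negbK.
      by case/orP => // /eqP yz; move: Fy; rewrite yz (negPf zF).
    have /existsP[y' /and3P[]] : [exists y', [&& y' \in F, y' \notin f & y' != x]];
      last by exists y'.
    apply: contraNT fA; rewrite negb_exists => /forallP all.
    rewrite eqEsubset; apply/andP; split.
      rewrite -subDset subsetD1 fF /=; rewrite yx in yf; exact: yf.
    rewrite subUset sub1set zf /=; apply/subsetP => v; rewrite !inE => /andP[vx Fv].
    by have := all v; rewrite Fv vx !andbT negbK.
  exists (z |: F :\ y').
  have zFy : z \notin F :\ y' by rewrite !inE (negPf zF) andbF.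
  rewrite !inE eqxx setU1K //= properD1 // cardsU1 zFy -Fk (cardsD1 y' F) Fy'; split=> //.
    rewrite andbT; apply/eqP => /setP/(_ y'); rewrite !inE eqxx y'x Fy' orbT.
    by rewrite orbF => /eqP y'z; move: zF; rewrite -y'z Fy'.
  rewrite -subDset subsetD1 fF !inE negb_and y'f orbT //.
- rewrite !inE eqxx setDv proper0 -card_gt0 Fk k0 andbT.
  by apply/eqP => E; move: k1; rewrite -Ak -E cards1.
- rewrite linkE; apply: vd_cone (vd_boundary Fx0) => f; rewrite inE => /proper_sub fF.
  by apply/negP => /(subsetP fF); rewrite !inE eqxx.
Qed.

End Stacking.

(** * Injective renaming of vertices *)

Section Renaming.
Variables (V W : finType) (h : V -> W).
Hypothesis h_inj : injective h.
Implicit Types (C : {set {set V}}) (F g : {set V}).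

Definition map_complex C : {set {set W}} := [set h @: (g : {set V}) | g in C].

Lemma mem_map_complex C F : (h @: F \in map_complex C) = (F \in C).
Proof. by apply: mem_imset; apply: imset_inj. Qed.

Lemma map_complexP C (f : {set W}) :
  reflect (exists2 g, g \in C & f = h @: g) (f \in map_complex C).
Proof. exact: imsetP. Qed.

Lemma map_complex_sub F (f : {set W}) : f \subset h @: F -> exists2 g : {set V}, g \subset F & f = h @: g.
Proof.
move=> /subsetP fF; exists [set x in F | h x \in f].
  by apply/subsetP => x; rewrite inE => /andP[].
apply/setP => y; apply/idP/imsetP => [fy|[x]]; last by rewrite inE => /andP[_ fx] ->.
by have /imsetP[x Fx yx] := fF y fy; exists x; rewrite // inE Fx -yx.
Qed.

Lemma map_complex_sc C : simplicial_complex C -> simplicial_complex (map_complex C).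
Proof.
case=> C0 sC; split; first by rewrite -(imset0 h) mem_map_complex.
move=> F f fF /map_complexP[G CG FE]; rewrite FE in fF.
by have [g gG ->] := map_complex_sub fF; rewrite mem_map_complex (sC G).
Qed.

Lemma map_complex_pure k C : pure_complex k C -> pure_complex k (map_complex C).
Proof.
case/pureP => sC pC; apply/pureP; split; first exact: map_complex_sc.
move=> f /map_complexP[g Cg ->]; have [F [CF gF Fk]] := pC g Cg.
by exists (h @: F); rewrite mem_map_complex card_imset ?imsetS.
Qed.

Lemma map_complex_setD1 C F : map_complex (C :\ F) = map_complex C :\ (h @: F).
Proof.
apply/setP => f; rewrite in_setD1; apply/map_complexP/andP => [[g]|[fF /map_complexP[g Cg fE]]].
  by rewrite in_setD1 => /andP[gF Cg] ->; rewrite mem_map_complex (inj_eq (imset_inj h_inj)).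
by exists g; rewrite // in_setD1 Cg andbT; apply: contraNneq fF => <-; rewrite fE.
Qed.

Lemma link_map_complex C x : link (map_complex C) (h x) = map_complex (link C x).
Proof.
apply/setP => f; rewrite inE; apply/and3P/map_complexP.
  move=> [/map_complexP[g Cg ->]]; rewrite mem_imset // -imsetU1 mem_map_complex => xg xgC.
  by exists g; rewrite // inE Cg xg.
move=> [g]; rewrite inE => /and3P[Cg xg xgC] ->.
by rewrite mem_imset // -imsetU1 !mem_map_complex.
Qed.

Lemma deletion_map_complex C x : deletion (map_complex C) (h x) = map_complex (deletion C x).
Proof.
apply/setP => f; rewrite inE; apply/andP/map_complexP.
  by move=> [/map_complexP[g Cg ->]]; rewrite mem_imset // => xg; exists g; rewrite // inE Cg.
by move=> [g]; rewrite inE => /andP[Cg xg] ->; rewrite mem_imset // mem_map_complex.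
Qed.

Lemma vd_map_complex C : vertex_decomposable C -> vertex_decomposable (map_complex C).
Proof.
elim=> {C} [F|k C x pC xC _ IHl _ IHd pd].
  suff -> : map_complex (powerset F) = powerset (h @: F) by apply: vd_simplex.
  apply/setP => f; rewrite inE; apply/map_complexP/idP => [[g]|fF].
    by rewrite inE => gF ->; apply: imsetS.
  have [g gF ->] := map_complex_sub fF; exists g => //; by rewrite inE.
apply: (@vd_shed _ k _ (h x)); rewrite ?link_map_complex ?deletion_map_complex //; try exact: map_complex_pure.
by rewrite inE -imset_set1 mem_map_complex; move: xC; rewrite inE.
Qed.

End Renaming.

(** * One-point suspensions *)

Section OnePointSuspension.
Variable V : finType.
Implicit Types (C : {set {set V}}) (F G f g A : {set V}) (v x y z w b : V).

(* The one-point suspension: the vertex [w] is replaced by the edge [{w, b}], so that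
   the links of [w] and of [b] are both copies of [C]. *)
Definition suspension C w b : {set {set V}} :=
  [set f : {set V} | (f :\ b :\ w \in C) && ((b \in f) && (w \in f) ==> (f :\ b \in C))].

Variables (k : nat) (C : {set {set V}}) (w b : V).
Hypotheses (pC : pure_complex k C) (bC : fresh b C) (wC : w \in vertices C).
Hypothesis pd : pure_complex k (deletion C w).

Let C_sc : simplicial_complex C. Proof. by case: pC. Qed.

Let bw : b != w.
Proof. by apply: contraTneq wC => <-; rewrite inE; apply/negP => /bC; rewrite !inE eqxx. Qed.

Lemma suspension_sub f : f \in C -> f \in suspension C w b.
Proof.
move=> Cf; rewrite inE (negPf (bC Cf)) andbT.
by case: C_sc => _; apply; [|exact: Cf]; apply: subset_trans (subD1set _ _) (subD1set _ _).
Qed.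

Lemma mem_suspension_b f : b \notin f -> (b |: f \in suspension C w b) = (f \in C).
Proof.
move=> bf; rewrite inE setU1K // !inE eqxx /= (eq_sym w) (negPf bw) /=.
case: (boolP (w \in f)) => wf /=; last by rewrite (setDidPl _) ?andbT // disjoint_sym disjoints1 wf.
by apply/andb_idl; case: C_sc => _; apply; apply: subD1set.
Qed.

Lemma mem_suspension_Nb f : b \notin f -> (f \in suspension C w b) = (f :\ w \in C).
Proof.
move=> bf; rewrite inE (negPf bf) andbT (setDidPl (_ : [disjoint f & [set b]])) //.
by rewrite disjoint_sym disjoints1.
Qed.

Lemma link_suspension : link (suspension C w b) b = C.
Proof.
apply/setP => f; rewrite inE; case: (boolP (b \in f)) => bf /=; last first.
  rewrite mem_suspension_b //; apply/andb_idl => Cf; exact: suspension_sub.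
by rewrite andbF (contraTF (@bC f)).
Qed.

Lemma deletion_suspension : deletion (suspension C w b) b = cone w (deletion C w).
Proof.
apply/setP => f; rewrite inE; case: (boolP (b \in f)) => bf /=; last first.
  by rewrite mem_suspension_Nb // !inE eqxx andbT.
rewrite andbF inE; apply/esym/negbTE; rewrite inE negb_and; apply/orP; left.
by apply: contraL bf => /bC; rewrite !inE bw.
Qed.

Lemma suspension_sc : simplicial_complex (suspension C w b).
Proof.
case: C_sc => C0 sC; split; first by apply: suspension_sub.
move=> f g gf; rewrite !inE => /andP[fC fbC]; apply/andP; split.
  by apply: sC fC; apply: setSD; apply: setSD.
apply/implyP => /andP[bg wg]; apply: sC (implyP fbC _); first exact: setSD.
by rewrite !(subsetP gf).
Qed.

Lemma suspension_pure : pure_complex k.+1 (suspension C w b).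
Proof.
apply/pureP; split; first exact: suspension_sc.
move=> f; case: (boolP (b \in f)) => bf.
  rewrite -(setD1K bf) mem_suspension_b ?inE ?eqxx // => /(((pureP _ _).1 pC).2 _)[F [CF fF Fk]].
  by exists (b |: F); rewrite mem_suspension_b ?bC // cardsU1 bC // Fk setUS.
have <- : (f \in cone w (deletion C w)) = (f \in suspension C w b).
  by rewrite -deletion_suspension inE bf andbT.
have wd : fresh w (deletion C w) by move=> g; rewrite inE => /andP[].
case/(((pureP _ _).1 (cone_pure wd pd)).2 _) => F [CF fF Fk]; exists F; split=> //.
by move: CF; rewrite -deletion_suspension inE => /andP[].
Qed.

Lemma vd_suspension : vertex_decomposable C -> vertex_decomposable (deletion C w) ->
  vertex_decomposable (suspension C w b).
Proof.
move=> vC vd; have wd : fresh w (deletion C w) by move=> g; rewrite inE => /andP[].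
apply: (vd_shed suspension_pure (x := b)); rewrite ?link_suspension ?deletion_suspension //.
- by rewrite inE -[[set b]]setU0 mem_suspension_b ?inE //; case: C_sc.
- exact: vd_cone.
- exact: cone_pure.
Qed.

Lemma vd_suspension_setD1 A : 0 < k -> pure_complex k (C :\ A) -> vertex_decomposable (C :\ A) ->
  vertex_decomposable (deletion C w) -> A \in C -> #|A| = k ->
  vertex_decomposable (suspension C w b :\ (b |: A)).
Proof.
move=> k0 pCA vCA vd CA Ak; have wd : fresh w (deletion C w) by move=> g; rewrite inE => /andP[].
have bA := bC CA; set S := suspension C w b.
have lE : link (S :\ (b |: A)) b = C :\ A.
  apply/setP => f; rewrite inE [f \in _ :\ _]in_setD1 [b |: f \in _]in_setD1 [RHS]in_setD1.
  case: (boolP (b \in f)) => bf; first by rewrite andbF (contraTF (@bC f)) ?andbF.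
  have -> : f != b |: A by apply: contraNneq bf => ->; rewrite !inE eqxx.
  rewrite mem_suspension_b //=.
  have -> : (b |: f == b |: A) = (f == A).
    by apply/eqP/eqP => [E|->//]; rewrite -(setU1K bf) E setU1K.
  case: (f == A); rewrite ?andbF //=; apply/andb_idl => Cf; exact: suspension_sub.
have dE : deletion (S :\ (b |: A)) b = cone w (deletion C w).
  rewrite -deletion_suspension; apply/setP => f; rewrite inE in_setD1 [RHS]inE.
  case: (boolP (b \in f)) => bf; rewrite ?andbF //= !andbT.
  by have -> : f != b |: A by apply: contraNneq bf => ->; rewrite !inE eqxx.
have bAk : #|b |: A| = k.+1 by rewrite cardsU1 bA Ak.
have pS : pure_complex k.+1 (S :\ (b |: A)).
  apply/pureP; split; first exact: setD1_sc suspension_pure bAk.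
  move=> f; rewrite in_setD1 => /andP[fA]; case: (boolP (b \in f)) => bf.
    rewrite -(setD1K bf) mem_suspension_b ?inE ?eqxx // => Cf.
    have [|F [CF fF Fk]] := ((pureP _ _).1 pCA).2 (f :\ b).
      by rewrite in_setD1 Cf andbT; apply: contraNneq fA => <-; rewrite setD1K.
    move: CF; rewrite in_setD1 => /andP[FA CF]; exists (b |: F); split.
    - rewrite in_setD1 mem_suspension_b ?bC // CF andbT.
      by apply: contraNneq FA => E; apply/eqP; rewrite -(setU1K (bC CF)) E setU1K.
    - exact: setUS.
    - by rewrite cardsU1 bC // Fk.
  move=> Sf; have : f \in cone w (deletion C w) by rewrite -deletion_suspension inE Sf bf.
  case/(((pureP _ _).1 (cone_pure wd pd)).2 _) => F [CF fF Fk]; exists F; split=> //.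
  by move: CF; rewrite -dE inE => /andP[].
apply: (vd_shed pS (x := b)); rewrite ?lE ?dE //.
- rewrite inE in_setD1 -[X in X \in S]setU0 mem_suspension_b ?inE //.
  have -> : set0 \in C by case: C_sc.
  rewrite andbT; apply/eqP => E.
  by have := bAk; rewrite -E cards1 => -[k0']; rewrite -k0' in k0.
- exact: vd_cone.
- exact: cone_pure.
Qed.

(** The two suspension vertices are interchangeable, which carries the result on removing [b |: A]
    over to [w |: A]. *)
Lemma suspension_tperm f : (tperm w b @: f \in suspension C w b) = (f \in suspension C w b).
Proof.
have tI : injective (tperm w b) by apply: perm_inj.
have mt x (D : {set V}) : (x \in tperm w b @: D) = (tperm w b x \in D).
  by rewrite -{1}(tpermK w b x) mem_imset.
have tE : (tperm w b @: f) :\ b :\ w = f :\ b :\ w.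
  apply/setP => x; rewrite !inE mt; case: tpermP => [->|->|//]; first by rewrite eqxx.
  by rewrite eqxx andbF.
rewrite !inE tE !mt tpermL tpermR [(w \in f) && _]andbC; congr (_ && _).
case: (boolP ((b \in f) && (w \in f))) => //= /andP[bf wf].
suff -> : tperm w b @: f = f by [].
by apply/setP => x; rewrite mt; case: tpermP => [->|->|//]; rewrite bf wf.
Qed.

Lemma vd_suspension_setD1w A : 0 < k -> pure_complex k (C :\ A) -> vertex_decomposable (C :\ A) ->
  vertex_decomposable (deletion C w) -> A \in C -> #|A| = k -> w \notin A ->
  vertex_decomposable (suspension C w b :\ (w |: A)).
Proof.
move=> k0 pCA vCA vd CA Ak wA; have tI : injective (tperm w b) by apply: perm_inj.
have -> : suspension C w b :\ (w |: A) = map_complex (tperm w b) (suspension C w b :\ (b |: A)).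
  have tA : tperm w b @: (b |: A) = w |: A.
    rewrite imsetU1 tpermR; congr (_ |: _); apply/setP => x.
    rewrite -{1}(tpermK w b x) mem_imset //; case: tpermP => [->|->|//].
      by rewrite (negPf wA) (negPf (bC CA)).
    by rewrite (negPf wA) (negPf (bC CA)).
  rewrite map_complex_setD1 // tA; congr (_ :\ _); apply/setP => f.
  have fE : f = tperm w b @: (tperm w b @: f).
    by rewrite -imset_comp -[LHS]imset_id; apply: eq_imset => x; rewrite /= tpermK.
  by rewrite [in RHS]fE mem_map_complex // suspension_tperm.
by apply: vd_map_complex => //; apply: vd_suspension_setD1.
Qed.

End OnePointSuspension.

(** * Geometric realizations *)

Section Realization.
Local Open Scope ring_scope.
Variable R : realType.

Lemma big_option (Z : nmodType) (V : finType) (h : option V -> Z) :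
  \sum_o h o = h None + \sum_v h (Some v).
Proof.
rewrite (bigD1 None) //=; congr (_ + _); rewrite (reindex_omap Some id) //=; last by case.
by apply: eq_bigl => v; rewrite eqxx.
Qed.

Lemma small_forall (I : finType) (Q : I -> R -> Prop) :
  (forall i, exists2 e, 0 < e & forall t, 0 < t <= e -> Q i t) ->
  exists2 e, 0 < e & forall t, 0 < t <= e -> forall i, Q i t.
Proof.
move=> Qi; suff [e e0 Qe] : exists2 e, 0 < e & forall t, 0 < t <= e ->
    forall i, i \in enum I -> Q i t.
  by exists e => // t te i; apply: Qe; rewrite ?mem_enum.
elim: (enum I) => [|i s [e e0 Qe]]; first by exists 1.
have [e' e'0 Qe'] := Qi i; exists (Num.min e e'); first by rewrite lt_min e0.
move=> t /andP[t0]; rewrite le_min => /andP[te te'] j.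
by rewrite inE => /predU1P[->|]; [apply: Qe'; rewrite t0|apply: Qe; rewrite t0].
Qed.

Lemma small_linear (u w : R) : u < 0 ->
  exists2 e, 0 < e & forall t, 0 < t <= e -> u + t * w < 0.
Proof.
move=> u0; have w1 : 0 < `|w| + 1 by rewrite ltr_wpDl.
exists (- u / (`|w| + 1)); first by rewrite divr_gt0 // oppr_gt0.
move=> t /andP[t0]; rewrite ler_pdivlMr // => te.
have : t * w <= t * `|w| by rewrite ler_pM2l // ler_norm.
nra.
Qed.

Section Dot.
Variable d : nat.
Implicit Types (a x y : 'rV[R]_d).

Lemma dotDl a a' x : dot (a + a') x = dot a x + dot a' x.
Proof. by rewrite /dot -big_split; apply: eq_bigr => j _; rewrite mxE mulrDl. Qed.

Lemma dotZl k a x : dot (k *: a) x = k * dot a x.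
Proof. by rewrite /dot mulr_sumr; apply: eq_bigr => j _; rewrite mxE mulrA. Qed.

Lemma dotBl a a' x : dot (a - a') x = dot a x - dot a' x.
Proof. by rewrite -scaleN1r dotDl dotZl mulN1r. Qed.

Lemma dot0l x : dot 0 x = 0.
Proof. by rewrite -(scale0r 0) dotZl mul0r. Qed.

Lemma dotC a x : dot a x = dot x a.
Proof. by apply: eq_bigr => j _; rewrite mulrC. Qed.

Lemma dotZr k a x : dot a (k *: x) = k * dot a x.
Proof. by rewrite dotC dotZl dotC. Qed.

Lemma dot0r a : dot a 0 = 0.
Proof. by rewrite dotC dot0l. Qed.

Lemma dot_sumr (I : Type) (r : seq I) (P : pred I) (F : I -> 'rV[R]_d) a :
  dot a (\sum_(i <- r | P i) F i) = \sum_(i <- r | P i) dot a (F i).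
Proof.
apply: (big_morph (dot a)); last exact: dot0r.
by move=> x y; rewrite dotC dotDl !(dotC _ a).
Qed.

Lemma dot_suml (I : Type) (r : seq I) (P : pred I) (F : I -> 'rV[R]_d) x :
  dot (\sum_(i <- r | P i) F i) x = \sum_(i <- r | P i) dot (F i) x.
Proof. by rewrite dotC dot_sumr; apply: eq_bigr => i _; rewrite dotC. Qed.

End Dot.

(* [p] places the vertices of [C] so that [C] is the boundary of a simplicial
   polytope with the origin in its interior: every facet [F] lies on a hyperplane
   [dot alpha x = 1] with the other vertices strictly below, and the cones over the
   facets cover the space. *)
Record realizes (V : finType) (d : nat) (p : V -> 'rV[R]_d) (C : {set {set V}}) : Prop :=
  Realizes {
    rz_pure : pure_complex d C;
    rz_vert : forall v, [set v] \in C;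
    rz_supp : forall F, F \in C -> #|F| = d ->
      exists alpha, (forall v, v \in F -> dot alpha (p v) = 1) /\
                    (forall v, v \notin F -> dot alpha (p v) < 1);
    rz_dual : forall F, F \in C -> #|F| = d ->
      exists mu : V -> 'rV[R]_d, forall x v, x \in F -> v \in F ->
        dot (mu x) (p v) = (v == x)%:R;
    rz_cover : forall x, exists F (lambda : V -> R),
      [/\ F \in C, #|F| = d, forall v, 0 <= lambda v,
          forall v, v \notin F -> lambda v = 0 & x = \sum_v lambda v *: p v]
  }.

Definition extend_point (V : finType) d (p : V -> 'rV[R]_d) z (o : option V) : 'rV[R]_d :=
  if o is Some v then p v else z.

Lemma some_inj (V : Type) : injective (@Some V). Proof. by move=> x y []. Qed.

Lemma fresh_None (V : finType) (C : {set {set V}}) : fresh None (map_complex Some C).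
Proof. by move=> f /imsetP[g _ ->]; apply/imsetP => -[]. Qed.

Lemma facet_stack (V : finType) k (C : {set {set V}}) (F : {set V}) (f : {set option V}) :
  f \in stack (map_complex Some C) (Some @: F) None -> #|f| = k -> #|F| = k ->
  (exists G, [/\ G \in C, #|G| = k, G != F & f = Some @: G]) \/
  (exists2 y, y \in F & f = None |: Some @: (F :\ y)).
Proof.
rewrite inE; case: ifP => [Nf fF fk Fk|Nf /andP[/imsetP[G CG ->]]]; last first.
  rewrite (inj_eq (imset_inj (@some_inj V))) => GF Gk _; left; exists G.
  by rewrite (card_imset _ (@some_inj V)) in Gk.
right; have [g gF gE] := map_complex_sub (proper_sub fF).
have gk : #|g|.+1 = k by rewrite -fk (cardsD1 None f) Nf gE (card_imset _ (@some_inj V)) add1n.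
have [y Fy yg] : exists2 y, y \in F & y \notin g.
  apply/subsetPn; apply/negP => Fg; have := subset_leq_card Fg.
  by rewrite Fk -gk ltnn.
exists y => //; rewrite -(setD1K Nf) gE; suff -> : g = F :\ y by [].
apply/eqP; rewrite eqEcard subsetD1 gF yg /= -ltnS gk -Fk (cardsD1 y F) Fy.
by rewrite add1n leqnn.
Qed.

(** The new point is the sum of the vertices of [F] divided by [d - t] for a small [t > 0], that is,
    the barycentre of [F] pushed slightly outwards: beyond [F], but still beneath all other
    facets. *)
Lemma realizes_stack (V : finType) d (p : V -> 'rV[R]_d) C (F : {set V}) : (1 < d)%N ->
  realizes p C -> F \in C -> #|F| = d ->
  exists z, realizes (extend_point p z) (stack (map_complex Some C) (Some @: F) None).
Proof.
move=> d1 [pC vC sC dC cC] CF Fd; have d0 := ltnW d1.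
have [alpha [aF aNF]] := sC F CF Fd; have [mu muF] := dC F CF Fd.
(* How small [t] has to be: the left summands keep the new point strictly below the hyperplanes of
   the other facets, the right ones keep the vertices outside [F] strictly below the tilted
   hyperplanes of the new facets. *)
have [|e e0 He] := @small_forall ({set V} + V * V)%type (fun i t =>
  match i with
  | inl G => G \in C -> #|G| = d -> G != F -> exists beta,
       [/\ forall v, v \in G -> dot beta (p v) = 1, forall v, v \notin G -> dot beta (p v) < 1 &
           \sum_(v in F) dot beta (p v) - d%:R + t * 1 < 0]
  | inr (x, v) => v \notin F -> dot alpha (p v) - 1 + t * - dot (mu x) (p v) < 0
  end).
  case=> [G|[x v]].
    case: (boolP [&& G \in C, #|G| == d & G != F]) => [/and3P[CG /eqP Gd GF]|nG]; last first.
      by exists 1 => // t _ CG Gd GF; case/and3P: nG; rewrite CG Gd GF.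
    have [beta [bG bNG]] := sC G CG Gd.
    have [|e e0 He] := @small_linear (\sum_(v in F) dot beta (p v) - d%:R) 1; last first.
      by exists e => // t /He te _ _ _; exists beta.
    have [x Fx xG] : exists2 x, x \in F & x \notin G.
      apply/subsetPn; apply: contra GF => FG; apply/eqP/esym/eqP.
      by rewrite eqEcard FG Fd Gd leqnn.
    have dE : d%:R = \sum_(v in F) (1 : R) by rewrite sumr_const Fd.
    rewrite subr_lt0 dE (bigD1 x) //= [ltRHS](bigD1 x) //=.
    apply: ltr_leD; first exact: bNG.
    apply: ler_sum => v _; case: (boolP (v \in G)) => [/bG->//|/bNG/ltW//].
  case: (boolP (v \in F)) => vF; first by exists 1 => // t _; rewrite vF.
  have [|e e0 He] := @small_linear (dot alpha (p v) - 1) (- dot (mu x) (p v)).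
    by rewrite subr_lt0; apply: aNF.
  by exists e => // t /He te _.
pose t := Num.min e 2^-1.
have t0 : 0 < t by rewrite lt_min e0 invr_gt0 ltr0n.
have te : 0 < t <= e by rewrite t0 ge_min lexx.
have dt : 0 < d%:R - t.
  rewrite subr_gt0; apply: (@le_lt_trans _ _ 2^-1); first by rewrite ge_min lexx orbT.
  by apply: (@lt_le_trans _ _ 1); [rewrite invf_lt1 ?ltr1n|rewrite ler1n].
have {He}Hte := He t te.
pose z := (d%:R - t)^-1 *: \sum_(v in F) p v; exists z.
have muz y : y \in F -> dot (mu y) z = (d%:R - t)^-1.
  move=> Fy; rewrite dotZr dot_sumr (bigD1 y) //= muF // eqxx big1 ?addr0 ?mulr1 // => v /andP[Fv vy].
  by rewrite muF // (negPf vy).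
have alz : dot alpha z = d%:R / (d%:R - t).
  rewrite dotZr dot_sumr (eq_bigr (fun=> 1)) => [|v Fv]; last exact: aF.
  by rewrite sumr_const Fd mulrC.
have si := @some_inj V.
have N0 (G : {set V}) : None \notin (Some @: G : {set option V}) by apply/imsetP => -[].
have mS (G : {set V}) v : (Some v \in (Some @: G : {set option V})) = (v \in G).
  by rewrite mem_imset //; apply: some_inj.
have pCS : pure_complex d (stack (map_complex Some C) (Some @: F) None).
  apply: stack_pure => //.
  - exact: map_complex_pure (@some_inj V) _ _ pC.
  - exact: fresh_None.
  - by rewrite mem_map_complex //; apply: some_inj.
  - by rewrite card_imset //; apply: some_inj.
split=> //.
- case=> [v|]; rewrite !inE //=; last by rewrite setDv proper0 -card_gt0 card_imset // Fd.
  rewrite -imset_set1 mem_map_complex // vC /= (inj_eq (imset_inj (@some_inj V))).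
  by apply: contraTneq d1 => E; rewrite -Fd -E cards1.
- move=> f Cf fd; have [[G [CG Gd GF ->]]|[y Fy ->]] := facet_stack Cf fd Fd.
    have [beta [bG bNG bz]] := Hte (inl G) CG Gd GF; exists beta; split.
      by case=> [v|]; rewrite ?(negPf (N0 G)) // mS; apply: bG.
    case=> [v|_] /=; first by rewrite mS; apply: bNG.
    by rewrite dotZr dot_sumr mulrC ltr_pdivrMr // mul1r; lra.
  (* Tilting by [t *: mu y] lowers the value at [y] to [1 - t] and brings the value at the new point
     from [d / (d - t)] down to 1. *)
  exists (alpha - t *: mu y); split=> [] [v|] /=.
  + rewrite !inE /= mS !inE => /andP[vy Fv].
    by rewrite dotBl dotZl aF // muF // (negPf vy) mulr0 subr0.
  + by rewrite dotBl dotZl alz muz // -mulrBl divff // gt_eqF.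
  + rewrite !inE /= mS !inE negb_and negbK => /orP[/eqP->|vF].
      by rewrite dotBl dotZl aF // muF // eqxx mulr1 gtrBl.
    by have := Hte (inr (y, v)) vF; rewrite dotBl dotZl; lra.
  + by rewrite !inE eqxx.
- move=> f Cf fd; have [[G [CG Gd GF ->]]|[y Fy ->]] := facet_stack Cf fd Fd.
    have [nu nuG] := dC G CG Gd; exists (fun o => if o is Some x then nu x else 0).
    case=> [x|] [v|]; rewrite ?(negPf (N0 G)) ?mS //= => xG vG.
    by rewrite nuG.
  exists (fun o => if o is Some x then mu x - mu y else (d%:R - t) *: mu y).
  case=> [x|] [v|]; rewrite !inE /= ?mS ?inE.
  + move=> /andP[xy Fx] /andP[vy Fv].
    by rewrite dotBl !muF // (negPf vy) subr0.
  + by move=> /andP[xy Fx] _; rewrite dotBl !muz // subrr.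
  + by move=> _ /andP[vy Fv]; rewrite dotZl muF // (negPf vy) mulr0.
  + by move=> _ _; rewrite dotZl muz // divff // gt_eqF.
- move=> x; have [G [la [CG Gd la0 laG xE]]] := cC x.
  have [GF|GF] := eqVneq G F; last first.
    exists (Some @: G), (fun o => if o is Some v then la v else 0).
    split; first 1 last.
    + by rewrite card_imset.
    + by case.
    + by case=> // v; rewrite mS; apply: laG.
    + by rewrite big_option /= scale0r add0r.
    by rewrite inE (negPf (N0 G)) mem_map_complex // CG (inj_eq (imset_inj (@some_inj V))).
  rewrite {G}GF in CG Gd laG.
  have [x0 Fx0] : exists x0, x0 \in F by apply/set0Pn; rewrite -card_gt0 Fd.
  (* Trading the least coefficient, taken from all vertices of [F], for a multiple of the new point
     makes the coefficient of [y] vanish and leaves the others nonnegative. *)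
  have [y Fy ymin] : exists2 y, y \in F & forall v, v \in F -> la y <= la v.
    by case: (arg_minP la Fx0) => y Fy ymin; exists y.
  exists (None |: Some @: (F :\ y)), (fun o => if o is Some v then
     (if v \in F then la v - la y else 0) else la y * (d%:R - t)).
  have zF : None \notin Some @: (F :\ y) by [].
  split.
  + rewrite inE setU11 setU1K // properEcard imsetS ?subD1set //= !card_imset //.
    by rewrite [ltnRHS](cardsD1 y) Fy.
  + by rewrite cardsU1 zF card_imset // -Fd (cardsD1 y F) Fy.
  + case=> [v|]; last by rewrite mulr_ge0 // ltW.
    by case: ifP => // Fv; rewrite subr_ge0 ymin.
  + case=> [v|]; rewrite !inE //= mS !inE negb_and negbK.
    by case: ifP => // Fv; rewrite orbF => /eqP->; rewrite subrr.
  rewrite big_option /= scalerA mulfK ?gt_eqF // scaler_sumr xE.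
  rewrite [X in _ = X + _]big_mkcond -big_split /=; apply: eq_bigr => v _.
  case: ifP => Fv; first by rewrite -scalerDl addrC subrK.
  by rewrite laG ?Fv // scale0r addr0.
Qed.

End Realization.

(** * Realizing one-point suspensions *)

Section SuspensionRealization.
Local Open Scope ring_scope.
Variable R : realType.

Definition lift_row d (h : R) (x : 'rV[R]_d) : 'rV[R]_d.+1 := @row_mx R 1 1 d h%:M x.

Lemma dot_lift d h g (x y : 'rV[R]_d) : dot (lift_row h x) (lift_row g y) = h * g + dot x y.
Proof.
rewrite /dot /lift_row (@big_split_ord _ _ _ 1 d) /= big_ord1; congr (_ + _).
  by rewrite !(@row_mxEl R 1 1 d) !mxE eqxx !mulr1n.
by apply: eq_bigr => j _; rewrite !(@row_mxEr R 1 1 d).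
Qed.

Lemma lift_rowP d (X : 'rV[R]_d.+1) : exists h x, X = lift_row h x.
Proof.
exists (@lsubmx R 1 1 d X 0 0), (@rsubmx R 1 1 d X).
by rewrite /lift_row -mx11_scalar; apply/esym/(@hsubmxK _ 1 1 d).
Qed.

Lemma lift_rowD d h g (x y : 'rV[R]_d) :
  lift_row h x + lift_row g y = lift_row (h + g) (x + y).
Proof. by rewrite /lift_row raddfD; apply: (@add_row_mx _ 1 1 d). Qed.

Lemma lift_rowZ d k h (x : 'rV[R]_d) : k *: lift_row h x = lift_row (k * h) (k *: x).
Proof. by rewrite /lift_row -scale_scalar_mx; apply: (@scale_row_mx _ 1 1 d). Qed.

Lemma lift_row0 d : lift_row 0 (0 : 'rV[R]_d) = 0.
Proof. by rewrite -[RHS](scale0r (lift_row 0 0)) lift_rowZ mul0r scale0r. Qed.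

Lemma lift_row_sum d (I : finType) (h : I -> R) (x : I -> 'rV[R]_d) :
  \sum_i lift_row (h i) (x i) = lift_row (\sum_i h i) (\sum_i x i).
Proof.
elim/big_rec3: _ => [|i h' s x' _ ->]; first by rewrite lift_row0.
by rewrite lift_rowD.
Qed.

(** The complex stays at height 0, except that [w] splits into a point at height 1 and one at height
    -1; [None] is the lower one. *)
Definition suspension_point (V : finType) d (p : V -> 'rV[R]_d) w (o : option V) : 'rV[R]_d.+1 :=
  if o is Some v then lift_row (v == w)%:R (p v) else lift_row (-1) (p w).

Lemma facet_suspension (V : finType) k (C : {set {set V}}) w (f : {set option V}) :
  pure_complex k C -> [set w] \in C ->
  f \in suspension (map_complex Some C) (Some w) None -> #|f| = k.+1 ->
  exists G : {set V}, [/\ G \in C, #|G| = k &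
    f = None |: Some @: G \/ (w \notin G /\ f = Some @: (w |: G))].
Proof.
move=> pC wC Sf fk; have si := @some_inj V; have fr := @fresh_None V C.
have pmC : pure_complex k (map_complex Some C) by apply: map_complex_pure.
have wmC : Some w \in vertices (map_complex Some C).
  by rewrite inE -imset_set1 mem_map_complex.
case: (boolP (None \in f)) => Nf.
  move: Sf; rewrite -{1}(setD1K Nf) (mem_suspension_b pmC fr wmC) ?inE ?eqxx //.
  case/imsetP => G CG fE; exists G; rewrite -(setD1K Nf) fE; split=> //; last by left.
  by move: fk; rewrite (cardsD1 None) Nf fE card_imset // add1n => -[].
move: Sf; rewrite mem_suspension_Nb // => /imsetP[G CG fE]; exists G.
have := fk; rewrite (cardsD1 (Some w)) fE card_imset //.
case: (boolP (Some w \in f)) => fw /= Gk; last first.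
  by have := pure_le pC CG; rewrite -[#|G|]add0n Gk ltnn.
have Gk' : #|G| = k by move: Gk; rewrite add1n => -[].
split=> //; right; split; last by rewrite imsetU1 -fE setD1K.
by rewrite -(mem_imset G w si) -fE !inE eqxx.
Qed.

Lemma realizes_suspension (V : finType) d (p : V -> 'rV[R]_d) C w :
  realizes p C -> pure_complex d (deletion C w) ->
  realizes (suspension_point p w) (suspension (map_complex Some C) (Some w) None).
Proof.
move=> [pC vC sC dC cC] pd; have si := @some_inj V; have fr := @fresh_None V C.
have N0 (G : {set V}) : None \notin (Some @: G : {set option V}) by apply/imsetP => -[].
have mS (G : {set V}) v : (Some v \in (Some @: G : {set option V})) = (v \in G).
  by rewrite mem_imset.
have pmC : pure_complex d (map_complex Some C) by apply: map_complex_pure.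
have wmC : Some w \in vertices (map_complex Some C).
  by rewrite inE -imset_set1 mem_map_complex.
have pmd : pure_complex d (deletion (map_complex Some C) (Some w)).
  by rewrite deletion_map_complex //; apply: map_complex_pure.
split; first exact: suspension_pure.
- case=> [v|].
    by apply: (suspension_sub _ pmC fr); rewrite -imset_set1 mem_map_complex.
  rewrite -[[set None]]setU0 (mem_suspension_b pmC fr wmC) ?inE //.
  by case: pmC => -[].
- move=> f Sf fd; have [G [CG Gd fE]] := facet_suspension pC (vC w) Sf fd.
  have [al [aG aNG]] := sC G CG Gd.
  have aw : w \notin G -> 0 < 1 - dot al (p w) by move=> /aNG; rewrite subr_gt0.
  case: fE => [->|[wG ->]].
    case: (boolP (w \in G)) => wG.
      exists (lift_row 0 al); split; case=> [v|] //=; rewrite ?inE ?mS /= dot_lift mul0r add0r //.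
      + exact: aG.
      + by rewrite aG.
      + exact: aNG.
    (* The first coordinate is determined by the value 1 at the lower copy of [w]. *)
    exists (lift_row (dot al (p w) - 1) al); split; case=> [v|]; rewrite !inE ?mS //= dot_lift.
    + move=> Gv; rewrite (_ : v == w = false) ?mulr0 ?add0r ?aG //.
      by apply: contraNF wG => /eqP<-.
    + by move=> _; lra.
    + move=> vG; have [->|_] := eqVneq v w; last by rewrite mulr0 add0r aNG.
      by have := aw wG; rewrite /=; lra.
  exists (lift_row (1 - dot al (p w)) al); split; case=> [v|]; rewrite ?mS ?(negPf (N0 _)) ?N0 //=
    dot_lift ?inE.
  + have [->|_] := eqVneq v w; first by move=> _ /=; lra.
    by move=> Gv; rewrite mulr0 add0r aG.
  + have [//|_] := eqVneq v w; rewrite mulr0 add0r; exact: aNG.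
  + by move=> _; have := aw wG; lra.
- move=> f Sf fd; have [G [CG Gd fE]] := facet_suspension pC (vC w) Sf fd.
  have [mu muG] := dC G CG Gd.
  case: fE => [->|[wG ->]].
    case: (boolP (w \in G)) => wG.
      exists (fun o => if o is Some x then
          (if x == w then lift_row 2^-1 (2^-1 *: mu w) else lift_row 0 (mu x))
          else lift_row (- 2^-1) (2^-1 *: mu w)).
      case=> [x|] [v|]; rewrite !inE ?mS //= => Gx Gv.
      + have [->|xw] := eqVneq x w; rewrite dot_lift ?mul0r ?add0r ?muG //.
        rewrite dotZl muG // (inj_eq si); case: (eqVneq v w) => _ /=; lra.
      + have [xw|xw] := eqVneq x w; rewrite dot_lift ?mul0r ?add0r ?dotZl muG //.
          by rewrite eqxx /=; lra.
        by rewrite eq_sym (negPf xw).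
      + rewrite dot_lift dotZl muG //; case: (eqVneq v w) => _ /=; lra.
      + by rewrite dot_lift dotZl muG // !eqxx /=; lra.
    exists (fun o => if o is Some x then lift_row (dot (mu x) (p w)) (mu x) else lift_row (-1) 0).
    case=> [x|] [v|]; rewrite !inE ?mS //= => Gx Gv; rewrite dot_lift ?dot0l.
    + rewrite (muG x v) // (inj_eq si) (_ : v == w = false) ?mulr0 ?add0r //.
      by apply: contraNF wG => /eqP<-.
    + by lra.
    + rewrite (_ : v == w = false) ?mulr0 ?add0r //.
      by apply: contraNF wG => /eqP<-.
    + by rewrite /=; lra.
  exists (fun o => if o is Some x then
      (if x == w then lift_row 1 0 else lift_row (- dot (mu x) (p w)) (mu x)) else 0).
  case=> [x|] [v|]; rewrite ?mS ?(negPf (N0 _)) // !inE => Gx Gv.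
  rewrite /=; have [xw|xw] := eqVneq x w; rewrite dot_lift.
    by rewrite xw dot0l addr0 mul1r.
  rewrite (negPf xw) /= in Gx; have [vw|vw] := eqVneq v w.
    by rewrite vw eq_sym (inj_eq si) (negPf xw) /=; lra.
  rewrite (negPf vw) /= in Gv; rewrite mulr0 add0r muG //.
move=> X; have [h [y XE]] := lift_rowP X.
(* Removing this multiple of [p w] leaves [la w + |h|] to be divided between the two copies of [w]
   with difference [h], so both shares are nonnegative. If [w] is not in [G], one share is 0, and
   the sign of [h] selects the facet. *)
have [G [la [CG Gd la0 laG yE]]] := cC (y - `|h| *: p w).
pose la' o := match o with
  | Some v => if v == w then la w / 2 + (`|h| + h) / 2 else la v
  | None => la w / 2 + (`|h| - h) / 2 end.
have la'0 o : 0 <= la' o.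
  have lw := la0 w; have := ler_norm h; have := ler_norm (- h); rewrite normrN => h1 h2.
  by case: o => [v|] /=; [case: ifP => _ //; lra|lra].
have XE' : X = \sum_o la' o *: suspension_point p w o.
  rewrite big_option (eq_bigr (fun v => lift_row (la' (Some v) * (v == w)%:R)
    (la' (Some v) *: p v))) => [|v _]; last by rewrite -lift_rowZ.
  rewrite lift_row_sum lift_rowZ lift_rowD XE; congr lift_row.
    rewrite (bigD1 w) //= eqxx big1 ?addr0 => [|v /negPf->]; last by rewrite mulr0.
    by rewrite mulr1 mulrN1; lra.
  rewrite -[LHS](subrK (`|h| *: p w)) yE !(bigD1 w (P := predT)) //= eqxx addrA -scalerDl addrAC -scalerDl.
  congr (_ *: _ + _); first by lra.
  by apply: eq_bigr => v /negPf->.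
case: (boolP (w \in G)) => wG.
  exists (None |: Some @: G), la'; split=> //.
  + by rewrite (mem_suspension_b pmC fr wmC) // mem_map_complex.
  + by rewrite cardsU1 N0 card_imset // Gd.
  + case=> [v|]; rewrite !inE ?mS //= => vG.
    by rewrite ifN ?laG //; apply: contraNneq vG => ->.
have [h0|h0] := leP 0 h.
  exists (Some @: (w |: G)), la'; split=> //.
  + rewrite mem_suspension_Nb // imsetU1 setU1K ?mS // mem_map_complex //.
  + by rewrite card_imset // cardsU1 wG Gd.
  + case=> [v|] /=; last by rewrite laG // ger0_norm //; lra.
    by rewrite mS !inE negb_or => /andP[vw vG]; rewrite (negPf vw) laG.
exists (None |: Some @: G), la'; split=> //.
+ by rewrite (mem_suspension_b pmC fr wmC) // mem_map_complex.
+ by rewrite cardsU1 N0 card_imset // Gd.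
+ case=> [v|]; rewrite !inE ?mS //= => vG.
  case: eqVneq => [vw|_]; last exact: laG.
  by rewrite laG // ltr0_norm //; lra.
Qed.

End SuspensionRealization.

(** * The boundary of a segment *)

Section TwoPoints.
Variable R : realType.

Definition two_points (b : bool) : 'rV[R]_1 := const_mx (if b then 1 else -1)%R.

Definition two_points_complex : {set {set bool}} := [set f : {set bool} | (#|f| <= 1)%N].

Lemma two_points_face f : f \in two_points_complex -> f = set0 \/ exists v, f = [set v].
Proof.
rewrite inE; case E: #|f| => [|[|]] // _; first by left; apply: cards0_eq.
by right; apply/cards1P; rewrite E.
Qed.

Lemma two_points_deletion v : deletion two_points_complex v = powerset [set ~~ v].
Proof.
apply/setP => f; rewrite [RHS]inE; apply/idP/idP => [|fv].
  rewrite inE => /andP[/two_points_face[->|[u ->]]]; rewrite ?sub0set //.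
  by rewrite sub1set !inE; case: u v => [] [].
rewrite !inE (leq_trans (subset_leq_card fv)) ?cards1 //.
by apply/negP => /(subsetP fv); rewrite inE; case: (v).
Qed.

Lemma two_points_setD1 v : two_points_complex :\ [set v] = powerset [set ~~ v].
Proof.
rewrite -two_points_deletion; apply/setP => f; rewrite in_setD1 [RHS]inE.
case: (boolP (f \in _)) => [/two_points_face[->|[u ->]]|_]; rewrite ?andbF ?andbT //=.
  by rewrite inE; apply/eqP => /setP/(_ v); rewrite !inE eqxx.
by rewrite inE (inj_eq set1_inj) eq_sym.
Qed.

Lemma two_points_pure : pure_complex 1 two_points_complex.
Proof.
apply/pureP; split.
  split; first by rewrite inE cards0.
  by move=> F G GF; rewrite !inE; apply: leq_trans; apply: subset_leq_card.
move=> f /two_points_face[->|[v ->]]; first by exists [set true]; rewrite inE sub0set cards1.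
by exists [set v]; rewrite inE subxx cards1.
Qed.

Local Open Scope ring_scope.

Lemma dot_two_points u v : dot (two_points u) (two_points v) = if u == v then 1 else -1.
Proof. by rewrite /dot big_ord1 !mxE; case: u v => [] [] /=; lra. Qed.

Lemma realizes_two_points : realizes two_points two_points_complex.
Proof.
split.
- exact: two_points_pure.
- by move=> v; rewrite inE cards1.
- move=> F _ /eqP/cards1P[v ->]; exists (two_points v).
  split=> u; rewrite inE dot_two_points; first by move=> /eqP->; rewrite eqxx.
  by move=> /negPf; rewrite eq_sym => ->; lra.
- move=> F _ /eqP/cards1P[v ->]; exists two_points => x u; rewrite !inE => /eqP-> /eqP->.
  by rewrite dot_two_points eqxx.
- move=> x; exists [set 0 <= x 0 0], (fun v => if v == (0 <= x 0 0) then `|x 0 0| else 0).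
  split; rewrite ?inE ?cards1 //.
  + by move=> v; case: ifP.
  + by move=> v; rewrite inE => /negPf->.
  rewrite (bigD1 (0 <= x 0 0)) //= eqxx big1 ?addr0 => [|v /negPf->]; last by rewrite scale0r.
  apply/rowP => j; rewrite !mxE (ord1 j); case: ifP => x0; first by rewrite ger0_norm ?mulr1.
  by rewrite ltr0_norm ?mulrN1 ?opprK // ltNge x0.
Qed.

End TwoPoints.

(** * Exposed faces of a realized complex *)

Section FacesOfRealization.
Local Open Scope ring_scope.
Variables (R : realType) (V : finType) (d : nat) (p : V -> 'rV[R]_d) (C : {set {set V}}).
Hypothesis pC : realizes p C.
Hypothesis d_gt0 : (0 < d)%N.

(** Covering [- p v] expresses that the origin is interior, in the form used below: a nonnegative
    combination with positive weight on [v]. *)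
Lemma zero_comb v : exists2 la : V -> R, (forall u, 0 <= la u) & p v + \sum_u la u *: p u = 0.
Proof.
by have [F [la [_ _ la0 _ E]]] := rz_cover pC (- p v); exists la; rewrite // -E subrr.
Qed.

(** Take the facet [F] whose cone contains the sum of the vertices in the exposed set [A], with
    coefficients [la] and normal [al]. Evaluating [a] gives [#|A| <= \sum_v la v], since [b > 0].
    Evaluating [al] shows that the right side is the sum of [al] over [A], with terms at most 1.
    Hence all these terms equal 1, and [A] lies in [F]. *)
Lemma face_subset_facet a b v0 : (forall v, dot a (p v) <= b) -> dot a (p v0) < b ->
  exists F, [/\ F \in C, #|F| = d & forall v, dot a (p v) = b -> v \in F].
Proof.
move=> le_b lt_b; have b0 : 0 < b.
  have [la la0 E] := zero_comb v0.
  have := dot0r a; rewrite -E dotC dotDl dotC dot_suml => /eqP.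
  have le : \sum_u dot (la u *: p u) a <= (\sum_u la u) * b.
    by rewrite mulr_suml; apply: ler_sum => u _; rewrite dotZl dotC ler_wpM2l.
  have s0 : 0 <= \sum_u la u by apply: sumr_ge0.
  nra.
have [A0|[v1 v1A]] := set_0Vmem [set v | dot a (p v) == b].
  have [[C0 _] /(_ _ C0)[F [CF _ Fd]]] := (pureP _ _).1 (rz_pure pC).
  by exists F; split=> // v /eqP av; move/setP/(_ v): A0; rewrite !inE av.
set A := [set v | _] in v1A.
have [F [la [CF Fd la0 laF E]]] := rz_cover pC (\sum_(v in A) p v).
have [al [aF aNF]] := rz_supp pC CF Fd; exists F; split=> //.
have le1 v : dot al (p v) <= 1 by case: (boolP (v \in F)) => [/aF->|/aNF/ltW].
have la_sum : dot al (\sum_(v in A) p v) = \sum_v la v.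
  rewrite E dot_sumr; apply: eq_bigr => v _; rewrite dotZr.
  by case: (boolP (v \in F)) => [/aF->|/laF->]; rewrite ?mulr1 ?mul0r.
have A_sum : \sum_(v in A) b <= b * \sum_v la v.
  have -> : \sum_(v in A) b = dot a (\sum_(v in A) p v).
    by rewrite dot_sumr; apply: eq_bigr => v; rewrite inE => /eqP.
  by rewrite E dot_sumr mulr_sumr; apply: ler_sum => v _; rewrite dotZr mulrC ler_wpM2r.
have {A_sum} cA : \sum_(v in A) 1 <= dot al (\sum_(v in A) p v).
  rewrite la_sum -(ler_pM2l b0); apply: le_trans A_sum; rewrite mulr_sumr.
  by apply: ler_sum => v _; rewrite mulr1.
move=> v av; apply/negPn/negP => /aNF vF.
have Av : v \in A by rewrite inE av.
move: cA; rewrite dot_sumr (bigD1 v) //= [leRHS](bigD1 v) //= leNgt => /negP; apply.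
by apply: ltr_leD => //; apply: ler_sum.
Qed.

(** Tilt the hyperplane of a facet [F] through [A]: [nu] is 0 on [A] and 1 on the rest of [F], so
    subtracting a small multiple of it keeps only [A] on the hyperplane. *)
Lemma exposed_face A : A \in C -> exists a,
  (forall v, v \in A -> dot a (p v) = 1) /\ (forall v, v \notin A -> dot a (p v) < 1).
Proof.
move=> CA; have [_ /(_ _ CA)[F [CF AF Fd]]] := (pureP _ _).1 (rz_pure pC).
have [al [aF aNF]] := rz_supp pC CF Fd; have [mu muF] := rz_dual pC CF Fd.
pose nu := \sum_(y in F :\: A) mu y.
have nuF v : v \in F -> dot nu (p v) = (v \notin A)%:R.
  move=> Fv; rewrite /nu dot_suml; case: (boolP (v \in A)) => vA /=.
    rewrite big1 // => y; rewrite inE => /andP[yA Fy]; rewrite muF //.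
    by have -> : v == y = false by apply: contraNF yA => /eqP<-.
  rewrite (bigD1 v) ?inE ?vA //= muF // eqxx big1 ?addr0 // => y /andP[].
  by rewrite inE => /andP[_ Fy] yv; rewrite muF // eq_sym (negPf yv).
have [|e e0 He] := @small_forall R V (fun v t => v \notin F ->
    dot al (p v) - 1 + t * - dot nu (p v) < 0).
  move=> v; case: (boolP (v \in F)) => Fv; first by exists 1.
  have [|e e0 He] := @small_linear R (dot al (p v) - 1) (- dot nu (p v)).
    by rewrite subr_lt0 aNF.
  by exists e => // t /He te _.
have ee : 0 < e <= e by rewrite e0 lexx.
exists (al - e *: nu); split=> v vA; rewrite dotBl dotZl.
  have Fv := subsetP AF _ vA.
  by rewrite aF // nuF // vA mulr0 subr0.
case: (boolP (v \in F)) => Fv; first by rewrite aF // nuF // vA mulr1 gtrBl.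
by have := He e ee v Fv; lra.
Qed.

Lemma independent_face F (w : V -> R) : F \in C -> #|F| = d ->
  (forall v, v \notin F -> w v = 0) -> \sum_v w v *: p v = 0 -> forall v, w v = 0.
Proof.
move=> CF Fd wF E v; case: (boolP (v \in F)) => [Fv|/wF//].
have [mu muF] := rz_dual pC CF Fd; have := dot0r (mu v); rewrite -E dot_sumr (bigD1 v) //=.
rewrite dotZr muF // eqxx mulr1 big1 ?addr0 // => u uv; rewrite dotZr.
case: (boolP (u \in F)) => [Fu|/wF->]; last by rewrite mul0r.
by rewrite muF // (negPf uv) mulr0.
Qed.

Lemma not_all_one a : ~ forall v, dot a (p v) = 1.
Proof.
move=> a1; have [[C0 _] /(_ _ C0)[F [CF _ Fd]]] := (pureP _ _).1 (rz_pure pC).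
have [v Fv] : exists v, v \in F by apply/set0Pn; rewrite -card_gt0 Fd.
have [la la0 E] := zero_comb v; have := dot0r a.
rewrite -E dotC dotDl dotC a1 dot_suml => /eqP; apply/negP; rewrite gt_eqF //.
rewrite ltr_wpDr // sumr_ge0 // => u _; by rewrite dotZl dotC a1 mulr1.
Qed.

Lemma realizes_inj : injective p.
Proof.
move=> u v puv; apply/eqP/negPn/negP => uv.
have [a [a1 aN]] := exposed_face (rz_vert pC u).
have := a1 u; rewrite inE eqxx => /(_ isT); rewrite puv => av.
by have := aN v; rewrite inE eq_sym uv av ltxx => /(_ isT).
Qed.

End FacesOfRealization.

(** * From realizations to simplicial polytopes *)

Section ToPolytope.
Import classical_sets.
Local Open Scope ring_scope.
Local Open Scope classical_set_scope.
Variable R : realType.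

Lemma realizes_rename (V W : finType) d (p : V -> 'rV[R]_d) C (h : V -> W) (g : W -> V) :
  cancel h g -> cancel g h -> realizes p C -> realizes (p \o g) (map_complex h C).
Proof.
move=> hg gh [pC vC sC dC cC]; have hI := can_inj hg.
have mE (G : {set V}) w : (w \in h @: G) = (g w \in G) by rewrite -{1}(gh w) mem_imset.
split.
- exact: map_complex_pure.
- by move=> w; rewrite -(gh w) -imset_set1 mem_map_complex.
- move=> f /imsetP[F CF ->]; rewrite card_imset // => Fd; have [al [aF aNF]] := sC F CF Fd.
  by exists al; split=> w; rewrite mE; [apply: aF|apply: aNF].
- move=> f /imsetP[F CF ->]; rewrite card_imset // => Fd; have [mu muF] := dC F CF Fd.
  by exists (mu \o g) => x w; rewrite !mE => Fx Fw; rewrite /= muF // (can_eq gh).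
- move=> x; have [F [la [CF Fd la0 laF ->]]] := cC x.
  exists (h @: F), (la \o g); split=> //.
  + by rewrite mem_map_complex.
  + by rewrite card_imset.
  + by move=> w; apply: la0.
  + by move=> w; rewrite mE; apply: laF.
  by rewrite (reindex g) //; exists h => ? _.
Qed.

Variables (n d : nat) (p : 'I_n -> 'rV[R]_d) (C : {set {set 'I_n}}).
Hypotheses (pC : realizes p C) (d_gt0 : (0 < d)%N).

Lemma conv_hull_vertex v : conv_hull p (p v).
Proof.
exists (fun i => (i == v)%:R); split=> //.
  by rewrite (bigD1 v) //= eqxx big1 ?addr0 // => i /negPf->.
by rewrite (bigD1 v) //= eqxx scale1r big1 ?addr0 // => i /negPf->; rewrite scale0r.
Qed.

Lemma conv_hull_le a b x : (forall v, dot a (p v) <= b) -> conv_hull p x -> dot a x <= b.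
Proof.
move=> le_b [w [w0 w1 ->]]; rewrite dot_sumr -[b]mul1r -w1 mulr_suml.
by apply: ler_sum => i _; rewrite dotZr ler_wpM2l.
Qed.

Lemma conv_hull_eq a b (w : 'I_n -> R) : (forall v, dot a (p v) <= b) ->
  (forall i, 0 <= w i) -> \sum_i w i = 1 -> dot a (\sum_i w i *: p i) = b ->
  forall i, w i != 0 -> dot a (p i) = b.
Proof.
move=> le_b w0 w1 E i wi.
have E0 : \sum_i w i * (b - dot a (p i)) = 0.
  under eq_bigr do rewrite mulrBr; rewrite sumrB -mulr_suml w1 mul1r -{1}E dot_sumr.
  by under eq_bigr do rewrite dotZr; rewrite subrr.
have := psumr_eq0P _ E0; move=> /(_ _ i isT) H.
have /eqP : w i * (b - dot a (p i)) = 0.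
  by apply: H => j _; rewrite mulr_ge0 // subr_ge0.
by rewrite mulf_eq0 (negPf wi) subr_eq0 => /eqP.
Qed.

Lemma proper_face_vertices G : proper_face (conv_hull p) G ->
  exists F, [/\ F \in C, #|F| = d & forall v, G (p v) -> v \in F].
Proof.
move=> [[a [b [le_b GE]]] GP].
have le_v v : dot a (p v) <= b by apply: le_b; apply: conv_hull_vertex.
have [[v0 lt_v0]|no_v] := pselect (exists v, dot a (p v) < b).
  have [F [CF Fd FA]] := face_subset_facet pC le_v lt_v0.
  by exists F; split=> // v; rewrite GE => -[_] /FA.
case: GP; rewrite GE; apply/seteqP; split=> x; first by case.
move=> Px; split=> //; case: Px => w [w0 w1 ->] /=.
rewrite dot_sumr (eq_bigr (fun i => w i * b)) => [|i _]; last first.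
  rewrite dotZr; congr (_ * _); apply/eqP; rewrite eq_le le_v /= leNgt.
  by apply/negP => lt_i; apply: no_v; exists i.
by rewrite -mulr_suml w1 mul1r.
Qed.

Lemma exposed_proper_face (A : {set 'I_n}) : A \in C ->
  exists2 G, proper_face (conv_hull p) G & [set` A] = p @^-1` G.
Proof.
move=> CA; have [a [aA aNA]] := exposed_face pC CA.
have le_v v : dot a (p v) <= 1.
  by case: (boolP (v \in A)) => [/aA->|/aNA/ltW].
exists (conv_hull p `&` [set x | dot a x = 1]).
  split; first by exists a, 1; split=> // x; apply: conv_hull_le.
  move=> E; apply: (not_all_one pC d_gt0 (a := a)) => v.
  by have := conv_hull_vertex v; rewrite -E => -[].
apply/seteqP; split=> v /=; first by move=> /aA; split=> //; apply: conv_hull_vertex.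
by case=> _ av; apply/negPn/negP => /aNA; rewrite av ltxx.
Qed.

Lemma realizes_boundary : boundary_complex p = C.
Proof.
apply/setP => A; rewrite inE; apply/asboolP/idP => [[G /proper_face_vertices[F [CF _ GF]] AE]|];
  last exact: exposed_proper_face.
have [[_ sC] _] := rz_pure pC.
apply: sC CF; apply/fintype.subsetP => v Av; apply: GF.
have : [set` A] v by [].
by rewrite AE.
Qed.

Lemma realizes_simplicial_polytope : simplicial_polytope p.
Proof.
split.
- exact: realizes_inj pC.
- apply/seteqP; split=> x /=.
    move=> [a [b [le_b xE]]].
    have le_v v : dot a (p v) <= b by apply: le_b; apply: conv_hull_vertex.
    have : [set x] x by []. rewrite xE => -[Px /= ax]; case: Px => w [w0 w1 xw].
    have [i wi] : exists i, w i != 0.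
      apply/not_existsP => H; have : (1 : R) = 0.
        by rewrite -w1 big1 // => i _; apply/eqP/negPn/negP/H.
      by apply/eqP; rewrite oner_eq0.
    have axw : dot a (\sum_i w i *: p i) = b by rewrite -xw.
    exists i => //; have : (conv_hull p `&` [set x | dot a x = b]) (p i).
      by split; [apply: conv_hull_vertex|apply: (conv_hull_eq le_v w0 w1 axw)].
    by rewrite -xE.
  move=> [v _ <-]; have [a [aA aNA]] := exposed_face pC (rz_vert pC v).
  have av : dot a (p v) = 1 by apply: aA; rewrite inE.
  have le_v u : dot a (p u) <= 1.
    by case: (boolP (u \in [set v]%SET)) => [/aA->|/aNA/ltW].
  exists a, 1; split=> [y|]; first exact: conv_hull_le.
  apply/seteqP; split=> y /=; first by move=> ->; split=> //; apply: conv_hull_vertex.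
  case=> -[w [w0 w1 ->]] ax.
  have wN i : i != v -> w i = 0.
    move=> iv; apply/eqP/negPn/negP => /(conv_hull_eq le_v w0 w1 ax) ai.
    by have := aNA i; rewrite inE iv ai ltxx => /(_ isT).
  have wv : w v = 1 by rewrite -w1 (bigD1 v) //= big1 ?addr0 // => i /wN.
  by rewrite (bigD1 v) //= wv scale1r big1 ?addr0 // => i /wN->; rewrite scale0r.
- apply/seteqP; split=> x // _.
  have [[C0 _] /(_ _ C0)[F [CF _ Fd]]] := (pureP _ _).1 (rz_pure pC).
  have [v0 _] : exists v, v \in F by apply/set0Pn; rewrite -card_gt0 Fd.
  have [la la0 E0] := zero_comb pC v0.
  have [_ [mu [_ _ _ _ xE]]] := rz_cover pC x.
  pose s := 1 + \sum_u la u; have s0 : 0 < s by rewrite ltr_wpDr ?sumr_ge0.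
  (* The weights [c] have sum 1 and represent the origin; a multiple of them corrects the sum of the
     weights of any point without moving it. *)
  pose c u := ((u == v0)%:R + la u) / s.
  have c1 : \sum_u c u = 1.
    rewrite -mulr_suml big_split /= (bigD1 v0) //= eqxx big1 ?addr0 => [|u /negPf->] //.
    by rewrite -/s divff // gt_eqF.
  have c0 : \sum_u c u *: p u = 0.
    under eq_bigr do rewrite /c mulrC -scalerA scalerDl.
    rewrite -scaler_sumr big_split /= (bigD1 v0) //= eqxx scale1r [X in _ + X + _]big1 ?addr0.
      by rewrite E0 scaler0.
    by move=> u /negPf->; rewrite scale0r.
  exists (fun u => mu u + (1 - \sum_v mu v) * c u); split.
    by rewrite big_split /= -mulr_sumr c1 mulr1 addrC subrK.
  under eq_bigr do rewrite scalerDl -scalerA.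
  by rewrite big_split /= -scaler_sumr c0 scaler0 addr0.
- move=> G /proper_face_vertices[F [CF Fd GF]] w wN _ E i.
  apply: (independent_face pC CF Fd) E i => v vF; apply: wN => /= Gv.
  by rewrite GF in vF.
Qed.

End ToPolytope.

(** * The polytopes *)

Section Corridors.
Variable R : realType.

(** The invariant of the construction. [cr_vdA] and [cr_vdB] are what suspending at a vertex stacked
    over [A] or [B] requires. *)
Record corridor d (V : finType) (C : {set {set V}}) (A B : {set V}) : Prop := Corridor {
  cr_real : exists p : V -> 'rV[R]_d, realizes p C;
  cr_vd : vertex_decomposable C;
  cr_vdA : vertex_decomposable (C :\ A);
  cr_vdB : vertex_decomposable (C :\ B);
  cr_A : A \in C;
  cr_B : B \in C;
  cr_Ad : #|A| = d;
  cr_Bd : #|B| = d;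
  cr_AB : A != B
}.

Lemma corridor_sym d V C A B : @corridor d V C A B -> corridor d C B A.
Proof. by case=> *; split=> //; rewrite eq_sym. Qed.

Lemma corridor_pure d V C A B : @corridor d V C A B -> pure_complex d C.
Proof. by case=> -[p []]. Qed.

(** Vertex decomposability gives purity in some dimension, and the remaining facet [B] tells
    which. *)
Lemma pure_setD1 d (V : finType) (C : {set {set V}}) A B :
  pure_complex d C -> vertex_decomposable (C :\ A) -> B \in C -> #|B| = d -> A != B ->
  pure_complex d (C :\ A).
Proof.
move=> pC /vd_pure[j pj] CB Bd AB; suff <- : j = d by [].
apply/eqP; rewrite eqn_leq; apply/andP; split.
  have [[C0 _] /(_ _ C0)[F [CF _ <-]]] := (pureP _ _).1 pj.
  by apply: (pure_le pC); move: CF; rewrite in_setD1 => /andP[].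
by rewrite -Bd; apply: (pure_le pj); rewrite in_setD1 eq_sym AB.
Qed.

Lemma stack_corridor d V C A B x : 1 < d -> @corridor d V C A B -> x \in A ->
  corridor d (stack (map_complex Some C) (Some @: A) None)
             (None |: Some @: (A :\ x)) (Some @: B).
Proof.
move=> d1 cr Ax; have pC := corridor_pure cr; have si := @some_inj V.
have pCA := pure_setD1 pC (cr_vdA cr) (cr_B cr) (cr_Bd cr) (cr_AB cr).
have BA : B != A by rewrite eq_sym (cr_AB cr).
have pCB := pure_setD1 pC (cr_vdB cr) (cr_A cr) (cr_Ad cr) BA.
have d0 := ltnW d1; have fr := @fresh_None V.
have N0 (G : {set V}) : None \notin (Some @: G : {set option V}) by apply/imsetP => -[].
have imE (G H : {set V}) : (Some @: G == Some @: H :> {set option V}) = (G == H).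
  by rewrite (inj_eq (imset_inj si)).
have A'E : None |: Some @: (A :\ x) = None |: (Some @: A) :\ Some x.
  congr (_ |: _); apply/setP => -[v|]; rewrite !inE /=.
    by rewrite !mem_imset // !inE (inj_eq si).
  by rewrite !(negPf (N0 _)).
have pm := map_complex_pure si pC.
have mA : Some @: A \in map_complex Some C by rewrite mem_map_complex // (cr_A cr).
have mAd : #|(Some @: A : {set option V})| = d by rewrite card_imset // (cr_Ad cr).
have CA := cr_A cr.
split.
- have [p rp] := cr_real cr.
  by have [z rz] := realizes_stack d1 rp CA (cr_Ad cr); exists (extend_point p z).
- by apply: (vd_stack (vd_map_complex si (cr_vd cr)) pm).
- rewrite A'E; apply: (@vd_stack_setD1 _ d) => //; rewrite -?map_complex_setD1 //.
  + exact: map_complex_pure.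
  + exact: vd_map_complex (cr_vdA cr).
  + by rewrite mem_imset.
- rewrite stack_setD1 // ?imE // -map_complex_setD1 //.
  apply: (@vd_stack _ d) => //.
  + exact: vd_map_complex (cr_vdB cr).
  + exact: map_complex_pure.
  + by rewrite mem_map_complex // in_setD1 (cr_AB cr).
- by rewrite inE setU11 setU1K // properEcard imsetS ?subD1set //= !card_imset //
    [ltnRHS](cardsD1 x) Ax.
- by rewrite inE (negPf (N0 B)) mem_map_complex // (cr_B cr) imE.
- by rewrite cardsU1 N0 card_imset // -(cr_Ad cr) (cardsD1 x A) Ax.
- by rewrite card_imset // (cr_Bd cr).
- by apply: contraNneq (N0 B) => <-; rewrite !inE eqxx.
Qed.

Lemma suspension_corridor d (V : finType) (p : V -> 'rV[R]_d) (K : {set {set V}}) w A : 0 < d ->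
  realizes p K -> vertex_decomposable K -> pure_complex d (K :\ A) ->
  vertex_decomposable (K :\ A) -> pure_complex d (deletion K w) ->
  vertex_decomposable (deletion K w) -> A \in K -> #|A| = d -> w \notin A ->
  corridor d.+1 (suspension (map_complex Some K) (Some w) None)
           (Some w |: Some @: A) (None |: Some @: A).
Proof.
move=> d0 rp vK pKA vKA pd vd KA Ad wA; have pK := rz_pure rp; have si := @some_inj V.
have fr := @fresh_None V K.
have N0 (G : {set V}) : None \notin (Some @: G : {set option V}) by apply/imsetP => -[].
have wA' : Some w \notin (Some @: A : {set option V}) by rewrite mem_imset.
have pm := map_complex_pure si pK.
have wm : Some w \in vertices (map_complex Some K).
  by rewrite inE -imset_set1 mem_map_complex // (rz_vert rp).
have pmd : pure_complex d (deletion (map_complex Some K) (Some w)).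
  by rewrite deletion_map_complex //; apply: map_complex_pure.
have vmd : vertex_decomposable (deletion (map_complex Some K) (Some w)).
  by rewrite deletion_map_complex //; apply: vd_map_complex.
have mA : Some @: A \in map_complex Some K by rewrite mem_map_complex.
have mAd : #|(Some @: A : {set option V})| = d by rewrite card_imset.
have pmA : pure_complex d (map_complex Some K :\ (Some @: A)).
  by rewrite -map_complex_setD1 //; apply: map_complex_pure.
have vmA : vertex_decomposable (map_complex Some K :\ (Some @: A)).
  by rewrite -map_complex_setD1 //; apply: vd_map_complex.
split.
- by exists (suspension_point p w); apply: realizes_suspension.
- by apply: (vd_suspension pm) => //; apply: vd_map_complex.
- exact: (vd_suspension_setD1w pm).
- exact: (vd_suspension_setD1 pm).
- by rewrite mem_suspension_Nb ?setU1K // in_setU1 negb_or N0.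
- by rewrite (mem_suspension_b pm).
- by rewrite cardsU1 wA' mAd.
- by rewrite cardsU1 N0 mAd.
- by apply/eqP => /setP/(_ None); rewrite !inE (negPf (N0 A)).
Qed.

(* [X], part of the facet [A], is replaced by as many new vertices, by successive
   stackings over the current facet. *)
Record layer d (V W : finType) (C : {set {set V}}) (A B X : {set V})
    (C' : {set {set W}}) (A' : {set W}) (iota : V -> W) : Prop := Layer {
  ly_inj : injective iota;
  ly_cr : corridor d C' A' (iota @: B);
  ly_A : A' = iota @: (A :\: X) :|: ~: (iota @: setT);
  ly_card : #|W| = #|V| + #|X|;
  ly_up : forall f, f \in C' -> (exists2 g, g \in C & f = iota @: g) \/
                                f \subset iota @: A :|: ~: (iota @: setT);
  ly_low : forall g, g \in C -> g != A -> iota @: g \in C'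
}.

Lemma layer_new d V W C A B X C' A' iota : @layer d V W C A B X C' A' iota ->
  #|~: (iota @: setT)| = #|X|.
Proof.
move=> ly; have := cardsC (iota @: setT).
by rewrite card_imset ?cardsT ?(ly_card ly) //; [move/addnI|exact: ly_inj ly].
Qed.

Lemma layer_ex d (V : finType) C A B (X : {set V}) : 1 < d -> @corridor d V C A B -> X \subset A ->
  exists (W : finType) (C' : {set {set W}}) (A' : {set W}) (iota : V -> W),
    layer d C A B X C' A' iota.
Proof.
move=> d1 cr; move: {2}#|X| (erefl #|X|) => m; elim: m X => [|m IHm] X Xm XA.
  move/cards0_eq: Xm => ->; exists V, C, A, id.
  have T0 : ~: (@id V @: setT) = set0 by rewrite imset_id setCT.
  split=> //; rewrite ?T0 ?imset_id ?setD0 ?setU0 ?cards0 ?addn0 //.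
    by move=> f Cf; left; exists f; rewrite ?imset_id.
  by move=> g; rewrite imset_id.
have [x Xx] : exists x, x \in X by apply/set0Pn; rewrite -card_gt0 Xm.
have Xm' : #|X :\ x| = m by move: Xm; rewrite (cardsD1 x) Xx add1n => -[].
have [W [C' [A' [iota ly]]]] := IHm _ Xm' (subset_trans (subD1set _ _) XA).
have Ax := subsetP XA _ Xx; have iI := ly_inj ly; have si := @some_inj W.
have A'x : iota x \in A' by rewrite (ly_A ly) inE mem_imset // !inE eqxx Ax.
have imT (g : {set V}) (w : W) : w \in iota @: g -> w \in iota @: setT.
  by apply/subsetP: w; apply: imsetS; apply: subsetT.
have NT : None \notin [set Some (iota v) | v in [set: V]] by apply/imsetP => -[].
have ST (w : W) : (Some w \in [set Some (iota v) | v in [set: V]]) = (w \in iota @: setT).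
  by rewrite (imset_comp Some iota) mem_imset.
exists (option W), (stack (map_complex Some C') (Some @: A') None),
  (None |: Some @: (A' :\ iota x)), (Some \o iota); split.
- exact: inj_comp.
- by rewrite (imset_comp Some iota); exact: stack_corridor d1 (ly_cr ly) A'x.
- apply/setP => -[w|]; rewrite !inE /= ?NT ?orbT // ST mem_imset // !inE (imset_comp Some iota) mem_imset //.
  rewrite (ly_A ly) !inE; have [->|wx] := eqVneq w (iota x).
    by rewrite /= mem_imset // !inE Xx /= mem_imset ?inE.
  rewrite /=; congr (_ || _); apply/imsetP/imsetP => -[v vA wv]; exists v => //.
    move: vA; rewrite !inE => /andP[]; rewrite negb_and negbK => /orP[/eqP vx|->->//].
    by rewrite wv vx eqxx in wx.
  by move: vA; rewrite !inE negb_and => /andP[->->]; rewrite orbT.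
- by rewrite card_option (ly_card ly) Xm' Xm addnS.
- move=> f; rewrite inE; case: ifP => Nf => [|/andP[/imsetP[g C'g ->] _]].
    move=> /proper_sub fA; right; apply/subsetP => -[w|] fw; rewrite !inE ?NT ?orbT //.
    have : Some w \in Some @: A' by apply: (subsetP fA); rewrite !inE.
    rewrite mem_imset // ST (imset_comp Some iota) mem_imset // (ly_A ly) !inE.
    case/orP => [wA|->]; last by rewrite orbT.
    by rewrite (subsetP (imsetS _ (subsetDl _ _)) _ wA).
  case: (ly_up ly C'g) => [[g0 Cg0 ->]|gA]; [left|right].
    by exists g0; rewrite // (imset_comp Some iota).
  apply/subsetP => _ /imsetP[w gw ->]; rewrite inE inE ST (imset_comp Some iota) mem_imset //.
  by have := subsetP gA w gw; rewrite !inE.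
- move=> g Cg gA; rewrite (imset_comp Some iota) inE.
  have -> : (None \in [set Some w | w in iota @: g]) = false by apply/negbTE/imsetP => -[].
  rewrite mem_map_complex // (ly_low ly) //= (inj_eq (imset_inj si)).
  apply: contraNneq gA => gA'.
  (* The facet stacked over contains all vertices added so far. It can be the image of an old face
     only when none has been added, and then that face is [A]. *)
  have L0 : ~: (iota @: setT) = set0.
    apply/setP => w; rewrite !inE; apply/negbTE; rewrite negbK.
    case: (boolP (w \in iota @: setT)) => // wT.
    have : w \in A' by rewrite (ly_A ly) !inE wT orbT.
    by rewrite -gA' => /imT; rewrite (negPf wT).
  have := layer_new ly; rewrite L0 cards0 => /esym/cards0_eq X0.
  by move: gA'; rewrite (ly_A ly) L0 setU0 X0 setD0 => /(imset_inj iI)->.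
Qed.

End Corridors.

(** * Doubling: a suspension with two layers at each end *)

Section Doubling.
Variable R : realType.

(* Two successive layers over the facet [c |: A], both keeping the vertex [c]. *)
Record double_layer d (V W : finType) (C : {set {set V}}) (c : V) (A B : {set V})
    (C' : {set {set W}}) (L1 L2 : {set W}) (iota : V -> W) : Prop := DoubleLayer {
  dl_inj : injective iota;
  dl_cr : corridor R d C' (iota c |: L2) (iota @: B);
  dl_L1 : forall v, iota v \notin L1;
  dl_L2 : forall v, iota v \notin L2;
  dl_dis : forall w, w \in L1 -> w \notin L2;
  dl_cover : forall w, [\/ w \in L1, w \in L2 | exists v, w = iota v];
  dl_card1 : #|L1| = #|A|;
  dl_card2 : #|L2| = #|A|;
  dl_up : forall f, f \in C' ->
    [\/ exists2 g, g \in C & f = iota @: g, f \subset iota c |: iota @: A :|: L1 |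
        f \subset iota c |: L1 :|: L2];
  dl_low : forall g, g \in C -> g != c |: A -> iota @: g \in C'
}.

Lemma double_layer_card d V W C c A B C' L1 L2 iota :
  @double_layer d V W C c A B C' L1 L2 iota -> #|W| = #|V| + 2 * #|A|.
Proof.
move=> dl; have -> : #|W| = #|iota @: setT :|: (L1 :|: L2)|.
  rewrite -cardsT; congr #|(_ : {set W})|; apply/esym/setP => w; rewrite !inE.
  case: (dl_cover dl w) => [->|->|[v ->]]; rewrite ?orbT //.
  by rewrite mem_imset ?inE //; apply: dl_inj dl.
rewrite cardsU [X in _ - X](_ : _ = 0) ?subn0.
  rewrite card_imset ?cardsT; last exact: dl_inj dl.
  rewrite cardsU [X in _ - X](_ : _ = 0) ?subn0 ?(dl_card1 dl) ?(dl_card2 dl) //.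
    by rewrite mul2n -addnn.
  apply/eqP; rewrite cards_eq0; apply/eqP/setP => w; rewrite !inE; apply/negbTE.
  by rewrite negb_and; case: (boolP (w \in L1)) => // /(dl_dis dl)->.
apply/eqP; rewrite cards_eq0; apply/eqP/setP => w; rewrite !inE; apply/negbTE/negP.
by case/andP => /imsetP[v _ ->]; rewrite (negPf (dl_L1 dl v)) (negPf (dl_L2 dl v)).
Qed.

Lemma setU1DK (T : finType) x (A : {set T}) : x \notin A -> (x |: A) :\: A = [set x].
Proof. by move=> xA; rewrite setDUl setDv setU0; apply/setDidPl; rewrite disjoints1. Qed.

Lemma double_layer_ex d (V : finType) (C : {set {set V}}) c (A B : {set V}) : 1 < d -> c \notin A ->
  0 < #|A| -> corridor R d C (c |: A) B ->
  exists (W : finType) (C' : {set {set W}}) (L1 L2 : {set W}) (iota : V -> W),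
    double_layer d C c A B C' L1 L2 iota.
Proof.
move=> d1 cA A0 cr.
have [V1 [C1 [A1 [i1 ly1]]]] := layer_ex d1 cr (subsetUr [set c] A).
pose M1 := ~: (i1 @: setT); have A1E : A1 = i1 c |: M1.
  by rewrite (ly_A ly1) setU1DK // imset_set1.
have M1A1 : M1 \subset A1 by rewrite A1E subsetUr.
have [W [C2 [A2 [i2 ly2]]]] := layer_ex d1 (ly_cr ly1) M1A1.
have I1 := ly_inj ly1; have I2 := ly_inj ly2.
pose M2 := ~: (i2 @: setT).
have cM1 : i1 c \notin M1 by rewrite !inE negbK imset_f.
have A2E : A2 = i2 (i1 c) |: M2.
  by rewrite (ly_A ly2) A1E setU1DK // imset_set1.
have m2 w : i2 w \notin M2 by rewrite inE negbK imset_f.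
have m1 v : i1 v \notin M1 by rewrite inE negbK imset_f.
exists W, C2, (i2 @: M1), M2, (i2 \o i1); split.
- exact: inj_comp.
- by rewrite imset_comp -A2E; apply: ly_cr ly2.
- by move=> v; rewrite /= mem_imset.
- by move=> v; apply: m2.
- by move=> _ /imsetP[w _ ->].
- move=> w; case: (boolP (w \in M2)) => [|]; first by constructor 2.
  rewrite inE negbK => /imsetP[u _ ->]; case: (boolP (u \in M1)) => [uM|].
    by constructor 1; apply: imset_f.
  by rewrite inE negbK => /imsetP[v _ ->]; constructor 3; exists v.
- by rewrite card_imset // (layer_new ly1).
- by rewrite (layer_new ly2) (layer_new ly1).
- move=> f /(ly_up ly2)[[g C1g ->]|]; last first.
    by rewrite A1E imsetU1 /= => fs; constructor 3.
  case: (ly_up ly1 C1g) => [[g0 Cg0 ->]|gs]; [constructor 1|constructor 2].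
    by exists g0; rewrite // imset_comp.
  apply: subset_trans (imsetS i2 gs) _.
  by rewrite imsetU imsetU1 imsetU1 /= -imset_comp.
- move=> g Cg gA; rewrite imset_comp; apply: (ly_low ly2); first exact: ly_low ly1 _ Cg gA.
  have [w wM] : exists w, w \in M1.
    by apply/set0Pn; rewrite -card_gt0 (layer_new ly1).
  apply: contraTneq wM => gE; have: w \in A1 -> w \notin M1; last first.
    by rewrite A1E; move=> H; apply/negP => wM; have := H (setU1r _ wM); rewrite wM.
  by rewrite -gE => /imsetP[v _ ->].
Qed.

(** The suspended vertex was stacked over [B], so both of its copies occur together only over faces
    of [B]; a face with at most one of them comes from a face of [C], or again lies over [B]. *)
Lemma suspension_face_cases (V : finType) (C : {set {set V}}) (B : {set V})
    (f : {set option (option V)}) :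
  let i v := Some (Some v) in let a := Some None in
  f \in suspension (map_complex Some (stack (map_complex Some C) (Some @: B) None)) a None ->
  f \subset [set a; None] :|: i @: B \/
  exists2 g, g \in C & [\/ f = i @: g, f = a |: i @: g | f = None |: i @: g].
Proof.
move=> i a; rewrite inE.
have ab : a != None by [].
have iE (g : {set V}) : i @: g = Some @: (Some @: g) by rewrite -imset_comp.
case/andP => f1; case: (boolP (None \in f)) => Nf /=; case: (boolP (a \in f)) => af /=.
- case/imsetP => k; rewrite inE => + fE; have -> : None \in k.
    by rewrite -(mem_imset k None (@some_inj _)) -fE !inE af.
  move/proper_sub => kB.
  left; apply/subsetP => -[[v|]|] fx; rewrite !inE ?eqxx ?orbT //=.
  rewrite iE (mem_imset _ _ (@some_inj _)); apply: (subsetP kB); rewrite !inE.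
  by rewrite -(mem_imset k _ (@some_inj _)) -fE !inE fx.
all: move=> _; right; case/imsetP: f1 => k; rewrite inE => + fE.
all: have /negPf-> : None \notin k by rewrite -(mem_imset k None (@some_inj _)) -fE !inE eqxx.
all: case/andP => /imsetP[g Cg kE] _; exists g; rewrite // iE -kE -fE.
- constructor 3; apply/setP => x; rewrite !inE; case: (eqVneq x None) => [->//|_].
  by case: (eqVneq x a) => [->|//]; rewrite (negPf af).
- constructor 2; apply/setP => x; rewrite !inE; case: (eqVneq x a) => [->//|_].
  by case: (eqVneq x None) => [->|//]; rewrite (negPf Nf).
- constructor 1; apply/setP => x; rewrite !inE; case: (eqVneq x a) => [->|_].
    by rewrite (negPf af).
  by case: (eqVneq x None) => [->|//]; rewrite (negPf Nf).
Qed.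

(** Vertex count: one vertex stacked over [B], one more from suspending at it, and two layers of [d]
    vertices at each of the two ends. *)
Lemma doubling_ex d (V : finType) (C : {set {set V}}) (A B : {set V}) : 1 < d -> corridor R d C A B ->
  exists (W : finType) (C' : {set {set W}}) (A' B' : {set W}),
    [/\ corridor R d.+1 C' A' B', #|W| = #|V| + 2 + 4 * d &
        exists (iota : V -> W) kappa a b, doubling C A B C' A' B' iota kappa a b].
Proof.
move=> d1 cr; have d0 := ltnW d1; have si T := @some_inj T.
have sV := si V; have sO := si (option V).
have [B0 [y By]] : 0 < #|B| /\ exists y, y \in B.
  by rewrite (cr_Bd cr) d0; split=> //; apply/set0Pn; rewrite -card_gt0 (cr_Bd cr).
set K := stack (map_complex Some C) (Some @: B) None.
have crB := stack_corridor d1 (corridor_sym cr) By; rewrite -/K in crB.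
have [p rp] := cr_real crB.
pose i (v : V) := Some (Some v); pose a0 : option (option V) := Some None.
pose D := suspension (map_complex Some K) a0 None.
have iE (g : {set V}) : i @: g = Some @: (Some @: g : {set option V}) by rewrite -imset_comp.
have iI : injective i by move=> ? ? [].
have frC := @fresh_None V C; have pC := corridor_pure cr.
have NA : None \notin (Some @: A : {set option V}) by apply/imsetP => -[].
have pCB := pure_setD1 pC (cr_vdB cr) (cr_A cr) (cr_Ad cr).
have crD : corridor R d.+1 D (a0 |: i @: A) (None |: i @: A).
  rewrite iE; apply: (suspension_corridor d0 rp) => //.
  - exact: cr_vd crB.
  - apply: pure_setD1 (rz_pure rp) (cr_vdB crB) (cr_A crB) (cr_Ad crB) _.
    by rewrite eq_sym (cr_AB crB).
  - exact: cr_vdB crB.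
  - rewrite deletion_stack_new // -map_complex_setD1 //; apply: map_complex_pure => //.
    by apply: pCB; rewrite eq_sym (cr_AB cr).
  - rewrite deletion_stack_new // -map_complex_setD1 //; apply: vd_map_complex => //.
    exact: cr_vdB cr.
  - exact: cr_B crB.
  - exact: cr_Bd crB.
have ia v (g : {set V}) : (i v \in i @: g) = (v \in g) by rewrite mem_imset.
have aI (g : {set V}) : a0 \notin i @: g by apply/imsetP => -[].
have bI (g : {set V}) : None \notin i @: g by apply/imsetP => -[].
have iAd : #|i @: A| = d by rewrite card_imset // (cr_Ad cr).
have iA0 : 0 < #|i @: A| by rewrite iAd.
have [V1 [C1 [La1 [La2 [j dla]]]]] := double_layer_ex (leqW d1) (aI A) iA0 crD.
have jI := dl_inj dla; have crb := corridor_sym (dl_cr dla).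
have jbE : j @: (None |: i @: A) = j None |: j @: (i @: A) by rewrite imsetU1.
rewrite jbE in crb.
have jbI : j None \notin j @: (i @: A) by rewrite mem_imset // bI.
have jA0 : 0 < #|j @: (i @: A)| by rewrite card_imset.
have [W [C' [Lb1 [Lb2 [h dlb]]]]] := double_layer_ex (leqW d1) jbI jA0 crb.
have hI := dl_inj dlb.
pose a := h (j a0); pose b := h (j None); pose iota v := h (j (i v)).
have hjI : injective (h \o j) by apply: inj_comp.
have Eq x y' : (h (j x) == h (j y')) = (x == y') by rewrite (inj_eq hI) (inj_eq jI).
pose kappa w := if w == a then 3 else if w == b then 5 else if w \in h @: La1 then 2
  else if w \in h @: La2 then 1 else if w \in Lb1 then 6 else if w \in Lb2 then 7 else 4.
have kh x : kappa (h (j x)) = if x == a0 then 3 else if x == None then 5 else 4.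
  rewrite /kappa /a /b !Eq !mem_imset // (negPf (dl_L1 dla x)) (negPf (dl_L2 dla x)).
  by rewrite (negPf (dl_L1 dlb _)) (negPf (dl_L2 dlb _)).
have kLa1 w : w \in La1 -> kappa (h w) = 2.
  move=> Lw; rewrite /kappa /a /b !(inj_eq hI) mem_imset // Lw.
  by rewrite !ifN //; apply: contraTneq Lw => ->; apply: dl_L1 dla _.
have kLa2 w : w \in La2 -> kappa (h w) = 1.
  move=> Lw; rewrite /kappa /a /b !(inj_eq hI) !mem_imset // Lw.
  rewrite !ifN //; try by apply: contraTneq Lw => ->; apply: dl_L2 dla _.
  by apply: contraL Lw => /(dl_dis dla).
have nLb1 w x : w \in Lb1 -> w != h x by move=> Lw; apply: contraTneq Lw => ->; apply: dl_L1 dlb _.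
have nLb2 w x : w \in Lb2 -> w != h x by move=> Lw; apply: contraTneq Lw => ->; apply: dl_L2 dlb _.
have nI w (L : {set V1}) : (forall x, w != h x) -> w \in h @: L = false.
  by move=> nw; apply/negbTE/imsetP => -[x _ wx]; have := nw x; rewrite wx eqxx.
have kLb1 w : w \in Lb1 -> kappa w = 6.
  move=> Lw; have nw x := nLb1 w x Lw.
  by rewrite /kappa /a /b !(negPf (nw _)) !nI // Lw.
have kLb2 w : w \in Lb2 -> kappa w = 7.
  move=> Lw; have nw x := nLb2 w x Lw.
  rewrite /kappa /a /b !(negPf (nw _)) !nI // Lw ifN //.
  by apply: contraL Lw => /(dl_dis dlb).
have cases w : [\/ exists x, w = h (j x), exists2 x, x \in La1 & w = h x,
                   exists2 x, x \in La2 & w = h x | w \in Lb1 \/ w \in Lb2].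
  case: (dl_cover dlb w) => [||[x ->]]; try by constructor 4; tauto.
  case: (dl_cover dla x) => [Lx|Lx|[z ->]]; [constructor 2|constructor 3|constructor 1].
  - by exists x.
  - by exists x.
  - by exists z.
have iotaE (g : {set V}) : h @: (j @: (i @: g)) = iota @: g.
  by rewrite -!imset_comp.
have K1 : [set w | kappa w == 1] = h @: La2.
  apply/setP => w; rewrite inE; apply/eqP/imsetP => [kw|[x Lx ->]]; last exact: kLa2.
  case: (cases w) => [[x wE]|[x Lx wE]|[x Lx ->]|[/kLb1|/kLb2]]; rewrite ?kw //.
  - by move: kw; rewrite wE kh; case: ifP => // _; case: ifP.
  - by move: kw; rewrite wE kLa1.
  - by exists x.
have K7 : [set w | kappa w == 7] = Lb2.
  apply/setP => w; rewrite inE; apply/eqP/idP => [kw|/kLb2//].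
  case: (cases w) => [[x wE]|[x Lx wE]|[x Lx wE]|[/kLb1|//]]; rewrite ?kw //.
  - by move: kw; rewrite wE kh; case: ifP => // _; case: ifP.
  - by move: kw; rewrite wE kLa1.
  - by move: kw; rewrite wE kLa2.
have crC' := corridor_sym (dl_cr dlb).
rewrite imsetU1 -/a -/b in crC'.
have DaN (g : {set V}) : g \in C -> g != B -> Some @: g \in K.
  move=> Cg gB; rewrite inE mem_map_complex // Cg (inj_eq (imset_inj (si V))) gB.
  by have /negPf-> : None \notin (Some @: g : {set option V}) by apply/imsetP => -[].
have push g : g \in D -> g != a0 |: i @: A -> g != None |: i @: A -> h @: (j @: g) \in C'.
  move=> Dg gA gB; apply: (dl_low dlb); first exact: dl_low dla _ Dg gA.
  by rewrite -jbE (inj_eq (imset_inj jI)).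
exists W, C', (a |: h @: La2), (b |: Lb2); split=> //.
  rewrite (double_layer_card dlb) (double_layer_card dla) !card_option (card_imset _ jI) iAd; lia.
exists iota, kappa, a, b; split.
- by move=> u v E; apply: iI; apply: jI; apply: hI.
- by move=> w; rewrite /kappa; case: (w == a) => //; case: (w == b) => //; do ?case: (_ \in _).
- by move=> u; rewrite /iota kh.
- move=> w; rewrite /kappa; by case: (w == a) => //; case: (w == b) => //; do ?case: (_ \in _).
- move=> w; rewrite /kappa; case: (eqVneq w a) => [->|_]; first by rewrite /a /b Eq.
  by case: (w == b) => //; do ?case: (_ \in _).
- by rewrite K1.
- by rewrite K7.
- by rewrite K1 card_imset // (dl_card2 dla) iAd.
- by rewrite K7 (dl_card2 dlb) (card_imset _ jI) iAd.
- by case: (corridor_pure crC').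
- exact: cr_A crC'.
- exact: cr_B crC'.
- have -> : [set a; b] = h @: (j @: [set a0; None]) by rewrite !imsetU1 !imset_set1.
  apply: push.
  + rewrite inE; have -> : [set a0; None] :\ None = [set a0] :> {set option (option V)}.
      by apply/setP => -[[v|]|]; rewrite !inE.
    have K0 : set0 \in K by case: (corridor_pure crB) => -[].
    have Ka : [set None] \in K.
      by rewrite inE inE eqxx setDv proper0 -card_gt0 card_imset.
    have -> : [set a0] \in map_complex Some K by rewrite -imset_set1 mem_map_complex.
    by rewrite implybT setDv -(imset0 Some) mem_map_complex // K0.
  + by apply/eqP => /setP/(_ None); rewrite !inE (negPf (bI A)).
  + by apply/eqP => /setP/(_ a0); rewrite !inE (negPf (aI A)).
- move=> f C'f Kk; have kbh : kappa b = 5 by rewrite kh.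
  have kah : kappa a = 3 by rewrite kh.
  case: (dl_up dlb C'f) => [[g C1g fE]|/subsetP fs|/subsetP fs].
  + case: (dl_up dla C1g) => [[g0 Dg0 gE]|/subsetP gs|/subsetP gs].
    * rewrite {}gE in fE; rewrite fE; do 4!right.
      have [gs|[g1 Cg1 g1E]] := suspension_face_cases Dg0; [left|right].
        apply: subset_trans (imsetS h (imsetS j gs)) _.
        by rewrite !imsetU !imset_set1 iotaE.
      exists g1 => //; case: g1E => ->; [constructor 1|constructor 2|constructor 3].
      - by rewrite iotaE.
      - by rewrite !imsetU1 iotaE.
      - by rewrite !imsetU1 iotaE.
    * right; left; apply/subsetP => w; rewrite fE => /imsetP[x /gs + ->].
      rewrite !inE => /orP[/predU1P[->|xA]|/kLa1->//]; first by rewrite -/a kah.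
      by rewrite -iotaE (mem_imset _ _ hI) xA orbT.
    * left; apply/subsetP => w; rewrite fE => /imsetP[x /gs + ->].
      by rewrite !inE => /orP[/predU1P[->|/kLa1->//]|/kLa2->//]; rewrite -/a kah.
  + do 3!right; left; apply/subsetP => w /fs; rewrite !inE.
    case/orP => [/predU1P[->|wA]|/kLb1->//]; first by rewrite -/b kbh.
    by rewrite -iotaE wA orbT.
  + do 2!right; left; apply/subsetP => w /fs; rewrite !inE.
    by case/orP => [/predU1P[->|/kLb1->//]|/kLb2->//]; rewrite -/b kbh.
- move=> g Cg gA gB; have iag : iota @: g = h @: (j @: (i @: g)) by rewrite iotaE.
  have Kg := DaN g Cg gB.
  have igD1 x : x \notin i @: g -> (x |: i @: g) :\ x = i @: g by apply: setU1K.
  have ig0 x : x \notin i @: g -> i @: g :\ x = i @: g.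
    by move=> xg; apply/setDidPl; rewrite disjoint_sym disjoints1.
  have abn : a0 != None by [].
  have iga : (i @: g == i @: A) = (g == A) by rewrite (inj_eq (imset_inj iI)).
  have -> : a |: iota @: g = h @: (j @: (a0 |: i @: g)) by rewrite iag !imsetU1.
  have -> : b |: iota @: g = h @: (j @: (None |: i @: g)) by rewrite iag !imsetU1.
  split; apply: push.
  + rewrite inE (_ : (a0 |: i @: g) :\ None = a0 |: i @: g); last first.
      by apply/setDidPl; rewrite disjoint_sym disjoints1 in_setU1 negb_or bI.
    have -> : (None \in a0 |: i @: g) = false by rewrite in_setU1 (negPf (bI g)).
    by rewrite andbT igD1 // iE mem_map_complex.
  + apply: contraNneq gA => E; rewrite -iga -(setU1K (aI g)) E setU1K //.
  + by apply/eqP => /setP/(_ None); rewrite !inE (negPf (bI g)).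
  + have aN : (a0 \in None |: i @: g) = false by rewrite in_setU1 (negPf (aI g)).
    by rewrite inE igD1 // ig0 // aN andbF andbT iE mem_map_complex.
  + by apply/eqP => /setP/(_ a0); rewrite !inE (negPf (aI g)).
  + apply: contraNneq gA => E; rewrite -iga -(setU1K (bI g)) E setU1K //.
Qed.

End Doubling.

(** * Polygons, the induction on the dimension, and the theorem *)

Lemma far_height (U : finType) (M : {set {set U}}) (A B : {set U}) (h : U -> nat) H :
  (forall f u v, f \in M -> u \in f -> v \in f -> h u <= (h v).+1) ->
  (forall u, u \in A -> h u = 0) -> (forall u, u \in B -> h u = H) -> far 2 H M A B.
Proof.
move=> hM hA hB V phi Y ZA ZB S F Fs [inj dis fresh up _] _ _ pF [x Fx xZ] [y [_ ly yZ]].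
pose k v := if v \in ZA then 0 else if v \in ZB then H
            else if [pick x | phi x == v] is Some x then h x else 0.
have kphi u : k (phi u) = h u.
  rewrite /k (negPf (fresh u).1) (negPf (fresh u).2).
  by case: pickP => [z /eqP/inj->//|/(_ u)]; rewrite eqxx.
have kA v : v \in ZA :|: phi @: A -> k v = 0.
  rewrite inE => /orP[|/imsetP[u Au ->]]; first by rewrite /k => ->.
  by rewrite kphi hA.
have kZB v : v \in ZB -> k v = H by move=> Zv; rewrite /k Zv ifN //; apply: contraL Zv; apply: dis.
have kB v : v \in ZB :|: phi @: B -> k v = H.
  by rewrite inE => /orP[/kZB//|/imsetP[u Bu ->]]; rewrite kphi hB.
have kY g u v : g \in Y -> u \in g -> v \in g -> k u <= (k v).+1.
  move=> /up[/subsetP gs|/subsetP gs|[f Mf ->]].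
  - by move=> /gs/kA-> _.
  - by move=> /gs/kB-> /gs/kB->.
  - by move=> /imsetP[u' fu ->] /imsetP[v' fv ->]; rewrite !kphi (hM f).
(* Consecutive edges share a vertex and heights within an edge differ by at most 1, so each step
   raises the maximal height by at most 1. *)
have step m : forall Fs F, cons_path 2 Y S F Fs -> (forall v, v \in F -> k v <= m) ->
    forall v, v \in last F Fs -> k v <= m + size Fs.
  move=> {F Fs Fx ly pF} Fs; elim: Fs m => [|G Fs IHFs] m F /=.
    by move=> _ Fm v /Fm; rewrite addn0.
  rewrite cons_path_cons cons_path_nil => /and4P[/and4P[uF /eqP sF _ _] aFG _ pG] Fm.
  rewrite addnS -addSn; apply: (IHFs _ _ pG) => v Gv.
  have /set0Pn[w] : [set:: F] :&: [set:: G] != set0.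
    case/andP: aFG => /eqP FG _; apply: contraTneq isT => FG0.
    by have := card_set_seq uF; rewrite -(cardsID [set:: G]) FG0 cards0 FG sF.
  rewrite !inE => /andP[Fw Gw]; have [_ _ YG] := cons_path_face pG.
  by apply: leq_trans (kY _ v w YG _ _) _; rewrite ?inE // ltnS Fm.
rewrite -(kZB y yZ) -[size Fs]add0n; apply: (step _ _ _ pF _ _ ly) => v Fv.
have [_ _ YF] := cons_path_face pF.
case: (up _ YF) => [/subsetP Fs0|/subsetP/(_ x)|[f _ FE]].
- by rewrite kA //; apply: Fs0; rewrite inE.
- rewrite !inE Fx (negPf (dis x xZ)) => /(_ isT)/imsetP[u _ xu].
  by case: (fresh u); rewrite -xu xZ.
- have : x \in [set:: F] by rewrite inE.
  by rewrite FE => /imsetP[u _ xu]; case: (fresh u); rewrite -xu xZ.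
Qed.

Section Construction.
Variable R : realType.

(** The triangle is the one-point suspension of two points. Each layer over the whole end edge adds
    two vertices and one level of height. *)
Lemma polygon_ex H : exists (V : finType) (C : {set {set V}}) (A B : {set V}) (h : V -> nat),
  [/\ corridor R 2 C A B, #|V| = 3 + 2 * H,
      forall f u v, f \in C -> u \in f -> v \in f -> h u <= (h v).+1,
      forall u, u \in A -> h u = 0 & forall u, u \in B -> h u = H].
Proof.
elim: H => [|H [V [C [A [B [h [cr Vn hC hA hB]]]]]]].
  have cr := @suspension_corridor R 1 _ _ _ false [set true] isT (realizes_two_points R).
  eexists; eexists; eexists; eexists; exists (fun=> 0); split=> //.
    apply: cr; rewrite ?two_points_setD1 ?two_points_deletion; try exact: vd_simplex.
    - exact: vd_points two_points_pure.
    - by have := powerset_pure [set false]; rewrite cards1.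
    - by have := powerset_pure [set true]; rewrite cards1.
    - by rewrite inE cards1.
    - by rewrite cards1.
    - by rewrite inE.
  by rewrite card_option card_bool.
have [W [C' [B' [i ly]]]] := layer_ex (isT : 1 < 2) (corridor_sym cr) (subxx B).
pose k w := if [pick x | i x == w] is Some x then h x else H.+1.
have iI := ly_inj ly.
have ki u : k (i u) = h u by rewrite /k; case: pickP => [z /eqP/iI->//|/(_ u)]; rewrite eqxx.
have kN w : w \notin i @: setT -> k w = H.+1.
  move=> wT; rewrite /k; case: pickP => // x /eqP xw.
  by case/negP: wT; rewrite -xw imset_f.
exists W, C', (i @: A), B', k; split.
- exact: corridor_sym (ly_cr ly).
- by rewrite (ly_card ly) Vn (cr_Bd cr); lia.
- move=> f u v C'f fu fv; case: (ly_up ly C'f) => [[g Cg fE]|/subsetP fs].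
    move: fu fv; rewrite fE => /imsetP[u' gu ->] /imsetP[v' gv ->].
    by rewrite !ki (hC g).
  have kf w : w \in f -> H <= k w <= H.+1.
    move=> /fs; rewrite inE => /orP[/imsetP[x Bx ->]|]; first by rewrite ki hB ?leqnn ?leqnSn.
    by rewrite inE => /kN->; rewrite leqnn leqnSn.
  by have /andP[_ ku] := kf u fu; have /andP[kv _] := kf v fv; apply: leq_trans ku _.
- by move=> _ /imsetP[x Ax ->]; rewrite ki hA.
- by move=> w; rewrite (ly_A ly) setDv imset0 set0U inE => /kN.
Qed.

(** The increments [4 * d + 2] are the differences of [2 * d ^ 2]; the 5 adjusts the start, a
    polygon with [3 + 2 * H] vertices at [d = 2]. *)
Lemma long_corridor_ex H e : exists (V : finType) (C : {set {set V}}) (A B : {set V}),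
  [/\ corridor R e.+2 C A B, #|V| + 5 = 2 * H + 2 * e.+2 ^ 2,
      far e.+2 (2 ^ e * H) C A B & far e.+2 (2 ^ e * H) C B A].
Proof.
elim: e => [|e [V [C [A [B [cr Vn far1 far2]]]]]].
  have [V [C [A [B [h [cr Vn hC hA hB]]]]]] := polygon_ex H.
  exists V, C, A, B; rewrite mul1n; split=> //; first by rewrite Vn; lia.
    exact: far_height hC hA hB.
  apply: (@far_height _ _ _ _ (fun u => H - h u)).
  - by move=> f u v Cf fu fv; have := hC f v u Cf fv fu; lia.
  - by move=> u /hB->; rewrite subnn.
  - by move=> u /hA->; rewrite subn0.
have [W [C' [A' [B' [cr' Wn [iota [kappa [a [b dbl]]]]]]]]] := doubling_ex (isT : 1 < e.+2) cr.
exists W, C', A', B'; rewrite (expnS 2 e) -mulnA; split=> //.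
- by rewrite Wn; move: Vn; nia.
- exact (far_doubling dbl (ltn0Sn _) far1 far2).
- exact (far_doubling (doubling_sym dbl) (ltn0Sn _) far1 far2).
Qed.

Lemma agree_map_complex (U V W : finType) (phi : U -> V) M A B Y ZA ZB (h : V -> W) :
  injective h -> agree phi M A B Y ZA ZB ->
  agree (h \o phi) M A B (map_complex h Y) (h @: ZA) (h @: ZB).
Proof.
move=> hI [inj dis fresh up low]; split.
- exact: inj_comp.
- by move=> _ /imsetP[v Zv ->]; rewrite mem_imset //; apply: dis.
- by move=> u /=; rewrite !mem_imset.
- move=> _ /imsetP[g Yg ->]; rewrite !(imset_comp h phi) -!imsetU.
  case: (up g Yg) => [gs|gs|[f Mf ->]]; [constructor 1|constructor 2|constructor 3].
  + exact: imsetS.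
  + exact: imsetS.
  + by exists f; rewrite // (imset_comp h phi).
- by move=> f Mf fA fB; rewrite (imset_comp h phi) mem_map_complex // low.
Qed.

(** [far] speaks of paths between vertices beyond the ends; one last stacking at each end provides
    them. *)
Lemma agree_stack (V : finType) (C : {set {set V}}) (A B : {set V}) x : x \in A -> A != B ->
  agree (Some \o Some) C A B
    (stack (map_complex Some (stack (map_complex Some C) (Some @: A) None))
           (Some @: (Some @: B)) None) [set Some None] [set None].
Proof.
move=> Ax AB; have sV := @some_inj V; have sO := @some_inj (option V).
have N0 (T : finType) (G : {set T}) : None \notin (Some @: G : {set option T}).
  by apply/imsetP => -[].
split.
- by move=> ? ? [].
- by move=> v; rewrite !inE => /eqP->.
- by move=> u; rewrite !inE.
- move=> g; rewrite inE; case: ifP => [Ng /proper_sub gB|_ /andP[/imsetP[f + ->] _]].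
    by constructor 2; rewrite -(setD1K Ng) (imset_comp Some Some) setUS.
  rewrite inE; case: ifP => [Nf /proper_sub fA|_ /andP[/imsetP[g0 Cg0 ->] _]].
    constructor 1; rewrite -(setD1K Nf) (imset_comp Some Some) imsetU1.
    by apply: setUS; apply: imsetS.
  by constructor 3; exists g0; rewrite // (imset_comp Some Some).
- move=> f Cf fA fB; rewrite (imset_comp Some Some) inE (negPf (N0 _ _)) mem_map_complex // inE.
  rewrite (negPf (N0 _ _)) mem_map_complex // Cf !(inj_eq (imset_inj sV)) fA.
  by rewrite (inj_eq (imset_inj sO)) (inj_eq (imset_inj sV)) fB.
Qed.

Lemma mono_cons_cons_path d (V : finType) (Y : {set {set V}}) A B F Fs : pure_complex d Y ->
  mono_cons_path Y A B F Fs -> cons_path d Y B F Fs.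
Proof.
move=> pY [/andP[/allP aF pF] _ _ _ cF]; rewrite /cons_path /face_path pF cF !andbT.
apply/allP => G /aF /andP[uG fG]; rewrite uG.
have YG : [set:: G] \in Y by move: fG; rewrite inE => /maxsetP[].
by rewrite YG -(card_set_seq uG) pY.2 ?eqxx.
Qed.

Lemma facet_of_card d (V : finType) (Y : {set {set V}}) F : pure_complex d Y ->
  F \in Y -> #|F| = d -> F \in facets Y.
Proof.
move=> pY YF Fd; rewrite inE; apply/maxsetP; split=> // G YG FG.
by apply: (pure_eq pY).
Qed.

End Construction.

Local Open Scope ring_scope.

Theorem theorem1p5 (R : realType) :
  exists c1 c2 : R, [/\ 0 < c1, 0 < c2 &
    forall d N : nat, (2 <= d)%N -> (4 <= N)%N ->
    exists (n : nat) (p : 'I_n -> 'rV[R]_d),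
      [/\ simplicial_polytope p,
          c1 * d%:R ^+ 2 <= n%:R - N%:R <= c2 * d%:R ^+ 2,
          vertex_decomposable (boundary_complex p) &
          exists F1 F2 : {set 'I_n},
            [/\ F1 \in facets (boundary_complex p),
                F2 \in facets (boundary_complex p) &
                forall (F : seq 'I_n) (Fs : seq (seq 'I_n)),
                  mono_cons_path_between (boundary_complex p) F1 F2 F Fs ->
                  (2 : R) ^ (d%:Z - 3) * N%:R <= (size Fs)%:R]]].
Proof.
(* The difference [n - N] will be [2 * d ^ 2 - 3] or [2 * d ^ 2 - 2], which lies between [d ^ 2] and
   [2 * d ^ 2] for [d >= 2]. *)
exists 1, 2; split=> // d N; case: d => [|[|e]] // _ N4.
(* A polygon of height [H] has about [2 * H] vertices, so [H] is half of [N] rounded up; this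
   halving turns the factor [2 ^ (d - 2)] into [2 ^ (d - 3)]. *)
have [V [C [A [B [cr Vn far1 far2]]]]] := long_corridor_ex R (uphalf N) e.
have [x Ax] : exists x, x \in A by apply/set0Pn; rewrite -card_gt0 (cr_Ad cr).
have [y By] : exists y, y \in B by apply/set0Pn; rewrite -card_gt0 (cr_Bd cr).
have sV := @some_inj V; have sO := @some_inj (option V).
have cr1 := stack_corridor (isT : 1 < e.+2)%N cr Ax.
have By' : Some y \in (Some @: B : {set option V}) by rewrite mem_imset.
have := stack_corridor (isT : 1 < e.+2)%N (corridor_sym cr1) By'.
set Y := stack _ (Some @: (Some @: B)) None; set F2 := None |: _; set F1 := Some @: _ => crY.
have agrY : agree (Some \o Some) C A B Y [set Some None] [set None].
  exact: agree_stack Ax (cr_AB cr).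
have tF2 : None \in F2 by rewrite !inE.
have sF1 : Some None \in F1 by rewrite mem_imset // !inE.
have F1s : F1 \subset [set Some None] :|: (Some \o Some) @: A.
  by rewrite /F1 imsetU1 (imset_comp Some Some); apply: setUS; do 2!apply: imsetS; apply: subD1set.
have F2s : F2 \subset [set None] :|: (Some \o Some) @: B.
  by rewrite /F2 (imset_comp Some Some); apply: setUS; apply: imsetS; apply: subD1set.
have [p rp] := cr_real crY; pose T : finType := option (option V).
pose n := #|T|; pose h : T -> 'I_n := enum_rank; have hI : injective h := enum_rank_inj.
have rq := realizes_rename enum_rankK enum_valK rp.
have pq := rz_pure rq.
exists n, (p \o enum_val); rewrite (realizes_boundary rq) //; split.
- exact: realizes_simplicial_polytope rq _.
- have Nu : (2 * uphalf N = N + odd N)%N.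
    by rewrite uphalf_half mul2n doubleD -[in RHS](odd_double_half N); case: (odd N); lia.
  have nE : (n + 3 = N + odd N + 2 * e.+2 ^ 2)%N by rewrite -Nu -Vn /n !card_option; lia.
  have d4 : (4 <= e.+2 ^ 2)%N by rewrite (@leq_exp2r 2 e.+2 2).
  have [lo up] : (N + e.+2 ^ 2 <= n)%N /\ (n <= N + 2 * e.+2 ^ 2)%N.
    by move: nE; case: (odd N) => /=; lia.
  by rewrite mul1r lerBrDl lerBlDl -!natrX -natrM -!natrD !ler_nat lo up.
- exact: vd_map_complex hI _ (cr_vd crY).
exists (h @: F1), (h @: F2).
have hF (F : {set T}) : F \in Y -> #|F| = e.+2 -> h @: F \in facets (map_complex h Y).
  by move=> YF Fd; apply: facet_of_card pq _ _; rewrite ?mem_map_complex ?card_imset.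
split.
- exact: hF (cr_B crY) (cr_Bd crY).
- exact: hF (cr_A crY) (cr_Ad crY).
have agr := agree_map_complex hI agrY; have [scY _] := pq.
move=> F Fs; suff bound : mono_cons_path_between (map_complex h Y) (h @: F1) (h @: F2) F Fs ->
    (2 ^ e * uphalf N <= size Fs)%N.
  move=> /bound; rewrite -(ler_nat R); apply: le_trans.
  have -> : e.+2%:Z - 3 = e%:Z + (-1) by rewrite -addn2 PoszD -addrA.
  rewrite expfzDr ?pnatr_eq0 // natrM natrX -exprnP -mulrA ler_pM2l ?exprn_gt0 ?ltr0n //.
  rewrite exprN1 mulrC ler_pdivrMr ?ltr0n // -natrM ler_nat uphalf_half.
  by rewrite -[leqLHS](odd_double_half N) mulnC mul2n doubleD; case: (odd N); lia.
case=> mc; have pF := mono_cons_cons_path pq mc; case: mc => _ FE lE _ _.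
  apply: far1 agr scY _ pF _ _.
  - by rewrite (imset_comp h (Some \o Some)) -imsetU; apply: imsetS.
  - by exists (h (Some None)); rewrite ?imset_set1 ?in_set1 // -[_ \in F](in_set (mem F)) FE mem_imset.
  - exists (h None); rewrite imset_set1 in_set1 eqxx mem_imset // tF2.
    by rewrite -[_ \in last _ _](in_set (mem (last F Fs))) lE mem_imset.
apply: far2 (agree_sym agr) scY _ pF _ _.
- by rewrite (imset_comp h (Some \o Some)) -imsetU; apply: imsetS.
- by exists (h None); rewrite ?imset_set1 ?in_set1 // -[_ \in F](in_set (mem F)) FE mem_imset.
- exists (h (Some None)); rewrite imset_set1 in_set1 eqxx mem_imset // sF1.
  by rewrite -[_ \in last _ _](in_set (mem (last F Fs))) lE mem_imset.
Qed.
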